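(* Let $L\in(0,2\pi)$ be fixed and let $(\phi_0,\phi_1)\in Y=H^1_{per,m}\times L^2_{per,m}$. There exists a unique global (weak) solution $\phi$ of the Cauchy problem $$\phi_{tt}-\phi_{xx}-\phi+\phi^3=0\ \text{ in }[0,L]\times(0,+\infty),\qquad \phi(x,0)=\phi_0(x),\quad \phi_t(x,0)=\phi_1(x)\ \text{ in }[0,L],$$ satisfying $(\phi,\phi_t)\in C([0,+\infty),Y)$.
   Context: $L^2_{per}$ is the space of real square-integrable $L$-periodic functions; for $s\ge0$, $H^s_{per}$ is the Sobolev space of real $L$-periodic functions with $\|f\|_{H^s_{per}}^2=L\sum_{n\in\mathbb{Z}}(1+n^2)^s|\hat f(n)|^2<\infty$; $H^s_{per,m}=\{f\in H^s_{per}:\int_0^Lf\,dx=0\}$, $L^2_{per,m}=H^0_{per,m}$, and $H^{-1}_{per,m}=(H^1_{per,m})'$. Notion of global weak solution: for every $p\in H^1_{per,m}$ and a.e. $t\in[0,+\infty)$, $$\langle\phi_{tt}(\cdot,t),p\rangle_{H^{-1}_{per,m},H^1_{per,m}}+\int_0^L\phi_x(x,t)p_x(x)\,dx-\int_0^L\phi(x,t)p(x)\,dx+\int_0^L\phi(x,t)^3p(x)\,dx=0,$$ together with the initial conditions $(\phi(0),\phi_t(0))=(\phi_0,\phi_1)$. Test functions have zero mean, so the equation is only tested modulo (time-dependent) constants in $x$. *)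

(* Defs.v *)
From HB Require Import structures.
From mathcomp Require Import all_boot all_order all_algebra.
From mathcomp Require Import all_classical all_reals all_analysis.
From mathcomp Require Import complex.

Set Implicit Arguments.
Unset Strict Implicit.
Unset Printing Implicit Defensive.

Import Order.TTheory GRing.Theory Num.Theory.
Import numFieldNormedType.Exports.

Local Open Scope classical_set_scope.
Local Open Scope ring_scope.

(* Elements of the function spaces are represented by functions R -> R; two
   representatives are identified when they agree almost everywhere. *)

Section PeriodicSobolev.
Context {R : realType}.
Notation mu := (@lebesgue_measure R).

Definition eq_ae (f g : R -> R) : Prop := {ae mu, forall x, f x = g x}.

Definition L2_per (L : R) : set (R -> R) := [set f : R -> R |
  [/\ measurable_fun setT f, periodic f L &
      mu.-integrable `[0, L] (fun x => (f x ^+ 2)%:E)]].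

(* 1/L \int_0^L f(x) e^{-2 pi i n x / L} dx *)
Definition fourier_coef (L : R) (f : R -> R) (n : int) : R[i] :=
  ((L^-1 * \int[mu]_(x in `[0, L]) (f x * cos (2 * pi * n%:~R * x / L)))
   +i* (- (L^-1 * \int[mu]_(x in `[0, L]) (f x * sin (2 * pi * n%:~R * x / L)))))%C.

Definition Hs_sqnorm (L s : R) (f : R -> R) : \bar R :=
  (L%:E * \esum_(n in [set: int])
     (((1 + n%:~R ^+ 2) `^ s) * Normc.normc (fourier_coef L f n) ^+ 2)%:E)%E.

Definition Hs_per (L s : R) : set (R -> R) :=
  [set f | L2_per L f /\ (Hs_sqnorm L s f < +oo)%E].

Definition Hs_per_m (L s : R) : set (R -> R) :=
  [set f | Hs_per L s f /\ \int[mu]_(x in `[0, L]) f x = 0].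

(* Meaningful on [Hs_per L s] only: [fine] sends +oo to 0. *)
Definition Hs_norm (L s : R) (f : R -> R) : R := Num.sqrt (fine (Hs_sqnorm L s f)).

(* Y = H^1_{per,m} x L^2_{per,m}, with L^2_{per,m} = H^0_{per,m} *)
Definition Y_space (L : R) : set ((R -> R) * (R -> R)) :=
  Hs_per_m L 1 `*` Hs_per_m L 0.

Definition Y_norm (L : R) (u : (R -> R) * (R -> R)) : R :=
  Num.sqrt (Hs_norm L 1 u.1 ^+ 2 + Hs_norm L 0 u.2 ^+ 2).

(* (u, v) \in C([0, +oo), Y); values at negative times are irrelevant *)
Definition continuous_Y (L : R) (u v : R -> R -> R) : Prop :=
  (forall t, 0 <= t -> Y_space L (u t, v t)) /\
  (forall t0, 0 <= t0 ->
    Y_norm L (u t \- u t0, v t \- v t0)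
      @[t --> within [set t | 0 <= t] (nbhs t0)] --> (0 : R)).

(* H^{-1}_{per,m}, the dual of H^1_{per,m}. Only the values of a functional on
   H^1_{per,m} matter; boundedness makes it compatible with [eq_ae]. *)
Definition Hm1_per_m (L : R) : set ((R -> R) -> R) := [set w |
  (forall (a : R) p q, Hs_per_m L 1 p -> Hs_per_m L 1 q ->
     w (a \*: p \+ q) = a * w p + w q) /\
  (exists C : R, forall p, Hs_per_m L 1 p -> `|w p| <= C * Hs_norm L 1 p)].

Definition Hm1_norm (L : R) (w : (R -> R) -> R) : \bar R :=
  ereal_sup [set `|w p|%:E | p in [set p | Hs_per_m L 1 p /\ Hs_norm L 1 p <= 1]].

(* L^1_loc([0, +oo); H^{-1}_{per,m}). The predual H^1_{per,m} is separable and
   reflexive, so weak and Bochner measurability coincide (Pettis). *)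
Definition L1loc_Hm1 (L : R) (w : R -> (R -> R) -> R) : Prop :=
  [/\ forall t, 0 <= t -> Hm1_per_m L (w t),
      forall p, Hs_per_m L 1 p ->
        measurable_fun `[(0 : R), +oo[ (fun t => w t p) &
      forall T, 0 < T -> mu.-integrable `[0, T] (fun t => Hm1_norm L (w t))].

Definition is_C1 (f : R -> R) : Prop :=
  (forall x, derivable f x 1) /\ continuous (derive1 f).

Definition is_weak_dx (L : R) (f g : R -> R) : Prop :=
  L2_per L g /\
  forall q : R -> R, periodic q L -> is_C1 q ->
    \int[mu]_(x in `[0, L]) (f x * derive1 q x) =
    - \int[mu]_(x in `[0, L]) (g x * q x).

(* A representative of the weak derivative f_x, unique up to [eq_ae] when it
   exists (in particular for f in H^1_per), and 0 by convention otherwise. *)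
Definition weak_dx (L : R) (f : R -> R) : R -> R :=
  xget (cst 0) [set g | is_weak_dx L f g].

(* C^1_c((0, +oo)) *)
Definition time_test (theta : R -> R) : Prop :=
  is_C1 theta /\
  exists a b : R, 0 < a /\ forall t, ~ (a <= t <= b) -> theta t = 0.

(* U' = V in the sense of distributions on (0, +oo) *)
Definition is_weak_dt (U V : R -> R) : Prop :=
  forall theta, time_test theta ->
    \int[mu]_(t in `]0, +oo[) (U t * derive1 theta t) =
    - \int[mu]_(t in `]0, +oo[) (V t * theta t).

Definition pairing (L : R) (f p : R -> R) : R := \int[mu]_(x in `[0, L]) (f x * p x).

(* [phit] is the derivative of [phi] as a map from (0, +oo) to L^2_{per,m}, and
   [phitt] the derivative of [phit] as a map from (0, +oo) to H^{-1}_{per,m},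
   where L^2_{per,m} embeds in H^{-1}_{per,m} by f |-> \int_0^L f p dx.
   Vector-valued derivatives are tested against the dual of the target. *)
Definition is_phit (L : R) (phi phit : R -> R -> R) : Prop :=
  forall p, Hs_per_m L 0 p ->
    is_weak_dt (fun t => pairing L (phi t) p) (fun t => pairing L (phit t) p).

Definition is_phitt (L : R) (phit : R -> R -> R) (phitt : R -> (R -> R) -> R) : Prop :=
  L1loc_Hm1 L phitt /\
  forall p, Hs_per_m L 1 p ->
    is_weak_dt (fun t => pairing L (phit t) p) (fun t => phitt t p).

Definition weak_equation (L : R) (phi : R -> R -> R)
    (phitt : R -> (R -> R) -> R) : Prop :=
  forall p, Hs_per_m L 1 p ->
    {ae mu, forall t, 0 <= t ->
      phitt t p
      + \int[mu]_(x in `[0, L]) (weak_dx L (phi t) x * weak_dx L p x)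
      - \int[mu]_(x in `[0, L]) (phi t x * p x)
      + \int[mu]_(x in `[0, L]) (phi t x ^+ 3 * p x) = 0}.

(* [phi t x] stands for phi(x, t). *)
Definition global_weak_solution (L : R) (phi0 phi1 : R -> R)
    (phi : R -> R -> R) : Prop :=
  exists (phit : R -> R -> R) (phitt : R -> (R -> R) -> R),
    [/\ continuous_Y L phi phit,
        is_phit L phi phit,
        is_phitt L phit phitt,
        weak_equation L phi phitt &
        eq_ae (phi 0) phi0 /\ eq_ae (phit 0) phi1].

End PeriodicSobolev.

(* Main.v *)
(* Expanding in an orthonormal trigonometric basis of the mean-zero functions
   turns the equation into the system a_k'' + lam_k a_k = a_k - (phi^3)_k.
   Since the sum of 1 / lam_k is finite, sup |phi|^2 is controlled by the energy
   sum_k (a_k'^2 + lam_k a_k^2), so once the cube is truncated at a height K the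
   right-hand side is globally Lipschitz for the energy norm, and Picard iteration
   in an exponentially weighted norm gives a global solution. Because L < 2 pi,
   every lam_k exceeds 1, and the conserved quantity
   sum_k (a_k'^2 + (lam_k - 1) a_k^2) + 2 int G_K(phi), where G_K >= 0 is the
   primitive of the truncated cube, bounds sup |phi| independently of K: for K
   large the truncation is never active. Conversely, testing with the basis and
   the du Bois-Reymond lemma in time show that the coefficients of any weak
   solution solve the same system; the energy estimate for the difference of two
   solutions, whose cubes are Lipschitz on bounded time intervals, then gives
   uniqueness. The Riesz-Fischer theorem and the completeness of the
   trigonometric system translate between functions and coefficients. *)

Require Import Defs.
From mathcomp Require Import all_boot all_order all_algebra.
From mathcomp Require Import all_classical all_reals all_analysis.
From mathcomp Require Import measurable_realfun complex ring lra.
Import Order.TTheory GRing.Theory Num.Theory.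
Import numFieldNormedType.Exports.
Local Open Scope classical_set_scope.
Local Open Scope ring_scope.

(** * Calculus on the half-line *)

Section Calculus.
Set Implicit Arguments.
Unset Strict Implicit.
Context {R : realType}.
Notation mu := (@lebesgue_measure R).
Implicit Types (x t : R).

(** Energy estimates only involve finite sums of modes; a bound on the total energy is a bound on
    all partial sums. This works for the linear part because the identity E' = 2 sum h_k a_k' holds
    exactly for every finite set of modes. The nonlinear energy does not restrict to finitely many
    modes in this way, since the cube couples all of them: its conservation is replaced by an
    almost-conservation for partial sums, and the potential is differentiated through a quadratic
    Taylor remainder rather than under the integral sign.

    The truncation height has to be fixed before a solution exists, so the a priori bound must not
    depend on it. This is why the truncated cube is kept monotone, with a primitive lying between 0
    and s^4 / 4. With w = 2 pi / L > 1 one has (1 - w^-2) lam_k <= lam_k - 1, which recovers the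
    full energy from the conserved one.

    Test functions of zero mean see the equation modulo constants, so the constant mode is absent
    from the basis; the mean of the cube, nonzero in general, is not seen by the coefficients. *)

Lemma eq_ler d (T : porderType d) (y z : T) : y = z -> (y <= z)%O.
Proof. by move=> ->. Qed.

Lemma continuous_add (T : topologicalType) (f g : T -> R) : continuous f -> continuous g ->
  continuous (fun y => f y + g y).
Proof. by move=> cf cg x; apply: cvgD; [exact: cf|exact: cg]. Qed.

Lemma continuous_mul (T : topologicalType) (f g : T -> R) : continuous f -> continuous g ->
  continuous (fun y => f y * g y).
Proof. by move=> cf cg x; apply: cvgM; [exact: cf|exact: cg]. Qed.

Lemma continuous_scale (T : topologicalType) (c : R) (f : T -> R) : continuous f ->
  continuous (fun y => c * f y).
Proof. by move=> cf; apply: continuous_mul => //; exact: cst_continuous. Qed.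

Lemma continuous_sub (T : topologicalType) (f g : T -> R) : continuous f -> continuous g ->
  continuous (fun y => f y - g y).
Proof. by move=> cf cg x; apply: cvgB; [exact: cf|exact: cg]. Qed.

Lemma continuous_sqr (T : topologicalType) (f : T -> R) : continuous f ->
  continuous (fun y => f y ^+ 2).
Proof. by move=> cf; under eq_fun do rewrite expr2; exact: continuous_mul. Qed.

Lemma is_derive_add (f g : R -> R) x (df dg : R) : is_derive x 1 f df -> is_derive x 1 g dg ->
  is_derive x 1 (fun y => f y + g y) (df + dg).
Proof. by move=> hf hg; exact: is_deriveD. Qed.

Lemma is_derive_mul (f g : R -> R) x (df dg : R) : is_derive x 1 f df -> is_derive x 1 g dg ->
  is_derive x 1 (fun y => f y * g y) (f x * dg + g x * df).
Proof. by move=> hf hg; exact: is_deriveM. Qed.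

Lemma is_derive_congr (f g : R -> R) x (df dg : R) : is_derive x 1 f df ->
  f =1 g -> df = dg -> is_derive x 1 g dg.
Proof. by move=> h /funext <- <-. Qed.

Lemma is_derive_scale (f : R -> R) x (c df : R) : is_derive x 1 f df ->
  is_derive x 1 (fun y => c * f y) (c * df).
Proof. by move=> hf; exact: is_deriveZ. Qed.

Lemma is_derive_bigsum (s : seq nat) (h dh : nat -> R -> R) x :
  (forall k, is_derive x 1 (h k) (dh k x)) ->
  is_derive x 1 (fun y => \sum_(k <- s) h k y) (\sum_(k <- s) dh k x).
Proof.
move=> hd; elim: s => [|k s IH].
  rewrite big_nil; under eq_fun do rewrite big_nil; exact: is_derive_cst.
rewrite big_cons; under eq_fun do rewrite big_cons; exact: is_derive_add.
Qed.

Lemma is_derive_expZ x (c : R) : is_derive x 1 (fun y => expR (c * y)) (c * expR (c * x)).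
Proof.
have h : is_derive x (1 : R) (fun y : R => c * y) (c * 1).
  by apply: is_derive_scale; exact: is_derive_id.
have := is_derive1_comp (is_derive_expR (c * x)) h.
by rewrite mulr1 mulrC.
Qed.

Lemma is_derive_continuous (f : R -> R) x (df : R) : is_derive x 1 f df -> {for x, continuous f}.
Proof. by move=> [h _]; exact/differentiable_continuous/derivable1_diffP. Qed.

(* [continuous (fun t => f `|t|)] encodes continuity of [f] on the half-line [0, +oo). *)
Lemma continuous_halfline_within (f : R -> R) (s t : R) : 0 <= s ->
  continuous (fun y : R => f `|y|) -> {within `[s, t], continuous f}.
Proof.
move=> s0 cf; apply: (@subspace_eq_continuous R^o `[s, t] R^o (fun y : R => f `|y|)).
  by move=> y /set_mem /=; rewrite in_itv/= => /andP[sy _]; rewrite /= ger0_norm// (le_trans s0).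
exact: continuous_subspaceT.
Qed.

(** The mean value theorem integrates differential inequalities without any integrability assumption
    on the derivative. *)
Lemma growth_le (f : R -> R) (df : R -> R) (C s t : R) : 0 <= s -> s <= t ->
  continuous (fun y : R => f `|y|) ->
  (forall x, 0 < x -> is_derive x 1 f (df x)) ->
  (forall x, s < x < t -> df x <= C) -> f t - f s <= C * (t - s).
Proof.
move=> s0; rewrite le_eqVlt => /orP[/eqP<- _ _ _|st cf hd hC]; first by rewrite !subrr mulr0.
have [|c ct ->] := @MVT R f df s t st _ (@continuous_halfline_within f s t s0 cf).
  by move=> x; rewrite in_itv/= => /andP[sx _]; apply: hd; rewrite (le_lt_trans s0).
by rewrite ler_wpM2r ?subr_ge0 ?(ltW st)// hC.
Qed.

Lemma growth_abs_le (f : R -> R) (df : R -> R) (C s t : R) : 0 <= s -> s <= t ->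
  continuous (fun y : R => f `|y|) ->
  (forall x, 0 < x -> is_derive x 1 f (df x)) ->
  (forall x, s < x < t -> `|df x| <= C) -> `|f t - f s| <= C * (t - s).
Proof.
move=> s0 st cf hd hC; rewrite ler_norml; apply/andP; split; last first.
  by apply: (@growth_le f df) => // x /hC; apply: le_trans; exact: ler_norm.
rewrite lerNl opprB.
have := @growth_le (fun y => -1 * f y) (fun y => -1 * df y) C s t s0 st.
rewrite !mulN1r opprK addrC; apply.
- exact: continuous_scale.
- by move=> x x0; apply: is_derive_scale; exact: hd.
- by move=> x /hC; rewrite mulN1r; apply: le_trans; rewrite -normrN ler_norm.
Qed.

Lemma primitive_halfline (h : R -> R) : continuous h ->
  exists H : R -> R, H 0 = 0 /\ forall t, 0 <= t -> is_derive t 1 H (h t).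
Proof.
(* Integrating from -1 makes 0 an interior point, so that the derivative at 0 is two-sided. *)
move=> ch; pose G t := \int[mu]_(s in [set` `[-1, t]]) h s.
exists (fun t => G t - G 0); split; first by rewrite subrr.
move=> t t0.
have ih : mu.-integrable `[-1, t + 1] (EFin \o h).
  apply: continuous_compact_integrable; first exact: segment_compact.
  exact: continuous_subspaceT.
have t1 : t < t + 1 by rewrite ltrDl.
have t2 : -1 < t by rewrite (lt_le_trans _ t0)// ltrN10.
have [] : derivable G t 1 /\ derive1 G t = h t.
  exact: (@continuous_FTC1_closed R h (-1) t (t + 1) t1 ih t2 (ch t)).
clearbody G => dG G'.
have dG' : is_derive t 1 G (h t) by rewrite -G' derive1E; exact/derivableP.
have := is_derive_add dG' (is_derive_cst (- G 0) t 1).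
by rewrite addr0.
Qed.

End Calculus.

(** * Infinite systems of oscillators *)

Section Oscillators.
Context {R : realType}.
Set Implicit Arguments.
Unset Strict Implicit.
Implicit Types (lam : nat -> R) (a b h : nat -> R -> R) (t : R).

(* Mode by mode, [a'' + lam a = h] with [b = a']. *)
Definition oscillators lam a b h : Prop :=
  [/\ forall k, continuous (fun t : R => a k `|t|),
      forall k, continuous (fun t : R => b k `|t|),
      forall k (t : R), 0 < t -> is_derive t 1 (a k) (b k t) &
      forall k (t : R), 0 < t -> is_derive t 1 (b k) (- lam k * a k t + h k t)].

(** The sum runs over an arbitrary list of modes: initial segments measure the whole trajectory,
    segments starting at [m] its tail. *)
Definition energy lam a b (s : seq nat) (t : R) : R :=
  \sum_(k <- s) (b k t ^+ 2 + lam k * a k t ^+ 2).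

Lemma continuous_sum_halfline (s : seq nat) (h : nat -> R -> R) :
  (forall k, continuous (fun t : R => h k `|t|)) ->
  continuous (fun t : R => \sum_(k <- s) h k `|t|).
Proof.
move=> hc; elim: s => [|k s IH].
  under eq_fun do rewrite big_nil; exact: cst_continuous.
under eq_fun do rewrite big_cons.
exact: continuous_add.
Qed.

(** The exchanges between kinetic and potential energy cancel mode by mode, and only the work of the
    source remains. *)
Lemma oscillators_energy lam a b h s : oscillators lam a b h ->
  continuous (fun t : R => energy lam a b s `|t|) /\
  forall t : R, 0 < t -> is_derive t 1 (energy lam a b s)
     (2 * \sum_(k <- s) h k t * b k t).
Proof.
move=> [ca cb da db]; split.
  apply: (@continuous_sum_halfline s (fun k t => b k t ^+ 2 + lam k * a k t ^+ 2)).
  move=> k; apply: continuous_add; first exact: continuous_sqr.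
  exact/continuous_scale/continuous_sqr.
move=> t t0; rewrite mulr_sumr.
apply: (@is_derive_bigsum _ s (fun k t => b k t ^+ 2 + lam k * a k t ^+ 2)
  (fun k t => 2 * (h k t * b k t))) => k.
have h1 := is_derive_mul (db k t t0) (db k t t0).
have h2 := is_derive_scale (lam k) (is_derive_mul (da k t t0) (da k t t0)).
by apply: (is_derive_congr (is_derive_add h1 h2)) => [y|]; rewrite ?expr2//; ring.
Qed.

(** Young's inequality with a free parameter [c], which the applications tune. *)
Lemma sum_prod_le (s : seq nat) (x y : nat -> R) (c : R) : 0 < c ->
  2 * \sum_(k <- s) x k * y k <=
  c * \sum_(k <- s) y k ^+ 2 + c^-1 * \sum_(k <- s) x k ^+ 2.
Proof.
move=> c0; rewrite !mulr_sumr -big_split /=; apply: ler_sum => k _.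
rewrite -subr_ge0.
have -> : c * y k ^+ 2 + c^-1 * x k ^+ 2 - 2 * (x k * y k)
   = c^-1 * (c * y k - x k) ^+ 2 by field; rewrite gt_eqF.
by rewrite mulr_ge0 ?sqr_ge0// invr_ge0 ltW.
Qed.

Lemma energy_kinetic_le lam a b s t : (forall k, 0 <= lam k) ->
  \sum_(k <- s) b k t ^+ 2 <= energy lam a b s t.
Proof.
by move=> l0; apply: ler_sum => k _; rewrite lerDl mulr_ge0 ?sqr_ge0 ?l0.
Qed.

Lemma energy_potential_le lam a b s t :
  \sum_(k <- s) lam k * a k t ^+ 2 <= energy lam a b s t.
Proof. by apply: ler_sum => k _; rewrite lerDr sqr_ge0. Qed.

(* Gronwall in exponentially weighted form: the factor [4 / LL ^+ 2] becomes a
   contraction constant when [LL] is large. *)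
Lemma energy_growth lam a b h s (LL T E0 Q : R) : (forall k, 0 <= lam k) ->
  oscillators lam a b h -> 0 < LL -> 0 <= T -> 0 <= E0 -> 0 <= Q ->
  energy lam a b s 0 <= E0 ->
  (forall t : R, 0 < t < T -> \sum_(k <- s) h k t ^+ 2 <= Q * expR (LL * t)) ->
  energy lam a b s T <= expR (LL * T) * (E0 + 4 / LL ^+ 2 * Q).
Proof.
move=> l0 osc L0 T0 E00 Q0 hE0 hh.
have [cE dE] := oscillators_energy s osc.
pose m := LL / 2.
(* Young's inequality with parameter [m] gives E' <= m E + Q e^(2 m t) / m. Multiplied by e^(-m t),
   this says that [f] is nonincreasing, since 4 / LL^2 = 1 / m^2. *)
pose f t := expR (- m * t) * energy lam a b s t - 4 / LL ^+ 2 * Q * expR (m * t).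
pose df t := expR (- m * t) * (2 * \sum_(k <- s) h k t * b k t)
  + energy lam a b s t * (- m * expR (- m * t)) - 4 / LL ^+ 2 * Q * (m * expR (m * t)).
have dexp c t := is_derive_expZ (R := R) t c.
have cexp c : continuous (fun t : R => expR (c * `|t|)).
  move=> t; apply: (@continuous_comp _ _ _ (fun t : R => `|t|) (fun x => expR (c * x))).
    exact: norm_continuous.
  exact: (is_derive_continuous (dexp _ _)).
have f0 : f 0 = energy lam a b s 0 - 4 / LL ^+ 2 * Q.
  by rewrite /f !mulr0 expR0 mulr1 mul1r.
have : f T - f 0 <= 0 * (T - 0).
  apply: (@growth_le _ f df 0 0 T (lexx 0) T0).
  - apply: continuous_sub; last exact: continuous_scale.
    exact: continuous_mul.
  - move=> t t0; rewrite /f.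
    have h1 := is_derive_mul (dexp (- m) t) (dE t t0).
    have h2 := is_derive_scale (- (4 / LL ^+ 2 * Q)) (dexp m t).
    by apply: (is_derive_congr (is_derive_add h1 h2)) => [y|]; rewrite ?/df; ring.
  - move=> t tT; have m0 : 0 < m by rewrite /m divr_gt0.
    have h1 := sum_prod_le s (h^~ t) (b^~ t) m0.
    have h2 := energy_kinetic_le a b s t l0.
    have h3 := hh t tT.
    have eE : expR (LL * t) = expR (m * t) * expR (m * t).
      by rewrite -expRD /m; congr expR; field.
    rewrite eE in h3.
    have h4 : 2 * \sum_(k <- s) h k t * b k t <=
       m * energy lam a b s t + m^-1 * (Q * (expR (m * t) * expR (m * t))).
      apply: (le_trans h1); apply: lerD; first by rewrite ler_pM2l.
      by rewrite ler_pM2l ?invr_gt0.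
    have e0 := expR_gt0 (- m * t).
    have eN : expR (- m * t) * expR (m * t) = 1.
      by rewrite -expRD mulNr addNr expR0.
    move: h4; rewrite -(ler_pM2l e0) => h4.
    rewrite /df lerBlDr add0r.
    apply: (@le_trans _ _ (expR (- m * t) * expR (m * t) * (m^-1 * Q * expR (m * t)))).
      by move: h4; set X := \sum_(_ <- _) _; set Z := energy _ _ _ _ _; lra.
    rewrite eN mul1r; apply: eq_ler.
    by rewrite /m; field; rewrite gt_eqF.
rewrite mul0r f0 /f => hf.
have m0 : 0 <= m * T by rewrite mulr_ge0// /m divr_ge0 ?ltW.
have e1 : 1 <= expR (m * T) by rewrite -[leLHS]expR0 ler_expR.
have eE : expR (LL * T) = expR (m * T) * expR (m * T).
  by rewrite -expRD /m; congr expR; field.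
have eN : expR (m * T) * expR (- m * T) = 1.
  by rewrite -expRD mulNr addrN expR0.
have C0 : 0 <= 4 / LL ^+ 2 * Q by rewrite mulr_ge0// divr_ge0// exprn_ge0// ltW.
have : expR (m * T) * (expR (- m * T) * energy lam a b s T) <=
       expR (m * T) * (E0 + 4 / LL ^+ 2 * Q * expR (m * T)).
  by rewrite ler_pM2l ?expR_gt0//; move: hf hE0 C0; set X := _ * Q; lra.
rewrite mulrA eN mul1r => /le_trans; apply.
rewrite eE -[leRHS]mulrA ler_pM2l ?expR_gt0// [leRHS]mulrDr [_ * (_ * Q)]mulrC lerD2r.
exact: ler_peMl.
Qed.

End Oscillators.

(** * Linear oscillators and continuity in the energy norm *)

Section StrongContinuity.
Context {R : realType}.
Set Implicit Arguments.
Unset Strict Implicit.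
Implicit Types (lam : nat -> R) (a b h : nat -> R -> R) (t : R) (N : nat).

Lemma oscillator_solution (l a0 b0 : R) (h : R -> R) : 0 < l -> continuous h ->
  exists a b : R -> R, [/\ a 0 = a0, b 0 = b0,
    forall t, 0 <= t -> is_derive t 1 a (b t) &
    forall t, 0 <= t -> is_derive t 1 b (- l * a t + h t)].
Proof.
move=> l0 ch; pose w := Num.sqrt l.
have w0 : 0 < w by rewrite sqrtr_gt0.
have w2 : w ^+ 2 = l by rewrite sqr_sqrtr// ltW.
have dw t : is_derive t (1 : R) (fun y : R => w * y) (w * 1).
  by apply: is_derive_scale; exact: is_derive_id.
have dcos t : is_derive t (1 : R) (fun y => cos (w * y)) (- w * sin (w * t)).
  apply: (is_derive_congr (is_derive1_comp (is_derive_cos (w * t)) (dw t))) => //=.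
  by ring.
have dsin t : is_derive t (1 : R) (fun y => sin (w * y)) (w * cos (w * t)).
  apply: (is_derive_congr (is_derive1_comp (is_derive_sin (w * t)) (dw t))) => //=.
  by ring.
have [P [P0 dP]] : exists H : R -> R, H 0 = 0 /\
    forall t, 0 <= t -> is_derive t 1 H (cos (w * t) * h t).
  apply: primitive_halfline; apply: continuous_mul => // t.
  exact: (is_derive_continuous (dcos t)).
have [Q [Q0 dQ]] : exists H : R -> R, H 0 = 0 /\
    forall t, 0 <= t -> is_derive t 1 H (sin (w * t) * h t).
  apply: primitive_halfline; apply: continuous_mul => // t.
  exact: (is_derive_continuous (dsin t)).
(* Variation of constants: the Duhamel integral of sin (w (t - s)) h(s) / w, with the sine of the
   difference expanded so that [P] and [Q] are plain primitives. *)
exists (fun t => (a0 - w^-1 * Q t) * cos (w * t) + (w^-1 * b0 + w^-1 * P t) * sin (w * t)).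
exists (fun t => (b0 + P t) * cos (w * t) + (- w * a0 + Q t) * sin (w * t)).
have cst t (c : R) : is_derive t (1 : R) (fun=> c) 0 by exact: is_derive_cst.
split.
- by rewrite Q0 P0 !mulr0 cos0 sin0; ring.
- by rewrite Q0 P0 !mulr0 cos0 sin0; ring.
- move=> t t0.
  have h1 := is_derive_mul (is_derive_add (cst t a0) (is_derive_scale (- w^-1) (dQ t t0))) (dcos t).
  have h2 := is_derive_mul (is_derive_add (cst t (w^-1 * b0)) (is_derive_scale (w^-1) (dP t t0))) (dsin t).
  by apply: (is_derive_congr (is_derive_add h1 h2)) => [y|] /=; [ring|field; rewrite gt_eqF].
- move=> t t0.
  have h1 := is_derive_mul (is_derive_add (cst t b0) (dP t t0)) (dcos t).
  have h2 := is_derive_mul (is_derive_add (cst t (- w * a0)) (dQ t t0)) (dsin t).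
  apply: (is_derive_congr (is_derive_add h1 h2)) => [y|] /=; first by ring.
  have := cos2Dsin2 (w * t); rewrite -w2.
  set c := cos _; set s := sin _ => cs.
  transitivity (- w ^+ 2 * ((a0 - w^-1 * Q t) * c + (w^-1 * b0 + w^-1 * P t) * s) + (c ^+ 2 + s ^+ 2) * h t).
    by field; rewrite gt_eqF.
  by rewrite cs mul1r.
Qed.

(** The supremum of the partial sums plays the part of the sum of the series; [m] is an index where
    it is attained up to [e]. *)
Lemma tail_small (u : nat -> R) (C e : R) : (forall k, 0 <= u k) ->
  (forall N, \sum_(0 <= k < N) u k <= C) -> 0 < e ->
  exists m, forall N, \sum_(m <= k < N) u k <= e.
Proof.
move=> u0 uC e0.
pose A := range (fun N => \sum_(0 <= k < N) u k).
have hA : has_sup A.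
  split; first by exists (\sum_(0 <= k < 0) u k); exists 0%N.
  by exists C => _ [N _ <-].
have [_ [m _ <-] hm] := sup_adherent e0 hA.
exists m => N; have [Nm|mN] := leqP N m; first by rewrite big_geq// ltW.
have : \sum_(0 <= k < N) u k <= sup A by apply: (ub_le_sup hA.2); exists N.
by rewrite (big_cat_nat (n := m))//=; [lra|exact: ltnW].
Qed.

Lemma le_tail_sum (u : nat -> R) m N : (forall k, 0 <= u k) ->
  \sum_(m <= k < N) u k <= \sum_(0 <= k < N) u k.
Proof.
move=> u0; have [Nm|mN] := leqP N m; first by rewrite big_geq// sumr_ge0.
by rewrite [leRHS](big_cat_nat (n := m))//=; [rewrite lerDr sumr_ge0|exact: ltnW].
Qed.

Lemma le_sum_widen (u : nat -> R) m N : (forall k, 0 <= u k) -> (m <= N)%N ->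
  \sum_(0 <= k < m) u k <= \sum_(0 <= k < N) u k.
Proof.
by move=> u0 mN; rewrite [leRHS](big_cat_nat (n := m))//= lerDl sumr_ge0.
Qed.

(** Continuity of the trajectory in the norm of Y, read on coefficients: [d] does not depend on the
    number [N] of modes. *)
Definition strongly_continuous lam a b : Prop :=
  forall t0, 0 <= t0 -> forall e, 0 < e -> exists2 d, 0 < d &
  forall t, 0 <= t -> `|t - t0| < d -> forall N,
    energy lam (fun k t => a k t - a k t0) (fun k t => b k t - b k t0)
      (index_iota 0 N) t <= e.

Lemma sqr_sub_le (x y : R) : (x - y) ^+ 2 <= 2 * (x ^+ 2 + y ^+ 2).
Proof. by rewrite -subr_ge0 (_ : _ - _ = (x + y) ^+ 2) ?sqr_ge0//; ring. Qed.

Lemma energy_sub_le lam a b a' b' s t : (forall k, 0 <= lam k) ->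
  energy lam (fun k t => a k t - a' k t) (fun k t => b k t - b' k t) s t <=
  2 * (energy lam a b s t + energy lam a' b' s t).
Proof.
move=> l0; rewrite /energy -big_split mulr_sumr; apply: ler_sum => k _ /=.
have h1 := sqr_sub_le (b k t) (b' k t).
have h2 := ler_wpM2l (l0 k) (sqr_sub_le (a k t) (a' k t)).
lra.
Qed.

(** Modes below [m] are continuous one by one. The tail energy is small at [t0], and it stays small
    nearby because its derivative, the work of the source on the tail, is at most [2 * C] whatever
    [m] and [N] are. *)
Lemma oscillators_strongly_continuous lam a b h : (forall k, 0 <= lam k) ->
  oscillators lam a b h ->
  (forall T, exists C, forall t, 0 <= t <= T -> forall N,
     \sum_(0 <= k < N) h k t ^+ 2 <= C /\ energy lam a b (index_iota 0 N) t <= C) ->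
  strongly_continuous lam a b.
Proof.
move=> l0 osc bnd t0 t00 e e0.
have [C hC] := bnd (t0 + 1).
have C0 : 0 <= C.
  have [] := hC t0 _ 0%N; first by rewrite t00 lerDl ler01.
  by rewrite big_geq.
pose u t k := b k t ^+ 2 + lam k * a k t ^+ 2.
have u0 t k : 0 <= u t k by rewrite addr_ge0 ?sqr_ge0// mulr_ge0 ?sqr_ge0.
have [m hm] : exists m, forall N, \sum_(m <= k < N) u t0 k <= e / 16.
  apply: (tail_small (C := C)); [exact: u0| |by rewrite divr_gt0].
  by move=> N; apply: (hC t0 _ N).2; rewrite t00 lerDl ler01.
have dE t N : 0 <= t <= t0 + 1 ->
    `|energy lam a b (index_iota m N) t - energy lam a b (index_iota m N) t0| <= 2 * C * `|t - t0|.
  move=> /andP[t_0 tT]; have [cE dE] := oscillators_energy (index_iota m N) osc.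
  have key x : 0 <= x <= t0 + 1 -> `|2 * \sum_(k <- index_iota m N) h k x * b k x| <= 2 * C.
    move=> xT; have [h1 h2] := hC x xT N.
    have h3 : \sum_(m <= k < N) h k x ^+ 2 <= C.
      by apply: le_trans h1; apply: le_tail_sum => k; exact: sqr_ge0.
    have h4 : \sum_(m <= k < N) b k x ^+ 2 <= C.
      apply: le_trans h2; apply: le_trans (energy_kinetic_le a b (index_iota 0 N) x l0).
      by apply: (le_tail_sum (u := fun k => b k x ^+ 2)) => k; exact: sqr_ge0.
    have h5 := sum_prod_le (index_iota m N) (h^~ x) (b^~ x) ltr01.
    have h6 := sum_prod_le (index_iota m N) (fun k => - h k x) (b^~ x) ltr01.
    move: h5 h6; rewrite invr1 !mul1r.
    under [X in _ -> _ <= _ + X -> _]eq_bigr do rewrite sqrrN.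
    under [X in _ -> 2 * X <= _ -> _]eq_bigr do rewrite mulNr.
    rewrite sumrN mulrN => h5 h6; rewrite ler_norml.
    by move: h3 h4 h5 h6; rewrite /=; lra.
  have [tt0|/ltW tt0] := leP t t0.
    rewrite distrC [X in _ <= _ * X]distrC [X in _ <= _ * X]ger0_norm ?subr_ge0//.
    apply: (growth_abs_le t_0 tt0 cE dE) => x /andP[x1 x2]; apply: key.
    by apply/andP; split; lra.
  rewrite [X in _ <= _ * X]ger0_norm ?subr_ge0//.
  apply: (growth_abs_le t00 tt0 cE dE) => x /andP[x1 x2]; apply: key.
  by apply/andP; split; lra.
have [ca cb _ _] := osc.
pose D t := energy lam (fun k t => a k t - a k t0) (fun k t => b k t - b k t0)
      (index_iota 0 m) `|t|.
have cD : continuous D.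
  apply: (@continuous_sum_halfline _ _ (fun k t => (b k t - b k t0) ^+ 2 + lam k * (a k t - a k t0) ^+ 2)).
  move=> k; apply: continuous_add.
    apply: continuous_sqr; apply: continuous_sub; [exact: cb|exact: cst_continuous].
  apply: continuous_scale; apply: continuous_sqr.
  apply: continuous_sub; [exact: ca|exact: cst_continuous].
have D0 : D t0 = 0.
  by rewrite /D /energy big1// => k _; rewrite ger0_norm// !subrr expr0n/= mulr0 addr0.
have e2 : 0 < e / 2 by rewrite divr_gt0.
have [d1 /= d10 hd1] := (@cvgrPdist_le _ _ _ _ _ _ _).1 (cD t0) _ e2.
(* The entry 1 keeps [t] in [0, t0 + 1], and the last one makes [2 * C * |t - t0|] at most [e / 16];
   the tail of the difference is then at most 2 (3 e / 16) <= e / 2. *)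
pose d := Num.min d1 (Num.min 1 (e / (32 * C + 32))).
have C32 : 0 < 32 * C + 32 by lra.
exists d; first by rewrite !lt_min d10 ltr01 divr_gt0.
move=> t t_0; rewrite !lt_min => /and3P[td1 tlt1 te] N.
have tT : 0 <= t <= t0 + 1.
  by rewrite t_0/=; move: tlt1; rewrite ltr_distl; lra.
pose v k := (b k t - b k t0) ^+ 2 + lam k * (a k t - a k t0) ^+ 2.
have v0 k : 0 <= v k by rewrite addr_ge0 ?sqr_ge0// mulr_ge0 ?sqr_ge0.
have hv1 : \sum_(0 <= k < m) v k <= e / 2.
  have := hd1 t; rewrite /= distrC => /(_ td1); rewrite D0 sub0r normrN.
  have -> : D t = \sum_(0 <= k < m) v k by rewrite /D ger0_norm.
  exact: (le_trans (ler_norm _)).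
have hv2 : \sum_(m <= k < N) v k <= e / 2.
  have h1 := energy_sub_le a b (fun k _ => a k t0) (fun k _ => b k t0) (index_iota m N) t l0.
  apply: (le_trans h1).
  have h2 := hm N; have := dE t N tT; rewrite ler_norml => /andP[_].
  have h3 : 2 * C * `|t - t0| <= e / 16.
    move: te; rewrite ltr_pdivlMr// => /ltW te.
    by have := normr_ge0 (t - t0); lra.
  by move: h2 h3; rewrite /u /energy; lra.
rewrite /energy -/(v _); have [Nm|mN] := leqP N m.
  apply: (@le_trans _ _ (\sum_(0 <= k < m) v k)); first exact: le_sum_widen.
  by lra.
rewrite (big_cat_nat (n := m))//=; last exact: ltnW.
by have := lerD hv1 hv2; rewrite -splitr.
Qed.

End StrongContinuity.

(** * Contraction argument for Lipschitz sources *)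

Section Picard.
Context {R : realType}.
Set Implicit Arguments.
Unset Strict Implicit.
Implicit Types (lam : nat -> R) (a b h : nat -> R -> R) (t : R) (N : nat).

Lemma oscillators_sub lam a b h a' b' h' :
  oscillators lam a b h -> oscillators lam a' b' h' ->
  oscillators lam (fun k t => a k t - a' k t) (fun k t => b k t - b' k t)
    (fun k t => h k t - h' k t).
Proof.
move=> [ca cb da db] [ca' cb' da' db']; split.
- by move=> k; apply: continuous_sub.
- by move=> k; apply: continuous_sub.
- move=> k t t0.
  apply: (is_derive_congr (is_derive_add (da k t t0) (is_derive_scale (-1) (da' k t t0)))).
    by move=> y; rewrite mulN1r.
  by rewrite mulN1r.
- move=> k t t0.
  apply: (is_derive_congr (is_derive_add (db k t t0) (is_derive_scale (-1) (db' k t t0)))).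
    by move=> y; rewrite mulN1r.
  by ring.
Qed.

Lemma le0_geometric (x C : R) : (forall j, x <= C * (4^-1) ^+ j) -> x <= 0.
Proof.
move=> h.
have hc : (fun j : nat => C * (4^-1 : R) ^+ j) @ \oo --> C * 0.
  apply: cvgM; first exact: cvg_cst.
  by apply: cvg_expr; rewrite ger0_norm ?invr_ge0// invf_lt1//; lra.
rewrite mulr0 in hc; apply: (@ler_cvg_to _ _ _ _ (cst x) _ x 0 _ hc); first exact: cvg_cst.
by near=> j; exact: h.
Unshelve. all: by end_near. Qed.

Lemma energy_eq0 lam a b t : (forall k, 0 < lam k) ->
  (forall N, energy lam a b (index_iota 0 N) t <= 0) -> forall k, a k t = 0 /\ b k t = 0.
Proof.
move=> l0 hE k; have l0' j : 0 <= lam j by exact: ltW.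
pose v k := b k t ^+ 2 + lam k * a k t ^+ 2.
have v0 j : 0 <= v j by rewrite addr_ge0 ?sqr_ge0// mulr_ge0 ?sqr_ge0.
have vk : v k <= 0.
  apply: le_trans (hE k.+1); by rewrite /energy big_nat_recr//= lerDr; apply: sumr_ge0 => j _; exact: v0.
have := v0 k; rewrite le_eqVlt ltNge vk orbF eq_sym.
have pl : 0 <= lam k * a k t ^+ 2 by rewrite mulr_ge0 ?sqr_ge0.
rewrite paddr_eq0 ?sqr_ge0// [lam k * _ == 0]mulf_eq0 (gt_eqF (l0 k))/= !sqrf_eq0.
by move=> /andP[/eqP-> /eqP->].
Qed.

Lemma energy_congr lam a b a' b' s t : (forall k, a k t = a' k t) ->
  (forall k, b k t = b' k t) -> energy lam a b s t = energy lam a' b' s t.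
Proof. by move=> h1 h2; apply: eq_bigr => k _; rewrite h1 h2. Qed.

(** The contraction is run on a single trajectory with zero data: an energy bound C 4^-j e^(LL s) is
    fed into the hypothesis on the source, and [energy_growth] returns it with one more factor
    1/4. *)
Lemma oscillators_zero lam a b h (T K C : R) : (forall k, 0 < lam k) -> 0 <= K ->
  oscillators lam a b h -> (forall k, a k 0 = 0 /\ b k 0 = 0) ->
  (forall t, 0 <= t <= T -> forall N, energy lam a b (index_iota 0 N) t <= C) ->
  (forall t, 0 < t < T -> forall S, (forall N, \sum_(0 <= k < N) lam k * a k t ^+ 2 <= S) ->
     forall N, \sum_(0 <= k < N) h k t ^+ 2 <= K * S) ->
  forall t, 0 <= t <= T -> forall k, a k t = 0 /\ b k t = 0.
Proof.
move=> l0 K0 osc ini bnd src t /andP[t0 tT].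
have C0 : 0 <= C.
  by have := bnd t _ 0%N; rewrite t0 tT /energy big_geq//; exact.
have l0' j : 0 <= lam j by exact: ltW.
(* With this exponent 4 K / LL^2 = K / (4 (K + 1)^2) is at most 1/4. *)
pose LL := 4 * (K + 1).
have LL0 : 0 < LL by rewrite /LL; lra.
have LK : 4 / LL ^+ 2 * K <= 4^-1.
  rewrite mulrAC ler_pdivrMr ?exprn_gt0// /LL.
  have -> : 4^-1 * (4 * (K + 1)) ^+ 2 = 4 * (K + 1) ^+ 2 by field.
  by nra.
have ini0 N : energy lam a b (index_iota 0 N) 0 <= 0.
  by rewrite /energy big1// => k _; have [-> ->] := ini k; rewrite !expr0n/= mulr0 addr0.
have main j : forall s, 0 <= s <= T -> forall N,
    energy lam a b (index_iota 0 N) s <= (C * (4^-1) ^+ j) * expR (LL * s).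
  elim: j => [|j IH] s /andP[s0 sT] N.
    rewrite expr0 mulr1; apply: (le_trans (bnd s _ N)); first by rewrite s0.
    rewrite ler_peMr// -[leLHS]expR0 ler_expR; apply: mulr_ge0 => //; exact: ltW.
  have Q0 : 0 <= K * (C * 4^-1 ^+ j) by rewrite !mulr_ge0// exprn_ge0// invr_ge0.
  have hh x : 0 < x < s ->
      \sum_(k <- index_iota 0 N) h k x ^+ 2 <= K * (C * 4^-1 ^+ j) * expR (LL * x).
    move=> /andP[x0 xs]; rewrite -mulrA; apply: src.
      by rewrite x0 (lt_le_trans xs).
    move=> N'; apply: le_trans (energy_potential_le lam a b _ x) _; apply: IH.
    by rewrite (ltW x0) (le_trans (ltW xs)).
  have := energy_growth l0' osc LL0 s0 (lexx 0) Q0 (ini0 N) hh.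
  rewrite add0r => /le_trans; apply.
  rewrite mulrC ler_pM2r ?expR_gt0// (exprS _ j) [leRHS]mulrCA [leLHS]mulrA.
  by apply: ler_wpM2r => //; rewrite mulr_ge0// exprn_ge0// invr_ge0.
apply: energy_eq0 => // N; apply: (@le0_geometric _ (C * expR (LL * t))) => j.
by rewrite mulrAC; apply: main; rewrite t0.
Qed.

Definition finite_energy lam (c : nat -> R) : Prop :=
  exists S, forall N, \sum_(0 <= k < N) lam k * c k ^+ 2 <= S.

(** Both sides are squared norms, so [K] is the square of a Lipschitz constant, from the norm
    weighted by [lam] to the unweighted one. Sequences of infinite energy are excluded because their
    trigonometric series need not converge. *)
Definition lipschitz_source lam (gam : (nat -> R) -> nat -> R) (K : R) : Prop :=
  forall c c', finite_energy lam c -> finite_energy lam c' ->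
  forall S, (forall N, \sum_(0 <= k < N) lam k * (c k - c' k) ^+ 2 <= S) ->
  forall N, \sum_(0 <= k < N) (gam c k - gam c' k) ^+ 2 <= K * S.

Lemma cauchy_geometric (u : nat -> R) (C : R) :
  (forall j m, (u (j + m)%N - u j) ^+ 2 <= C * (4^-1) ^+ j) -> cvgn u.
Proof.
move=> h; apply: cauchy_cvg; apply: cauchy_exP => e e0.
have hc : (fun j : nat => C * (4^-1 : R) ^+ j) @ \oo --> C * 0.
  apply: cvgM; first exact: cvg_cst.
  by apply: cvg_expr; rewrite ger0_norm ?invr_ge0// invf_lt1//; lra.
rewrite mulr0 in hc.
have e20 : 0 < e ^+ 2 / 2 by rewrite divr_gt0 ?exprn_gt0.
have [j _ hj] := (@cvgrPdist_le _ _ _ _ _ _ _).1 hc _ e20.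
exists (u j), j => // n /= jn.
rewrite -ball_normE/= distrC -(@ltr_pXn2r _ 2)//; [|by rewrite nnegrE..|by rewrite nnegrE ltW].
have := h j (n - j)%N; rewrite subnKC// real_normK ?num_real// => /le_lt_trans; apply.
have := hj j (leqnn j); rewrite sub0r normrN => hh.
apply: (@le_lt_trans _ _ (e ^+ 2 / 2)); first exact: le_trans (ler_norm _) hh.
by have := exprn_gt0 2 e0; lra.
Qed.

Lemma cvg_energy lam (a b : nat -> nat -> R) (a' b' : nat -> R) (s : seq nat) :
  (forall k, a^~ k @ \oo --> a' k) -> (forall k, b^~ k @ \oo --> b' k) ->
  (fun m => energy lam (fun k _ => a m k) (fun k _ => b m k) s 0) @ \oo -->
   energy lam (fun k _ => a' k) (fun k _ => b' k) s 0.
Proof.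
move=> ha hb; rewrite /energy; elim: s => [|k s IH].
  by under eq_fun do rewrite big_nil; rewrite big_nil; exact: cvg_cst.
under eq_fun do rewrite big_cons; rewrite big_cons; apply: cvgD => //.
apply: cvgD; first by under eq_fun do rewrite expr2; rewrite expr2; exact: cvgM.
by apply: cvgM; [exact: cvg_cst|under eq_fun do rewrite expr2; rewrite expr2; exact: cvgM].
Qed.

End Picard.

(** * Picard iteration for the infinite system *)

Section PicardExistence.
Context {R : realType}.
Set Implicit Arguments.
Unset Strict Implicit.
Implicit Types (t : R) (N : nat).

Notation traj := ((nat -> R -> R) * (nat -> R -> R))%type.

(** The ball on which the iteration acts, for the energy norm weighted by the exponential. *)
Definition admissible (lam : nat -> R) (B LL : R) (u : traj) : Prop :=
  strongly_continuous lam u.1 u.2 /\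
  forall t, 0 <= t -> forall N, energy lam u.1 u.2 (index_iota 0 N) t <= B * expR (LL * t).

(** A squared distance between trajectories; its triangle inequality therefore costs a factor 2. *)
Definition denergy (lam : nat -> R) (u v : traj) N t :=
  energy lam (fun k t => u.1 k t - v.1 k t) (fun k t => u.2 k t - v.2 k t) (index_iota 0 N) t.

Lemma admissible_finite_energy lam B LL (u : traj) t : 0 <= t ->
  admissible lam B LL u -> finite_energy lam (u.1^~ t).
Proof.
move=> t0 [_ hB]; exists (B * expR (LL * t)) => N.
exact: le_trans (energy_potential_le lam u.1 u.2 _ t) (hB t t0 N).
Qed.

Lemma denergy_triangle lam (u v w : traj) N t : (forall k, 0 <= lam k) ->
  denergy lam u w N t <= 2 * (denergy lam u v N t + denergy lam v w N t).
Proof.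
move=> l0; rewrite /denergy /energy -big_split mulr_sumr; apply: ler_sum => k _ /=.
have h (x y z : R) : (x - z) ^+ 2 <= 2 * ((x - y) ^+ 2 + (y - z) ^+ 2).
  by rewrite -subr_ge0 (_ : _ - _ = (x - 2 * y + z) ^+ 2) ?sqr_ge0//; ring.
have := h (u.2 k t) (v.2 k t) (w.2 k t).
have := ler_wpM2l (l0 k) (h (u.1 k t) (v.1 k t) (w.1 k t)).
by lra.
Qed.

Lemma denergy_sym lam (u v : traj) N t : denergy lam u v N t = denergy lam v u N t.
Proof.
by apply: eq_bigr => k _; congr (_ + _ * _); rewrite -sqrrN opprB.
Qed.

Section Step.
Variables (lam : nat -> R) (gam : (nat -> R) -> nat -> R) (K : R).
Variables (a0 b0 : nat -> R) (E0 : R).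
Hypotheses (l0 : forall k, 0 < lam k) (K0 : 0 <= K).
Hypotheses (gamL : lipschitz_source lam gam K) (gam0 : forall k, gam (fun=> 0) k = 0).
Hypothesis ini : forall N, \sum_(0 <= k < N) (b0 k ^+ 2 + lam k * a0 k ^+ 2) <= E0.

(** [LL] makes the contraction factor [4 / LL ^+ 2 * K] at most 1/4; [B] is chosen so that E0 + B /
    4 <= B, which keeps the iteration in its ball. *)
Let LL := 4 * (K + 1).
Let B := 2 * E0.
Let l0' k : 0 <= lam k. Proof. exact: ltW. Qed.
Let K1 : 0 < K + 1. Proof. by rewrite ltr_wpDl. Qed.
Let LL0 : 0 < LL. Proof. by rewrite mulr_gt0// ltr_wpDl. Qed.
Let LK : 4 / LL ^+ 2 * K <= 4^-1.
Proof.
rewrite mulrAC ler_pdivrMr ?exprn_gt0// /LL.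
have -> : 4^-1 * (4 * (K + 1)) ^+ 2 = 4 * (K + 1) ^+ 2 by field.
by nra.
Qed.
Let E00 : 0 <= E0. Proof. by have := ini 0%N; rewrite big_geq. Qed.

Let B0 : 0 <= B. Proof. by rewrite mulr_ge0. Qed.

Lemma gam_le c S : (forall N, \sum_(0 <= k < N) lam k * c k ^+ 2 <= S) ->
  forall N, \sum_(0 <= k < N) gam c k ^+ 2 <= K * S.
Proof.
move=> hS N; have := gamL (c := c) (c' := fun=> 0) _ _ (S := S).
have f0 : finite_energy lam (fun=> 0).
  by exists 0 => M; rewrite big1// => k _; rewrite expr0n/= mulr0.
move=> /(_ (ex_intro _ S hS) f0) h.
have -> : \sum_(0 <= k < N) gam c k ^+ 2 = \sum_(0 <= k < N) (gam c k - gam (fun=> 0) k) ^+ 2.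
  by apply: eq_bigr => k _; rewrite gam0 subr0.
by apply: h => M; under eq_bigr do rewrite subr0.
Qed.

(** One Picard step: the source is computed along [u] and drives [v]. A trajectory related to itself
    solves the nonlinear system. *)
Definition next (u v : traj) : Prop :=
  [/\ oscillators lam v.1 v.2 (fun k t => gam (u.1^~ t) k),
      (forall k, v.1 k 0 = a0 k /\ v.2 k 0 = b0 k) & admissible lam B LL v].

(** Along an admissible [u] each component of the source is continuous in time, by strong continuity
    and the Lipschitz property; the modes then decouple into scalar forced oscillators. *)
Lemma next_exists u : admissible lam B LL u -> exists v, next u v.
Proof.
move=> [su hu].
have fe t : finite_energy lam (fun j => u.1 j `|t|).
  by apply: (@admissible_finite_energy _ B LL).
have ch k : continuous (fun t => gam (fun j => u.1 j `|t|) k).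
  move=> t; apply/cvgrPdist_le => e e0.
  have e1 : 0 < e ^+ 2 / (K + 1) by rewrite divr_gt0 ?exprn_gt0.
  have [d d0 hd] := su `|t| (normr_ge0 t) _ e1.
  exists d => // s /= ts.
  have sd : `| `|s| - `|t| | < d.
    by apply: le_lt_trans ts; rewrite distrC; exact: ler_dist_dist.
  have hS N : \sum_(0 <= k < N) lam k * (u.1 k `|s| - u.1 k `|t|) ^+ 2 <= e ^+ 2 / (K + 1).
    apply: le_trans (hd _ (normr_ge0 s) sd N).
    exact: (@energy_potential_le _ lam (fun k x => u.1 k x - u.1 k `|t|)
       (fun k x => u.2 k x - u.2 k `|t|)).
  have := gamL (fe s) (fe t) hS k.+1.
  rewrite big_nat_recr//= => hk.
  have : (gam (fun j => u.1 j `|s|) k - gam (fun j => u.1 j `|t|) k) ^+ 2 <= e ^+ 2.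
    apply: (@le_trans _ _ (K * (e ^+ 2 / (K + 1)))).
      by apply: le_trans hk; rewrite lerDr sumr_ge0// => i _; exact: sqr_ge0.
    rewrite mulrA ler_pdivrMr ?K1// mulrC ler_wpM2l ?sqr_ge0//.
    by rewrite lerDl.
  rewrite distrC -[X in X <= _]real_normK ?num_real//.
  by rewrite ler_pXn2r// ?nnegrE// ltW.
have /choice [F hF] : forall k, exists ab : (R -> R) * (R -> R), [/\ ab.1 0 = a0 k, ab.2 0 = b0 k,
    forall t, 0 <= t -> is_derive t 1 ab.1 (ab.2 t) &
    forall t, 0 <= t -> is_derive t 1 ab.2 (- lam k * ab.1 t + gam (fun j => u.1 j `|t|) k)].
  by move=> k; have [a [b hab]] := oscillator_solution (a0 k) (b0 k) (l0 k) (ch k); exists (a, b).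
pose v : traj := (fun k => (F k).1, fun k => (F k).2).
have osc : oscillators lam v.1 v.2 (fun k t => gam (u.1^~ t) k).
  have cc (f g : R -> R) : (forall t, 0 <= t -> is_derive t 1 f (g t)) -> continuous (fun t : R => f `|t|).
    move=> hf t; apply: (@continuous_comp _ _ _ (fun t : R => `|t|) f).
      exact: norm_continuous.
    exact: (is_derive_continuous (hf _ (normr_ge0 t))).
  split => /=.
  - by move=> k; have [_ _ /cc] := hF k.
  - by move=> k; have [_ _ _ /cc] := hF k.
  - by move=> k t t0; have [_ _ h _] := hF k; exact: h (ltW t0).
  - move=> k t t0; have [_ _ _ h] := hF k.
    by have := h t (ltW t0); rewrite ger0_norm// ltW.
have src t : 0 <= t -> forall N,
    \sum_(k <- index_iota 0 N) gam (u.1^~ t) k ^+ 2 <= K * B * expR (LL * t).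
  move=> t0 N; rewrite -mulrA; apply: gam_le => M.
  exact: le_trans (energy_potential_le lam u.1 u.2 _ t) (hu t t0 M).
have hv t : 0 <= t -> forall N, energy lam v.1 v.2 (index_iota 0 N) t <= B * expR (LL * t).
  move=> t0 N; have Q0 : 0 <= K * B by rewrite mulr_ge0.
  have hini : energy lam v.1 v.2 (index_iota 0 N) 0 <= E0.
    apply: le_trans (ini N); apply: eq_ler.
    by apply: eq_bigr => k _ /=; have [-> -> _ _] := hF k.
  have := energy_growth l0' osc LL0 t0 E00 Q0 hini _.
  move=> /(_ (fun x x0 => src x (ltW (andP x0).1) N)) /le_trans; apply.
  rewrite mulrC ler_pM2r ?expR_gt0// mulrA.
  have := ler_wpM2r B0 LK; have E0' := E00; have : B = 2 * E0 by [].
  by set X := _ * B; lra.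
exists v; split => //.
  by move=> k /=; have [-> -> _ _] := hF k.
split=> //; apply: (oscillators_strongly_continuous l0' osc) => T.
exists ((K + 1) * B * expR (LL * T)) => t /andP[t0 tT] N.
have eT : expR (LL * t) <= expR (LL * T) by rewrite ler_expR ler_pM2l.
split.
  apply: (le_trans (src t t0 N)); apply: ler_pM => //; rewrite ?mulr_ge0 ?expR_ge0//.
  by rewrite mulrDl lerDl mul1r.
apply: (le_trans (hv t t0 N)); apply: ler_pM => //; rewrite ?expR_ge0//.
by rewrite mulrDl mul1r lerDr mulr_ge0.
Qed.

(** The difference starts from zero, so [energy_growth] returns the contraction term alone. *)
Lemma next_contract u v u' v' (M : R) : 0 <= M ->
  admissible lam B LL u -> admissible lam B LL v ->
  next u u' -> next v v' ->
  (forall t, 0 <= t -> forall N, denergy lam u v N t <= M * expR (LL * t)) ->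
  forall t, 0 <= t -> forall N, denergy lam u' v' N t <= M / 4 * expR (LL * t).
Proof.
move=> M0 au av [ou iu _] [ov iv _] hM t t0 N.
have osc := oscillators_sub ou ov.
have Q0 : 0 <= K * M by rewrite mulr_ge0.
have hini : denergy lam u' v' N 0 <= 0.
  rewrite /denergy /energy big1// => k _.
  by have [-> ->] := iu k; have [-> ->] := iv k; rewrite !subrr expr0n/= mulr0 addr0.
have src x : 0 < x < t ->
    \sum_(k <- index_iota 0 N) (gam (u.1^~ x) k - gam (v.1^~ x) k) ^+ 2 <= K * M * expR (LL * x).
  move=> /andP[/ltW x0 _]; rewrite -mulrA.
  apply: gamL; [exact: (admissible_finite_energy x0 au)|exact: (admissible_finite_energy x0 av)|].
  move=> N'; apply: le_trans (hM x x0 N').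
  exact: (@energy_potential_le _ lam (fun k x => u.1 k x - v.1 k x) (fun k x => u.2 k x - v.2 k x)).
have := energy_growth l0' osc LL0 t0 (lexx 0) Q0 hini src.
rewrite add0r => /le_trans; apply.
rewrite mulrC ler_pM2r ?expR_gt0// [leLHS]mulrA [leRHS]mulrC.
exact: ler_wpM2r.
Qed.

(* Picard iteration from the zero trajectory. *)
Theorem oscillators_exist : exists u, next u u.
Proof.
have /choice [F hF] : forall u, exists v, admissible lam B LL u -> next u v.
  move=> u; have [/next_exists[v hv]|nu] := pselect (admissible lam B LL u).
    by exists v.
  by exists u.
pose z : traj := (fun _ _ => 0, fun _ _ => 0).
have az : admissible lam B LL z.
  split=> [t0 t00 e e0|t t0 N].
    exists 1 => // t _ _ N; rewrite /energy big1 ?ltW// => k _.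
    by rewrite !subrr expr0n/= mulr0 addr0.
  rewrite /energy big1 ?mulr_ge0 ?expR_ge0// => k _ /=.
  by rewrite expr0n/= mulr0 addr0.
pose u j := iter j F z.
have au j : admissible lam B LL (u j).
  by elim: j => [//|j /hF []].
have nu j : next (u j) (u j.+1) by apply: hF; exact: au.
pose q : R := 4^-1.
have q0 j : 0 <= q ^+ j by rewrite exprn_ge0// invr_ge0.
(* The constant [4 * B] is the case j = 0, where each of [u 1] and [z] has energy at most B e^(LL t)
   and the squared difference costs a factor 2. *)
have inc j : forall t, 0 <= t -> forall N,
    denergy lam (u j.+1) (u j) N t <= (4 * B * q ^+ j) * expR (LL * t).
  elim: j => [|j IH].
    move=> t t0 N; rewrite expr0 mulr1.
    have := energy_sub_le (u 1%N).1 (u 1%N).2 z.1 z.2 (index_iota 0 N) t l0'.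
    have := (au 1%N).2 t t0 N; have := az.2 t t0 N.
    rewrite /denergy; set e := expR _.
    by move=> h1 h2 /le_trans; apply; move: h1 h2; set X := energy _ _ _ _ _; set Y := energy _ _ _ _ _; lra.
  have M0 : 0 <= 4 * B * q ^+ j by rewrite !mulr_ge0.
  move=> t t0 N; have := next_contract M0 (au j.+1) (au j) (nu j.+1) (nu j) IH t0 N.
  by move=> /le_trans; apply; rewrite (exprS _ j) /q; apply: eq_ler; field.
(* The constant 16 B reproduces itself: 2 (16 B q / 1 + 4 B) = 16 B for q = 1/4. *)
have far m : forall j t, 0 <= t -> forall N,
    denergy lam (u (j + m)%N) (u j) N t <= (16 * B * q ^+ j) * expR (LL * t).
  elim: m => [|m IH] j t t0 N.
    rewrite addn0 /denergy /energy big1; first by rewrite !mulr_ge0 ?expR_ge0.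
    by move=> k _; rewrite !subrr expr0n/= mulr0 addr0.
  have := denergy_triangle (u (j + m.+1)%N) (u j.+1) (u j) N t l0'.
  rewrite -addSnnS; have := IH j.+1 t t0 N; have := inc j t t0 N.
  rewrite (exprS _ j); set X := denergy _ _ _ _ _; set Y := denergy _ _ _ _ _.
  set Z := denergy _ _ _ _ _; rewrite /q; set p := 4^-1 ^+ j; set e := expR _.
  have : 0 <= p * B * e by rewrite !mulr_ge0 ?expR_ge0// /p -/q.
  by lra.
have mode (w v : traj) k t C : 0 <= C ->
    (forall N, denergy lam w v N t <= C) ->
    (w.1 k t - v.1 k t) ^+ 2 <= (lam k)^-1 * C /\ (w.2 k t - v.2 k t) ^+ 2 <= C.
  move=> C0 hC; have := hC k.+1; rewrite /denergy /energy big_nat_recr//=.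
  set S := \sum_(_ <= _ < _) _ => h.
  have S0 : 0 <= S by apply: sumr_ge0 => i _; rewrite addr_ge0 ?sqr_ge0// mulr_ge0 ?sqr_ge0.
  have h1 := sqr_ge0 (w.2 k t - v.2 k t).
  have h2 := mulr_ge0 (l0' k) (sqr_ge0 (w.1 k t - v.1 k t)).
  split; last by lra.
  by rewrite ler_pdivlMl//; lra.
have ge0 j t : 0 <= 16 * B * q ^+ j * expR (LL * t) by rewrite !mulr_ge0 ?expR_ge0.
have cva k t : 0 <= t -> cvgn (fun j => (u j).1 k t).
  move=> t0; apply: (@cauchy_geometric _ _ ((lam k)^-1 * (16 * B * expR (LL * t)))) => j m.
  have := (mode _ _ k t _ (ge0 j t) (far m j t t0)).1.
  by rewrite -/q !mulrA => /le_trans; apply; apply: eq_ler; ring.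
have cvb k t : 0 <= t -> cvgn (fun j => (u j).2 k t).
  move=> t0; apply: (@cauchy_geometric _ _ (16 * B * expR (LL * t))) => j m.
  have := (mode _ _ k t _ (ge0 j t) (far m j t t0)).2.
  by move=> /le_trans; apply; rewrite -/q mulrAC.
(* The limit is taken mode by mode at each time; it is meaningful at nonnegative times only. *)
pose w : traj := (fun k t => limn (fun j => (u j).1 k t), fun k t => limn (fun j => (u j).2 k t)).
have wu j t : 0 <= t -> forall N, denergy lam w (u j) N t <= (16 * B * q ^+ j) * expR (LL * t).
  move=> t0 N.
  have := @cvg_energy _ lam (fun m k => (u (j + m)%N).1 k t - (u j).1 k t)
    (fun m k => (u (j + m)%N).2 k t - (u j).2 k t) (fun k => w.1 k t - (u j).1 k t)
    (fun k => w.2 k t - (u j).2 k t) (index_iota 0 N).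
  have sh (f : nat -> R) : cvgn f -> (fun m => f (j + m)%N) @ \oo --> limn f.
    move=> cf; under eq_fun do rewrite addnC.
    suff : [sequence f (n + j)%N]_n @ \oo --> limn f by [].
    by rewrite cvg_shiftn.
  move=> /(_ _ _)-h.
  apply: (@ler_cvg_to _ _ _ _ _ (cst ((16 * B * q ^+ j) * expR (LL * t))) _ _ (h _ _)).
  - by move=> k; apply: cvgB; [exact: (sh _ (cva k t t0))|exact: cvg_cst].
  - by move=> k; apply: cvgB; [exact: (sh _ (cvb k t t0))|exact: cvg_cst].
  - exact: cvg_cst.
  - by near=> m; exact: far.
have aw : admissible lam B LL w.
  split=> [t0 t00 e e0|t t0 N]; last first.
    have h := @cvg_energy _ lam (fun m k => (u m).1 k t) (fun m k => (u m).2 k t)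
      (fun k => w.1 k t) (fun k => w.2 k t) (index_iota 0 N)
      (fun k => cva k t t0) (fun k => cvb k t t0).
    apply: (@ler_cvg_to _ _ _ _ _ (cst (B * expR (LL * t))) _ _ h); first exact: cvg_cst.
    by near=> m; exact: (au m).2.
  (* Strong continuity passes to the limit by comparing [w] with [u j] at both times; restricting to
     [0, t0 + 1] bounds the exponential weight. *)
  have [j hj] : exists j, 4 * (16 * B * q ^+ j * expR (LL * (t0 + 1))) <= e / 4.
    apply/not_existsP => hn.
    have : e / 4 <= 0; last by rewrite leNgt divr_gt0.
    apply: (@le0_geometric _ _ (4 * (16 * B * expR (LL * (t0 + 1))))) => j.
    have /negP := hn j; rewrite -ltNge => /ltW /le_trans; apply.
    by rewrite -/q; apply: eq_ler; ring.
  have e4 : 0 < e / 8 by rewrite divr_gt0.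
  have [d d0 hd] := (au j).1 t0 t00 _ e4.
  exists (Num.min d 1); first by rewrite lt_min d0 ltr01.
  move=> t t_0; rewrite lt_min => /andP[td t1] N.
  pose cstt (v : traj) : traj := (fun k _ => v.1 k t0, fun k _ => v.2 k t0).
  have h1 := denergy_triangle w (u j) (cstt w) N t l0'.
  have h2 := denergy_triangle (u j) (cstt (u j)) (cstt w) N t l0'.
  have h3 := wu j t t_0 N.
  have h4 := wu j t0 t00 N.
  have h5 := hd t t_0 td N.
  have h6 : denergy lam (cstt (u j)) (cstt w) N t = denergy lam w (u j) N t0.
    by rewrite denergy_sym.
  rewrite h6 in h2.
  have eT : expR (LL * t) <= expR (LL * (t0 + 1)).
    by rewrite ler_expR ler_pM2l//; move: t1; rewrite ltr_distl; lra.
  have eT0 : expR (LL * t0) <= expR (LL * (t0 + 1)) by rewrite ler_expR ler_pM2l//; lra.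
  have c0 : 0 <= 16 * B * q ^+ j by rewrite !mulr_ge0.
  have h7 := ler_wpM2l c0 eT; have h8 := ler_wpM2l c0 eT0.
  have := le_trans h4 h8; have := le_trans h3 h7.
  move: h1 h2 hj h5.
  rewrite /denergy /cstt /=; lra.
(* The limit [w] is not known to satisfy any differential equation. One further step [v] does, and
   the contraction forces [v] and [w] to agree on [0, +oo). *)
have nw := hF w aw; set v := F w in nw.
have av : admissible lam B LL v by case: nw.
have vw t k : 0 <= t -> v.1 k t = w.1 k t /\ v.2 k t = w.2 k t.
  move=> t0; suff [h1 h2] : v.1 k t - w.1 k t = 0 /\ v.2 k t - w.2 k t = 0.
    by split; apply/eqP; rewrite -subr_eq0; apply/eqP.
  apply: (@energy_eq0 _ lam (fun k t => v.1 k t - w.1 k t) (fun k t => v.2 k t - w.2 k t) t l0) => N.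
  apply: (@le0_geometric _ _ (2 * (16 * B + 16 * B) * expR (LL * t))) => j.
  have M0 : 0 <= 16 * B * q ^+ j by rewrite !mulr_ge0.
  have h1 := next_contract M0 aw (au j) nw (nu j) (wu j) t0 N.
  have h2 := wu j.+1 t t0 N.
  have := denergy_triangle v (u j.+1) w N t l0'.
  rewrite (denergy_sym lam (u j.+1) w) => /le_trans; apply.
  move: h1 h2; rewrite (exprS _ j) /q; set p := 4^-1 ^+ j; set e := expR _.
  have : 0 <= p * B * e by rewrite !mulr_ge0 ?expR_ge0// /p -/q.
  by set X := denergy _ _ _ _ _; set Y := denergy _ _ _ _ _; lra.
(* The equations of [v] have their source computed along [w]; at positive times this is the source
   of [v] itself. *)
exists v; split; [|by case: nw|exact: av].
have [[ca cb da db] _ _] := nw; split => // k t t0.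
have -> : v.1^~ t = w.1^~ t by apply/funext => i; exact: (vw t i (ltW t0)).1.
exact: db.
Unshelve. all: by end_near. Qed.

End Step.
End PicardExistence.

(** * Trigonometric series *)

Section SquareIntegrable.
Context {R : realType}.
Notation mu := (@lebesgue_measure R).
Set Implicit Arguments.
Unset Strict Implicit.
Variable L : R.
Implicit Types (f g h : R -> R) (x : R).

Notation I := [set` `[(0 : R), L]].
Definition integ f := mu.-integrable I (EFin \o f).

(** Square integrability over one period. Periodicity is kept apart, since [pairing] only sees
    [0, L]. *)
Definition sqi f : Prop := measurable_fun setT f /\ integ (fun x => f x ^+ 2).

Let mI : measurable (I : set (measurableTypeR R)). Proof. exact: measurable_itv. Qed.

Lemma ae_imp (P Q : R -> Prop) : (forall x, P x -> Q x) ->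
  {ae mu, forall x, P x} -> {ae mu, forall x, Q x}.
Proof. by move=> PQ; apply: filterS => //; exact: (ae_filter_ringOfSetsType mu). Qed.

Lemma sqi_meas f : sqi f -> measurable_fun I f.
Proof. by move=> [mf _]; exact: measurable_funTS. Qed.

Lemma measurable_continuous f : continuous f -> measurable_fun setT f.
Proof. exact: continuous_measurable_fun. Qed.

Lemma integ_cont f : continuous f -> integ f.
Proof.
move=> cf; apply: continuous_compact_integrable; first exact: segment_compact.
exact: continuous_subspaceT.
Qed.

Lemma integ_le f g : measurable_fun I f -> (forall x, I x -> `|f x| <= g x) ->
  integ g -> integ f.
Proof.
move=> mf fg; apply: le_integrable => //.
  exact/measurable_EFinP.
by move=> x Ix /=; rewrite lee_fin (le_trans (fg x Ix))// ler_norm.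
Qed.

Lemma integ_add f g : integ f -> integ g -> integ (fun x => f x + g x).
Proof. by move=> hf hg; apply: (integrableD mI hf hg). Qed.

Lemma integ_scale (c : R) f : integ f -> integ (fun x => c * f x).
Proof. by move=> hf; apply: (integrableZl mI c hf). Qed.

Lemma sqi_mul f g : sqi f -> sqi g -> integ (fun x => f x * g x).
Proof.
move=> hf hg; apply: (@integ_le _ (fun x => f x ^+ 2 + g x ^+ 2)).
- exact: measurable_funM (sqi_meas hf) (sqi_meas hg).
- move=> x _; rewrite normrM.
  rewrite -[f x ^+ 2]real_normK ?num_real// -[g x ^+ 2]real_normK ?num_real//.
  have := sqr_ge0 (`|f x| - `|g x|); have := sqr_ge0 (`|f x| + `|g x|); nra.
- exact: integ_add hf.2 hg.2.
Qed.

Lemma sqi_cont f : continuous f -> sqi f.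
Proof.
move=> cf; split; first exact: measurable_continuous.
apply: integ_cont; exact: continuous_sqr.
Qed.

Lemma sqi_integ f : sqi f -> integ f.
Proof.
move=> hf; have := sqi_mul hf (sqi_cont (@cst_continuous _ _ (1 : R))).
by apply: eq_integrable => // x _ /=; rewrite mulr1.
Qed.

Lemma sqi_cst (c : R) : sqi (fun=> c).
Proof. by apply: sqi_cont; exact: cst_continuous. Qed.

Lemma sqi_bounded f (M : R) : measurable_fun setT f -> (forall x, `|f x| <= M) -> sqi f.
Proof.
move=> mf fM; split=> //; apply: (@integ_le _ (fun=> M ^+ 2)).
- by apply: measurable_funTS; exact: measurable_funX.
- move=> x _; rewrite ger0_norm ?sqr_ge0// -[leLHS]real_normK ?num_real//.
  by rewrite ler_pXn2r ?nnegrE// (le_trans _ (fM x)).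
- by apply: integ_cont; exact: cst_continuous.
Qed.

Lemma sqi_scale (c : R) f : sqi f -> sqi (fun x => c * f x).
Proof.
move=> [mf hf]; split; first exact: measurable_funM.
have := integ_scale (c ^+ 2) hf.
by apply: eq_integrable => // x _ /=; rewrite exprMn.
Qed.

Lemma sqi_add f g : sqi f -> sqi g -> sqi (fun x => f x + g x).
Proof.
move=> hf hg; split; first exact: measurable_funD hf.1 hg.1.
have := integ_add (integ_add hf.2 (integ_scale 2 (sqi_mul hf hg))) hg.2.
by apply: eq_integrable => // x _ /=; congr _%:E; ring.
Qed.

Lemma sqi_sub f g : sqi f -> sqi g -> sqi (fun x => f x - g x).
Proof.
move=> hf hg; have := sqi_add hf (sqi_scale (-1) hg).
by rewrite (_ : (fun x => f x + -1 * g x) = (fun x => f x - g x))//; apply/funext => x; ring.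
Qed.

Lemma sqi_sum (s : seq nat) (F : nat -> R -> R) : (forall k, sqi (F k)) ->
  sqi (fun x => \sum_(k <- s) F k x).
Proof.
move=> hF; elim: s => [|k s IH].
  by under eq_fun do rewrite big_nil; exact: sqi_cst.
by under eq_fun do rewrite big_cons; exact: sqi_add.
Qed.

Lemma pairingC f g : pairing L f g = pairing L g f.
Proof. by apply: eq_Rintegral => x _; rewrite mulrC. Qed.

Lemma pairingDl f g h : sqi f -> sqi g -> sqi h ->
  pairing L (fun x => f x + g x) h = pairing L f h + pairing L g h.
Proof.
move=> hf hg hh; rewrite /pairing.
under eq_Rintegral do rewrite mulrDl.
by apply: RintegralD => //; exact: sqi_mul.
Qed.

Lemma pairingZl (c : R) f h : sqi f -> sqi h ->
  pairing L (fun x => c * f x) h = c * pairing L f h.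
Proof.
move=> hf hh; rewrite /pairing.
under eq_Rintegral do rewrite -mulrA.
by apply: RintegralZl => //; exact: sqi_mul.
Qed.

Lemma pairingBl f g h : sqi f -> sqi g -> sqi h ->
  pairing L (fun x => f x - g x) h = pairing L f h - pairing L g h.
Proof.
move=> hf hg hh; have := pairingDl hf (sqi_scale (-1) hg) hh.
rewrite pairingZl// mulN1r => <-; apply: eq_Rintegral => x _; ring.
Qed.

Lemma pairing_suml (s : seq nat) (F : nat -> R -> R) h : (forall k, sqi (F k)) -> sqi h ->
  pairing L (fun x => \sum_(k <- s) F k x) h = \sum_(k <- s) pairing L (F k) h.
Proof.
move=> hF hh; elim: s => [|k s IH].
  under eq_fun do rewrite big_nil; rewrite big_nil /pairing.
  by under eq_Rintegral do rewrite mul0r; rewrite Rintegral_cst// mul0r.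
under eq_fun do rewrite big_cons; rewrite big_cons -IH pairingDl//; exact: sqi_sum.
Qed.

Lemma pairing_ge0 f : 0 <= pairing L f f.
Proof. by apply: Rintegral_ge0 => x _; rewrite -expr2 sqr_ge0. Qed.

Lemma pairing_ae f f' g : {ae mu, forall x, I x -> f x = f' x} -> sqi f -> sqi f' -> sqi g ->
  pairing L f g = pairing L f' g.
Proof.
move=> ff' hf hf' hg; congr fine; apply: ae_eq_integral => //.
- by apply: (measurable_int mu); exact: sqi_mul.
- by apply: (measurable_int mu); exact: sqi_mul.
by apply: ae_imp ff' => x h Ix; rewrite /= h.
Qed.

Lemma cauchy_schwarz f g : sqi f -> sqi g ->
  pairing L f g ^+ 2 <= pairing L f f * pairing L g g.
Proof.
move=> hf hg.
have key (c : R) : 0 <= pairing L f f + 2 * c * pairing L f g + c ^+ 2 * pairing L g g.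
  have h1 := sqi_add hf (sqi_scale c hg).
  have := pairing_ge0 (fun x => f x + c * g x).
  rewrite pairingDl//; last exact: sqi_scale.
  rewrite pairingZl// [pairing L f _]pairingC [pairing L g (fun _ => _)]pairingC.
  rewrite !pairingDl ?pairingZl//; try exact: sqi_scale.
  rewrite [pairing L g f]pairingC => /le_trans; apply; rewrite le_eqVlt; apply/orP; left.
  by apply/eqP; ring.
set A := pairing L f f in key *; set B := pairing L f g in key *.
set C := pairing L g g in key *.
have C0 : 0 <= C by exact: pairing_ge0.
have A0 : 0 <= A by exact: pairing_ge0.
move: C0; rewrite le_eqVlt => /orP[/eqP C0|C0].
  rewrite -C0 mulr0; have [->|B0] := eqVneq B 0; first by rewrite expr0n.
  (* For [C = 0] the form is affine in [c], and this [c] gives it the negative value - A - 2. *)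
  have := key (- (A + 1) / B); rewrite -C0 mulr0 addr0.
  have -> : 2 * (- (A + 1) / B) * B = - (2 * (A + 1)) by field.
  by lra.
have := key (- B / C).
have -> : A + 2 * (- B / C) * B + (- B / C) ^+ 2 * C = (A * C - B ^+ 2) / C by field; rewrite gt_eqF.
by rewrite pmulr_lge0 ?invr_gt0// subr_ge0.
Qed.

End SquareIntegrable.

(** * The orthonormal trigonometric system of mean zero *)

Section TrigBasis.
Context {R : realType}.
Notation mu := (@lebesgue_measure R).
Set Implicit Arguments.
Unset Strict Implicit.
Variable L : R.
Hypothesis L0 : 0 < L.
Implicit Types (f : R -> R) (x : R) (N : nat).

(** Each frequency serves two consecutive indices, and the lowest one is 2 pi / L: the constant mode
    is left out because of the zero mean. *)
Definition freq (k : nat) : R := 2 * pi / L * (k./2.+1)%:R.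

(* [tb (2m)] and [tb (2m+1)] are the normalized cosine and sine of index [m+1]. *)
Definition tb (k : nat) (x : R) : R :=
  Num.sqrt (2 / L) * (if odd k then sin (freq k * x) else cos (freq k * x)).

Definition coef f (k : nat) : R := pairing L f (tb k).

Lemma freq_gt0 k : 0 < freq k.
Proof. by rewrite /freq mulr_gt0// divr_gt0// mulr_gt0// pi_gt0. Qed.

Lemma freqL k : freq k * L = (2 * pi) * (k./2.+1)%:R.
Proof.
rewrite /freq; move: (k./2.+1)%:R => n.
have -> : 2 * pi / L * n * L = (2 * pi) * n * (L^-1 * L) by ring.
by rewrite mulVf ?mulr1// gt_eqF.
Qed.

Lemma sin_cos_2pin n : sin (2 * pi * n%:R : R) = 0 /\ cos (2 * pi * n%:R : R) = 1.
Proof.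
have e : 2 * pi * n%:R = 0 + (pi *+ 2) *+ n :> R by rewrite add0r -[RHS]mulr_natr -[pi *+ 2]mulr_natr (mulrC 2).
rewrite e; split.
  by rewrite (periodicn (@sinD2pi R)) sin0.
by rewrite (periodicn (@cosD2pi R)) cos0.
Qed.

Lemma is_derive_cosZ (c x : R) : is_derive x 1 (fun y => cos (c * y)) (- c * sin (c * x)).
Proof.
have dw : is_derive x (1 : R) (fun y : R => c * y) (c * 1).
  by apply: is_derive_scale; exact: is_derive_id.
apply: (is_derive_congr (is_derive1_comp (is_derive_cos (c * x)) dw)) => //=.
by ring.
Qed.

Lemma is_derive_sinZ (c x : R) : is_derive x 1 (fun y => sin (c * y)) (c * cos (c * x)).
Proof.
have dw : is_derive x (1 : R) (fun y : R => c * y) (c * 1).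
  by apply: is_derive_scale; exact: is_derive_id.
apply: (is_derive_congr (is_derive1_comp (is_derive_sin (c * x)) dw)) => //=.
by ring.
Qed.

Lemma Rintegral_derive (a b : R) (f F : R -> R) : a <= b -> continuous f ->
  (forall x, is_derive x 1 F (f x)) ->
  \int[mu]_(x in `[a, b]) f x = F b - F a.
Proof.
rewrite le_eqVlt => /orP[/eqP<- _ _|ab cf dF].
  by rewrite set_itv1 Rintegral_set1 subrr.
rewrite /Rintegral (@continuous_FTC2 R f F a b ab)//.
- exact: continuous_subspaceT.
- have cF : continuous F by move=> x; exact: (is_derive_continuous (dF x)).
  split; first by move=> x _; case: (dF x).
  + exact/cvg_at_right_filter/cF.
  + exact/cvg_at_left_filter/cF.
- by move=> x _; rewrite derive1E; case: (dF x).
Qed.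

Lemma continuous_cosZ (c : R) : continuous (fun x : R => cos (c * x)).
Proof. by move=> x; exact: (is_derive_continuous (is_derive_cosZ c x)). Qed.

Lemma continuous_sinZ (c : R) : continuous (fun x : R => sin (c * x)).
Proof. by move=> x; exact: (is_derive_continuous (is_derive_sinZ c x)). Qed.

Lemma integral_cosZ (c : R) : c != 0 ->
  \int[mu]_(x in `[0, L]) cos (c * x) = sin (c * L) / c.
Proof.
move=> c0; transitivity (c^-1 * sin (c * L) - c^-1 * sin (c * 0)); last first.
  by rewrite mulr0 sin0 mulr0 subr0 mulrC.
apply: (@Rintegral_derive 0 L _ (fun x => c^-1 * sin (c * x)) (ltW L0)).
  exact: continuous_cosZ.
move=> x; apply: (is_derive_congr (is_derive_scale c^-1 (is_derive_sinZ c x))) => //.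
by rewrite mulrA mulVf// mul1r.
Qed.

Lemma integral_sinZ (c : R) : c != 0 ->
  \int[mu]_(x in `[0, L]) sin (c * x) = (1 - cos (c * L)) / c.
Proof.
move=> c0; transitivity (- c^-1 * cos (c * L) - - c^-1 * cos (c * 0)); last first.
  by rewrite mulr0 cos0 mulr1 mulNr opprK addrC mulrBl mul1r mulrC.
apply: (@Rintegral_derive 0 L _ (fun x => (- c^-1) * cos (c * x)) (ltW L0)).
  exact: continuous_sinZ.
move=> x; apply: (is_derive_congr (is_derive_scale (- c^-1) (is_derive_cosZ c x))) => //.
by rewrite mulrA mulrNN mulVf// mul1r.
Qed.

(** A sum of two frequencies is also of this form, as the difference of [m + n] and 0. *)
Lemma integral_trig (m n : nat) : let w := 2 * pi / L in
  \int[mu]_(x in `[0, L]) cos ((w * m%:R - w * n%:R) * x) = (if m == n then L else 0) /\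
  \int[mu]_(x in `[0, L]) sin ((w * m%:R - w * n%:R) * x) = 0.
Proof.
move=> w; have wL (j : nat) : w * j%:R * L = 2 * pi * j%:R.
  rewrite /w; move: (j%:R) => r.
  have -> : 2 * pi / L * r * L = (2 * pi) * r * (L^-1 * L) by ring.
  by rewrite mulVf ?mulr1// gt_eqF.
have w0 : w != 0 by rewrite gt_eqF// divr_gt0// mulr_gt0// pi_gt0.
have [->|mn] := eqVneq m n.
  rewrite subrr; split.
    under eq_Rintegral do rewrite mul0r cos0.
    by rewrite Rintegral_cst//= lebesgue_measure_itv/= lte_fin L0 -EFinB/= subr0 mul1r.
  under eq_Rintegral do rewrite mul0r sin0.
  by rewrite Rintegral_cst// mul0r.
have c0 : w * m%:R - w * n%:R != 0.
  by rewrite -mulrBr mulf_neq0// subr_eq0 eqr_nat.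
have [sm cm] := sin_cos_2pin m; have [sn cn] := sin_cos_2pin n.
rewrite integral_cosZ// integral_sinZ// !mulrBl !wL sinB cosB sm cm sn cn.
by rewrite !mul0r !mulr0 !mulr1 subrr addr0 subrr !mul0r.
Qed.

Lemma tb_continuous k : continuous (tb k).
Proof.
rewrite /tb; case: odd; apply: continuous_scale; [exact: continuous_sinZ|exact: continuous_cosZ].
Qed.

Lemma sqi_tb k : sqi L (tb k).
Proof. exact/sqi_cont/tb_continuous. Qed.

Lemma tb_periodic k : periodic (tb k) L.
Proof.
move=> x; rewrite /tb mulrDr freqL.
have [s c] := sin_cos_2pin (k./2.+1).
by rewrite sinD cosD s c !mulr0 !mulr1 addr0 subr0.
Qed.

Lemma tb_bound k x : `|tb k x| <= Num.sqrt (2 / L).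
Proof.
rewrite /tb normrM ger0_norm ?sqrtr_ge0// ler_piMr ?sqrtr_ge0//.
by case: odd; rewrite ler_norml ?sin_geN1 ?sin_le1 ?cos_geN1 ?cos_le1.
Qed.

Lemma tb_sqr_bound k x : tb k x ^+ 2 <= 2 / L.
Proof.
have c0 : 0 <= 2 / L by rewrite divr_ge0// ltW.
rewrite -[leLHS]real_normK ?num_real// -[leRHS]sqr_sqrtr//.
by rewrite ler_pXn2r ?nnegrE// ?sqrtr_ge0// tb_bound.
Qed.

Lemma tb_orthonormal j k : pairing L (tb j) (tb k) = (j == k)%:R.
Proof.
set w := 2 * pi / L; set m := j./2.+1; set n := k./2.+1.
have c0 : 0 <= 2 / L by rewrite divr_ge0// ltW.
have [Im Jm] := integral_trig m n.
have [] := integral_trig (m + n)%N 0; rewrite mulr0 subr0 addn_eq0/= natrD mulrDr => Ip Jp.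
have ic c d : integ L (fun x => d * cos (c * x)).
  by apply: integ_cont; apply: continuous_scale; exact: continuous_cosZ.
have isn c d : integ L (fun x => d * sin (c * x)).
  by apply: integ_cont; apply: continuous_scale; exact: continuous_sinZ.
have eE : pairing L (tb j) (tb k) = 2 / L * \int[mu]_(x in `[0, L])
    ((if odd j then sin (w * m%:R * x) else cos (w * m%:R * x)) *
     (if odd k then sin (w * n%:R * x) else cos (w * n%:R * x))).
  rewrite -RintegralZl//; last first.
    apply: sqi_mul; apply: sqi_cont; case: odd;
      [exact: continuous_sinZ|exact: continuous_cosZ|exact: continuous_sinZ|exact: continuous_cosZ].
  apply: eq_Rintegral => x _; rewrite /tb /freq -/w -/m -/n.
  by rewrite mulrACA -expr2 sqr_sqrtr.
have trig1 (a b : R) : cos a * cos b = 2^-1 * cos (a - b) + 2^-1 * cos (a + b).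
  by rewrite cosB cosD; field.
have trig2 (a b : R) : sin a * sin b = 2^-1 * cos (a - b) + (- 2^-1) * cos (a + b).
  by rewrite cosB cosD; field.
have trig3 (a b : R) : sin a * cos b = 2^-1 * sin (a - b) + 2^-1 * sin (a + b).
  by rewrite sinB sinD; field.
have trig4 (a b : R) : cos a * sin b = (- 2^-1) * sin (a - b) + 2^-1 * sin (a + b).
  by rewrite sinB sinD; field.
have D (c d x : R) : c * x - d * x = (c - d) * x by rewrite mulrBl.
have P (c d x : R) : c * x + d * x = (c + d) * x by rewrite mulrDl.
have jk : (j == k) = (m == n) && (odd j == odd k).
  apply/eqP/andP => [E|[/eqP[jk2] /eqP jk']]; first by rewrite /m /n E !eqxx.
  by rewrite -[LHS]odd_double_half -[RHS]odd_double_half jk2 jk'.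
have cc c d : \int[mu]_(x in `[0, L]) (c * cos ((w * m%:R - w * n%:R) * x) + d * cos ((w * m%:R + w * n%:R) * x))
   = c * (if m == n then L else 0).
  rewrite RintegralD//; [|exact: ic|exact: ic].
  rewrite !RintegralZl// ?Im ?Ip ?mulr0 ?addr0//; apply: integ_cont; exact: continuous_cosZ.
have ss c d : \int[mu]_(x in `[0, L]) (c * sin ((w * m%:R - w * n%:R) * x) + d * sin ((w * m%:R + w * n%:R) * x))
   = 0.
  rewrite RintegralD//; [|exact: isn|exact: isn].
  rewrite !RintegralZl// ?Jm ?Jp ?mulr0 ?addr0//; apply: integ_cont; exact: continuous_sinZ.
rewrite eE jk; case: (odd j) (odd k) => [] [] /=.
- under eq_Rintegral do rewrite trig2 D P.
  by rewrite cc andbT; case: eqP => _ /=; [rewrite mulr1n; field; rewrite gt_eqF|rewrite !mulr0].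
- under eq_Rintegral do rewrite trig3 D P.
  by rewrite ss andbF mulr0.
- under eq_Rintegral do rewrite trig4 D P.
  by rewrite ss andbF mulr0.
- under eq_Rintegral do rewrite trig1 D P.
  by rewrite cc andbT; case: eqP => _ /=; [rewrite mulr1n; field; rewrite gt_eqF|rewrite !mulr0].
Qed.

End TrigBasis.

(** * Partial sums, Bessel's inequality and differentiation of the basis *)

Section Bessel.
Context {R : realType}.
Notation mu := (@lebesgue_measure R).
Set Implicit Arguments.
Unset Strict Implicit.
Variable L : R.
Hypothesis L0 : 0 < L.
Implicit Types (f g h : R -> R) (x : R) (N : nat).
Notation tb := (tb L).
Notation coef := (coef L).
Notation freq := (freq L).

Lemma sum_delta (c : nat -> R) k m N :
  \sum_(m <= i < N) c i * (i == k)%:R = if (m <= k < N)%N then c k else 0.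
Proof.
case: ifPn => [kN|kN].
  rewrite (bigD1_seq k) ?mem_index_iota ?iota_uniq//= eqxx mulr1 big1 ?addr0// => i /negPf->.
  by rewrite mulr0.
rewrite big_seq big1// => i; rewrite mem_index_iota => iN.
have [E|] := eqVneq i k; last by rewrite mulr0.
by rewrite -E iN in kN.
Qed.

Definition tsum (c : nat -> R) (m N : nat) (x : R) : R := \sum_(m <= k < N) c k * tb k x.

Lemma sqi_tsum c m N : sqi L (tsum c m N).
Proof. by apply: sqi_sum => k; apply: sqi_scale; exact: sqi_tb. Qed.

Lemma tsum_continuous c m N : continuous (tsum c m N).
Proof.
rewrite /tsum; elim: (index_iota m N) => [|k s IH].
  by under eq_fun do rewrite big_nil; exact: cst_continuous.
under eq_fun do rewrite big_cons; apply: continuous_add => //.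
exact/continuous_scale/tb_continuous.
Qed.

Lemma pairing_tsuml c m N f : sqi L f ->
  pairing L (tsum c m N) f = \sum_(m <= k < N) c k * coef f k.
Proof.
move=> hf; rewrite pairing_suml//; last first.
  by move=> k; apply: sqi_scale; exact: sqi_tb.
apply: eq_bigr => k _; rewrite pairingZl//; last exact: sqi_tb.
by rewrite pairingC.
Qed.

Lemma coef_tsum c m N k :
  coef (tsum c m N) k = if (m <= k < N)%N then c k else 0.
Proof.
rewrite /coef pairing_tsuml; last exact: sqi_tb.
rewrite -sum_delta; apply: eq_bigr => i _.
by rewrite /coef tb_orthonormal// eq_sym.
Qed.

Lemma pairing_tsum c m N : pairing L (tsum c m N) (tsum c m N) = \sum_(m <= k < N) c k ^+ 2.
Proof.
rewrite pairing_tsuml; last exact: sqi_tsum.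
rewrite !big_seq; apply: eq_bigr => k.
by rewrite mem_index_iota coef_tsum => ->; rewrite expr2.
Qed.

Lemma pairing_sub_tsum f m N : sqi L f ->
  pairing L (fun x => f x - tsum (coef f) m N x) (fun x => f x - tsum (coef f) m N x)
  = pairing L f f - \sum_(m <= k < N) coef f k ^+ 2.
Proof.
move=> hf; have ht := sqi_tsum (coef f) m N.
rewrite pairingBl ?[pairing L f (fun x => _)]pairingC ?[pairing L (tsum _ _ _) (fun x => _)]pairingC//; last exact: sqi_sub.
rewrite !pairingBl// pairing_tsum [pairing L f (tsum _ _ _)]pairingC pairing_tsuml//.
by under [X in _ - X - _]eq_bigr do rewrite -expr2; ring.
Qed.

Lemma bessel f m N : sqi L f -> \sum_(m <= k < N) coef f k ^+ 2 <= pairing L f f.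
Proof.
move=> hf; rewrite -subr_ge0 -pairing_sub_tsum//; exact: pairing_ge0.
Qed.

Lemma coefD f g k : sqi L f -> sqi L g -> coef (fun x => f x + g x) k = coef f k + coef g k.
Proof. by move=> hf hg; apply: pairingDl => //; exact: sqi_tb. Qed.

Lemma coefB f g k : sqi L f -> sqi L g -> coef (fun x => f x - g x) k = coef f k - coef g k.
Proof. by move=> hf hg; apply: pairingBl => //; exact: sqi_tb. Qed.

Lemma coefZ (c : R) f k : sqi L f -> coef (fun x => c * f x) k = c * coef f k.
Proof. by move=> hf; apply: pairingZl => //; exact: sqi_tb. Qed.

Definition mean f : R := \int[mu]_(x in `[0, L]) f x.

Lemma meanE f : mean f = pairing L f (fun=> 1).
Proof. by apply: eq_Rintegral => x _; rewrite mulr1. Qed.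

Lemma mean_tb k : mean (tb k) = 0.
Proof.
rewrite /mean /tb RintegralZl//; last first.
  apply: integ_cont; case: odd; [exact: continuous_sinZ|exact: continuous_cosZ].
have f0 : freq k != 0 by rewrite gt_eqF// freq_gt0.
have [s c] := @sin_cos_2pin R (k./2.+1).
case: odd; rewrite ?integral_sinZ ?integral_cosZ// freqL// ?s ?c ?subrr mul0r mulr0//.
Qed.

Lemma mean_tsum c m N : mean (tsum c m N) = 0.
Proof.
rewrite meanE pairing_tsuml; last by exact: sqi_cst.
by rewrite big1// => k _; rewrite /coef pairingC -meanE mean_tb mulr0.
Qed.

(* The cosine and the sine of the same frequency are exchanged by differentiation. *)
Definition partner (k : nat) : nat := if odd k then k.-1 else k.+1.
Definition dfreq (k : nat) : R := if odd k then freq k else - freq k.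

Lemma partnerK : involutive partner.
Proof.
move=> k; rewrite /partner; have [ok|ek] := boolP (odd k).
  by case: k ok => //= k /negPf->.
by rewrite /= ek.
Qed.

Lemma freq_partner k : freq (partner k) = freq k.
Proof.
rewrite /freq; congr (_ * _%:R).
rewrite /partner; have [ok|ek] := boolP (odd k).
  by case: k ok => //= k ek; rewrite uphalf_half (negPf ek).
by rewrite /= uphalf_half (negPf ek).
Qed.

Lemma dfreq_partner k : dfreq (partner k) = - dfreq k.
Proof.
rewrite /dfreq freq_partner /partner; have [ok|ek] := boolP (odd k).
  by case: k ok => //= k ek; rewrite (negPf ek).
by rewrite /= ek opprK.
Qed.

Lemma dfreq_sqr k : dfreq k ^+ 2 = freq k ^+ 2.
Proof. by rewrite /dfreq; case: odd; rewrite ?sqrrN. Qed.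

Lemma is_derive_tb k x : is_derive x 1 (tb k) (dfreq k * tb (partner k) x).
Proof.
rewrite /tb freq_partner /dfreq /partner; case: (boolP (odd k)) => ok.
  case: k ok => //= k ek; rewrite (negPf ek).
  by apply: (is_derive_congr (is_derive_scale (Num.sqrt (2 / L)) (is_derive_sinZ _ x))) => //; ring.
rewrite /= ok.
by apply: (is_derive_congr (is_derive_scale (Num.sqrt (2 / L)) (is_derive_cosZ _ x))) => //; ring.
Qed.

End Bessel.

(** * Completeness of the trigonometric system *)

Section Completeness.
Context {R : realType}.
Set Implicit Arguments.
Unset Strict Implicit.
Variable L : R.
Hypothesis L0 : 0 < L.
Implicit Types (f h : R -> R) (x : R) (N n : nat).
Notation tb := (tb L).
Notation coef := (coef L).
Notation freq := (freq L).

Let w : R := 2 * pi / L.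

Section Annihilator.
Variable f : R -> R.
Hypotheses (hf : sqi L f) (f0 : mean L f = 0) (fk : forall k, coef f k = 0).

Let cc (c y : R) : continuous (fun x => cos (c * (x - y))).
Proof.
move=> x; apply: (@continuous_comp _ _ _ (fun x => x - y) (fun x => cos (c * x))).
  by apply: cvgB; [exact: cvg_id|exact: cvg_cst].
exact: continuous_cosZ.
Qed.

Let sc (j : nat) (c d y : R) : continuous (fun x => cos (c * (x - y)) ^+ j * cos (d * (x - y))).
Proof.
apply: continuous_mul; last exact: cc.
elim: j => [|j IH]; first by under eq_fun do rewrite expr0; exact: cst_continuous.
by under eq_fun do rewrite exprS; apply: continuous_mul; [exact: cc|exact: IH].
Qed.

(** The addition formula writes a translated cosine in the two basis functions of its frequency;
    frequency 0 is the mean. *)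
Lemma annihilate_cos n y : pairing L f (fun x => cos (w * n%:R * (x - y))) = 0.
Proof.
case: n => [|n].
  under eq_fun do rewrite mulr0 mul0r cos0.
  by rewrite -meanE.
pose s := Num.sqrt (2 / L).
have s0 : s != 0 by rewrite gt_eqF// sqrtr_gt0 divr_gt0.
pose u := w * n.+1%:R.
have fr1 : freq n.*2 = u by rewrite /freq half_double.
have fr2 : freq n.*2.+1 = u by rewrite /freq /= uphalf_double.
have -> : (fun x => cos (u * (x - y))) =
   (fun x => cos (u * y) / s * tb n.*2 x + sin (u * y) / s * tb n.*2.+1 x).
  apply/funext => x; rewrite mulrBr cosB /tb fr1 fr2 /= odd_double -/s /=.
  by field.
have st k c : sqi L (fun x => c * tb k x) by apply: sqi_scale; exact: sqi_tb.
rewrite pairingC (pairingDl (st _ _) (st _ _) hf) !(pairingZl _ (sqi_tb _ _) hf).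
have hk k : pairing L (tb k) f = 0 by rewrite pairingC; exact: fk.
by rewrite !hk !mulr0 addr0.
Qed.

(** The product formula trades one factor of the power for the two neighbouring frequencies. At
    frequency 0, the power [j.+1] is the power [j] at frequency 1. *)
Lemma annihilate_cosX j : forall n y,
  pairing L f (fun x => cos (w * (x - y)) ^+ j * cos (w * n%:R * (x - y))) = 0.
Proof.
elim: j => [|j IH] n y.
  by under eq_fun do rewrite expr0 mul1r; exact: annihilate_cos.
case: n => [|n].
  have := IH 1%N y; under eq_fun do rewrite mulr1 -exprSr.
  by under [in X in _ -> X]eq_fun do rewrite mulr0 mul0r cos0 mulr1.
have E : (fun x => cos (w * (x - y)) ^+ j.+1 * cos (w * n.+1%:R * (x - y))) =
  (fun x => 2^-1 * (cos (w * (x - y)) ^+ j * cos (w * n.+2%:R * (x - y))) +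
            2^-1 * (cos (w * (x - y)) ^+ j * cos (w * n%:R * (x - y)))).
  apply/funext => x; set t := x - y.
  have -> : w * n.+2%:R * t = w * n.+1%:R * t + w * t by rewrite -[n.+2]addn1 natrD; ring.
  have -> : w * n%:R * t = w * n.+1%:R * t - w * t by rewrite -[n.+1]addn1 natrD; ring.
  by rewrite cosB cosD exprSr; field.
rewrite E pairingC.
have hs m : sqi L (fun x => cos (w * (x - y)) ^+ j * cos (w * m%:R * (x - y))).
  by apply: sqi_cont; exact: sc.
rewrite pairingDl ?(pairingZl _ (hs _) hf)//; try (apply: sqi_scale; exact: hs).
have hk m : pairing L (fun x => cos (w * (x - y)) ^+ j * cos (w * m%:R * (x - y))) f = 0.
  by rewrite pairingC.
by rewrite !hk !mulr0 addr0.
Qed.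

Lemma annihilate_poly (p : {poly R}) y : pairing L f (fun x => p.[cos (w * (x - y))]) = 0.
Proof.
have E : (fun x => p.[cos (w * (x - y))]) =
   (fun x => \sum_(i <- index_iota 0 (size p)) p`_i * cos (w * (x - y)) ^+ i).
  by apply/funext => x; rewrite horner_coef big_mkord.
have hs m : sqi L (fun x => cos (w * (x - y)) ^+ m).
  apply: sqi_cont; have := sc (j := m) (c := w) (d := 0) (y := y).
  by under [in X in X -> _]eq_fun do rewrite mul0r cos0 mulr1.
rewrite E pairingC pairing_suml//; last by move=> k; exact: sqi_scale.
rewrite big1// => k _; rewrite (pairingZl _ (hs _) hf) pairingC.
have := annihilate_cosX k 0 y.
by under eq_fun do rewrite mulr0 mul0r cos0 mulr1; move=> ->; rewrite mulr0.
Qed.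

End Annihilator.

(** The difference of the cosines is twice a product of two sines whose arguments lie in (0, pi). *)
Lemma cos_gt_cos (a t : R) : 0 < a < pi -> - a < t < a -> cos a < cos t.
Proof.
move=> /andP[a0 ap] /andP[ta1 ta2]; rewrite -subr_gt0.
have -> : cos t - cos a = 2 * (sin ((a + t) / 2) * sin ((a - t) / 2)).
  have -> : cos t = cos ((a + t) / 2 - (a - t) / 2) by congr cos; field.
  have -> : cos a = cos ((a + t) / 2 + (a - t) / 2) by congr cos; field.
  by rewrite cosB cosD; ring.
by rewrite mulr_gt0// mulr_gt0// sin_gt0_pi//; apply/andP; split; lra.
Qed.

Lemma cos_lt_cos (a t : R) : 0 < a < pi -> a < t < 2 * pi - a -> cos t < cos a.
Proof.
move=> /andP[a0 ap] /andP[ta1 ta2]; rewrite -subr_gt0.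
have -> : cos a - cos t = 2 * (sin ((t + a) / 2) * sin ((t - a) / 2)).
  have -> : cos t = cos ((t + a) / 2 + (t - a) / 2) by congr cos; field.
  have -> : cos a = cos ((t + a) / 2 - (t - a) / 2) by congr cos; field.
  by rewrite cosB cosD; ring.
by rewrite mulr_gt0// mulr_gt0// sin_gt0_pi//; apply/andP; split; lra.
Qed.

Lemma bernoulli_ineq (t : R) n : -1 <= t -> 1 + n%:R * t <= (1 + t) ^+ n.
Proof.
move=> t1; elim: n => [|n IH]; first by rewrite mul0r addr0 expr0.
rewrite exprS; apply: (@le_trans _ _ ((1 + t) * (1 + n%:R * t))); last first.
  by rewrite ler_wpM2l//; lra.
have -> : n.+1%:R = n%:R + 1 :> R by rewrite -addn1 natrD.
have : 0 <= n%:R * t ^+ 2 by rewrite mulr_ge0// sqr_ge0.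
by move: (n%:R : R) => r; rewrite expr2; lra.
Qed.

(* Polynomials separating the two sides of a threshold, as in the
   Brosowski-Deutsch proof of the Stone-Weierstrass theorem. *)
Lemma threshold_bounds (q : R) (K n : nat) : 0 <= q <= 1 ->
  [/\ 0 <= (1 - q ^+ n) ^+ (K ^ n) <= 1,
      1 - (K%:R * q) ^+ n <= (1 - q ^+ n) ^+ (K ^ n) &
      (K%:R * q) ^+ n * (1 - q ^+ n) ^+ (K ^ n) <= 1].
Proof.
move=> /andP[q0 q1]; set t := q ^+ n.
have t0 : 0 <= t by rewrite exprn_ge0.
have t1 : t <= 1 by rewrite exprn_ile1.
have P0 : 0 <= (1 - t) ^+ (K ^ n) by rewrite exprn_ge0// subr_ge0.
have E : (K%:R * q) ^+ n = (K ^ n)%:R * t by rewrite exprMn natrX.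
split.
- by rewrite P0/= exprn_ile1// ?subr_ge0//; lra.
- have := @bernoulli_ineq (- t) (K ^ n); rewrite E mulrN; apply; lra.
- have h := @bernoulli_ineq t (K ^ n) _; rewrite E.
  (* Bernoulli's inequality bounds (K q)^n by (1 + t)^(K^n), and the product with (1 - t)^(K^n) is a
     power of 1 - t^2. *)
  apply: (@le_trans _ _ ((1 + t) ^+ (K ^ n) * (1 - t) ^+ (K ^ n))).
    by rewrite ler_wpM2r// (le_trans _ (h _))//; lra.
  rewrite -exprMn exprn_ile1//; nra.
Qed.

Lemma threshold_cvg (q : R) (K : nat) : 0 <= q <= 1 -> K%:R * q != 1 ->
  (fun n => (1 - q ^+ n) ^+ (K ^ n)) @ \oo --> (if K%:R * q < 1 then 1 else 0 : R).
Proof.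
move=> q01 r1; have q0 : 0 <= q by case/andP: q01.
set r := K%:R * q in r1 *; have r0 : 0 <= r by rewrite mulr_ge0.
case: ifPn => [rlt|]; last rewrite -leNgt le_eqVlt eq_sym (negPf r1)/= => rgt.
  apply: (@squeeze_cvgr _ _ _ _ (fun n => 1 - r ^+ n) (cst 1)).
  - by near=> n; have [/andP[_ ->] -> _] := threshold_bounds K n q01.
  - rewrite -[X in _ --> X]subr0; apply: cvgB; first exact: cvg_cst.
    by apply: cvg_expr; rewrite ger0_norm.
  - exact: cvg_cst.
apply: (@squeeze_cvgr _ _ _ _ (cst 0) (fun n => r^-1 ^+ n)).
- near=> n; have [/andP[-> _] _ h] := threshold_bounds K n q01.
  by rewrite exprVn -[leRHS]mul1r ler_pdivlMr ?exprn_gt0//; [rewrite mulrC|lra].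
- exact: cvg_cst.
- by apply: cvg_expr; rewrite ger0_norm ?invr_ge0// invf_lt1//; lra.
Unshelve. all: by end_near. Qed.

End Completeness.

Section AlmostEverywhere.
Context {R : realType}.
Notation mu := (@lebesgue_measure R).
Set Implicit Arguments.
Unset Strict Implicit.
Implicit Types (P Q : R -> Prop).

Lemma ae_and P Q : {ae mu, forall x, P x} -> {ae mu, forall x, Q x} ->
  {ae mu, forall x, P x /\ Q x}.
Proof.
by move=> hP hQ; apply: filterI => //; exact: (ae_filter_ringOfSetsType mu).
Qed.

Lemma ae_neq (a : R) : {ae mu, forall x, x <> a}.
Proof.
exists [set a]; split => //; first exact: lebesgue_measure_set1.
by move=> x /= /contrapT.
Qed.

(** Translation invariance follows from the uniqueness of Lebesgue measure: the image measure under
    x |-> x + c takes the right value on every interval ]a, b]. *)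
Lemma ae_shift P (c : R) : {ae mu, forall x, P x} -> {ae mu, forall x, P (x + c)}.
Proof.
move=> [N [mN N0 hN]].
pose phi : measurableTypeR R -> measurableTypeR R := fun x => x + c.
have cphi : continuous (phi : R -> R).
  by move=> x; apply: cvgD; [exact: cvg_id|exact: cvg_cst].
have mphi : measurable_fun setT phi by exact: continuous_measurable_fun.
pose phi' : {mfun _ >-> _} := MeasurableFun.Pack (MeasurableFun.Class (isMeasurableFun.Build _ _ _ _ _ mphi)).
have E : forall A, measurable A -> mu A = pushforward mu phi' A.
  apply: lebesgue_measure_unique => _ [[a b]] _ <-.
  rewrite /pushforward.
  have Epre : phi' @^-1` [set` `]a, b]] = [set` `]a - c, b - c]].
    by apply/seteqP; split => x /=; rewrite !in_itv/= /phi ltrBlDr lerBrDr.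
  transitivity (mu [set` `]a - c, b - c]]); last by rewrite -Epre.
  rewrite !lebesgue_measure_itv/= !lte_fin ltrD2r.
  by case: ifPn => // _; rewrite -!EFinB; congr _%:E; ring.
exists (phi' @^-1` N); split.
- by rewrite -[X in measurable X]setTI; exact: (mphi measurableT _ mN).
- by have := E N mN; rewrite N0 /pushforward => ->.
- by move=> x /= hx; apply: hN => /= /hx.
Qed.

Lemma ae_countable_cover P (Q : nat -> R -> Prop) : (forall n, {ae mu, forall x, Q n x}) ->
  (forall x, (forall n, Q n x) -> P x) -> {ae mu, forall x, P x}.
Proof.
move=> hQ h.
have : mu.-negligible (\bigcup_n ~` [set x | Q n x]) by apply: negligible_bigcup => n; exact: hQ.
apply: negligibleS => x /= nP; apply: contrapT => hx; apply: nP; apply: h => n.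
by apply: contrapT => nQ; apply: hx; exists n.
Qed.

(** Countably many translates of [0, L] cover the line; [Q n] deals with the n-th one on either
    side. *)
Lemma ae_periodic (f g : R -> R) (L : R) : 0 < L -> periodic f L -> periodic g L ->
  {ae mu, forall x, [set` `[0, L]] x -> f x = g x} -> eq_ae f g.
Proof.
move=> L0 pf pg h.
pose Q (n : nat) x := (0 <= x + n%:R * L <= L -> f x = g x) /\
   (0 <= x - n%:R * L <= L -> f x = g x).
have pN (F : R -> R) : periodic F L -> forall x (n : nat), F (x + n%:R * L) = F x.
  by move=> pF x n; rewrite mulr_natl (periodicn pF).
apply: (@ae_countable_cover _ Q) => [n|x hx].
  apply: ae_and.
    apply: ae_imp (ae_shift (n%:R * L) h) => x /= hx h1.
    by rewrite -(pN f pf x n) -(pN g pg x n); apply: hx; rewrite in_itv.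
  apply: ae_imp (ae_shift (- (n%:R * L)) h) => x /= hx h1.
  rewrite -[x in LHS](subrK (n%:R * L)) -[x in RHS](subrK (n%:R * L)) !pN//; apply: hx.
  by rewrite in_itv.
have L0' := ltW L0.
have main (c : R) : 0 <= c -> c <= 1 -> 0 <= c * L <= L.
  by move=> c0 c1; rewrite mulr_ge0//= ler_piMl.
have main1 (a b : R) : b <= a -> a < b + 1 -> 0 <= a * L - b * L <= L.
  by move=> ba ab; rewrite -mulrBl; apply: main; lra.
have main2 (a b : R) : b <= a -> a < b + 1 -> 0 <= - (a * L) + (b + 1) * L <= L.
  by move=> ba ab; rewrite addrC -mulrBl; apply: main; lra.
have [x0|/ltW x0] := leP 0 x.
  have t0 : 0 <= x / L by rewrite divr_ge0// ltW.
  have [_ h2] := hx (Num.truncn (x / L)); apply: h2.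
  have /andP[t1 t2] := truncn_itv t0; rewrite -natr1 in t2.
  by have := main1 _ _ t1 t2; rewrite divfK ?gt_eqF.
have t0 : 0 <= - x / L by rewrite divr_ge0 ?oppr_ge0// ltW.
have [h1 _] := hx (Num.truncn (- x / L)).+1; apply: h1.
have /andP[t1 t2] := truncn_itv t0; rewrite -natr1 in t2 *.
by have := main2 _ _ t1 t2; rewrite divfK ?gt_eqF// opprK.
Qed.

End AlmostEverywhere.

(** * A function orthogonal to the system vanishes almost everywhere *)

Section CompletenessTheorem.
Context {R : realType}.
Notation mu := (@lebesgue_measure R).
Set Implicit Arguments.
Unset Strict Implicit.
Variable L : R.
Hypothesis L0 : 0 < L.
Implicit Types (f g h : R -> R) (x : R) (n : nat).
Notation coef := (coef L).
Notation I := [set` `[(0 : R), L]].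

Let mI : measurable (I : set (measurableTypeR R)). Proof. exact: measurable_itv. Qed.

Lemma integE f : integ L f ->
  (\int[mu]_(x in I) (f x)%:E = (\int[mu]_(x in I) f x)%:E)%E.
Proof. by move=> hf; rewrite /Rintegral fineK//; exact: integrable_fin_num. Qed.

Lemma Rdominated_cvg (u : nat -> R -> R) (g h : R -> R) :
  (forall n, measurable_fun I (u n)) -> measurable_fun I g -> integ L h ->
  {ae mu, forall x, I x -> u^~ x @ \oo --> g x} ->
  (forall n x, I x -> `|u n x| <= h x) ->
  (fun n => \int[mu]_(x in I) u n x) @ \oo --> \int[mu]_(x in I) g x.
Proof.
move=> mu_ mg ih ug uh.
have ui n : integ L (u n) by apply: (integ_le _ (uh n)).
have [||||| gi _ cv] := @dominated_convergence _ _ R mu I mI (fun n x => (u n x)%:E)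
    (fun x => (g x)%:E) (fun x => (h x)%:E).
- by move=> n; move/measurable_EFinP: (mu_ n).
- by move/measurable_EFinP: mg.
- apply: ae_imp ug => x hx Ix; apply: cvg_EFin; last exact: hx.
  by near=> n.
- exact: ih.
- by apply: aeW => x n Ix; rewrite lee_fin; exact: uh.
move: cv; rewrite (integE gi); under [X in X @ \oo --> _]eq_fun do rewrite integE//.
by move/fine_cvgP => [].
Unshelve. all: by end_near. Qed.

Section AnnihilatorVanishes.
Variable f : R -> R.
Hypotheses (hf : sqi L f) (f0 : mean L f = 0) (fk : forall k, coef f k = 0).

(* Polynomials in [cos (w * (x - x0 / 2))] converge boundedly to the indicator of
   the complement of [0, x0]. *)
Lemma integral_initial_eq0 (x0 : R) : 0 < x0 < L -> \int[mu]_(x in `[0, x0]) f x = 0.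
Proof.
move=> /andP[x00 x0L].
pose w : R := 2 * pi / L.
(* The interval [0, x0] is centred at [y] and [al] is its half-length in phase: the cosine of
   [w * (x - y)] exceeds [c] on ]0, x0[ and lies below [c] on ]x0, L[. *)
pose y := x0 / 2; pose al := w * y; pose c := cos al.
have p0 : 0 < pi :> R by exact: pi_gt0.
have w0 : 0 < w by rewrite divr_gt0// mulr_gt0.
have wL : w * L = 2 * pi by rewrite /w divfK// gt_eqF.
have al0 : 0 < al < pi.
  have y0 : 0 < y by rewrite divr_gt0.
  apply/andP; split; first by rewrite /al mulr_gt0.
  rewrite -(ltr_pM2l (ltr0n R 2)) -wL mulrCA ltr_pM2l// /y mulrCA divff ?mulr1//.
have c1 : 0 < 1 + c.
    have aux (a p : R) : 0 < a < p -> a < p < 2 * p - a.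
    by move=> /andP[? ?]; apply/andP; split; lra.
  rewrite addrC -ltrBlDr sub0r -cospi; apply: (@cos_lt_cos _ al pi al0).
  exact: (aux _ _ al0).
(* [K] is large enough for [q] to stay in [0, 1], while [K * q] = (1 + cos) / (1 + c) crosses the
   threshold 1 exactly where the cosine crosses [c]. *)
pose K := Num.bound (2 / (1 + c)).
have K2 : 2 / (1 + c) < K%:R.
  by apply: archi_boundP; rewrite divr_ge0// ltW.
have K0 : 0 < K%:R :> R by apply: lt_trans K2; rewrite divr_gt0.
have cK : 2 < K%:R * (1 + c) by rewrite -ltr_pdivrMr.
pose kk := (K%:R * (1 + c))^-1.
have kk0 : 0 < kk by rewrite invr_gt0 mulr_gt0.
pose q x := (1 + cos (w * (x - y))) * kk.
have q01 x : 0 <= q x <= 1.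
  have := cos_geN1 (w * (x - y)); have := cos_le1 (w * (x - y)).
  rewrite /q; move: (cos (w * _)) => t t1 t2.
  have t3 : 0 <= 1 + t by lra.
  rewrite (mulr_ge0 t3 (ltW kk0))/= ler_pdivrMr ?mulr_gt0// mul1r.
  by apply: le_trans (ltW cK); lra.
have Kq x : K%:R * q x = (1 + cos (w * (x - y))) / (1 + c).
  by rewrite /q /kk; field; rewrite (gt_eqF K0) (gt_eqF c1).
pose P n x := (1 - q x ^+ n) ^+ (K ^ n).
pose p n : {poly R} := (1 - ((1 + 'X) * kk%:P) ^+ n) ^+ (K ^ n).
have pP n x : (p n).[cos (w * (x - y))] = P n x.
  by rewrite /p /P /q !hornerE.
have cP n : continuous (P n).
  have cq : continuous q.
    apply: continuous_mul; last exact: cst_continuous.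
    apply: continuous_add; first exact: cst_continuous.
    move=> x; apply: (@continuous_comp _ _ _ (fun x => x - y) (fun x => cos (w * x))).
      by apply: cvgB; [exact: cvg_id|exact: cvg_cst].
    exact: continuous_cosZ.
  have cX (g : R -> R) m : continuous g -> continuous (fun x => g x ^+ m).
    move=> cg; elim: m => [|m IH]; first by under eq_fun do rewrite expr0; exact: cst_continuous.
    by under eq_fun do rewrite exprS; exact: continuous_mul.
  apply: (cX); apply: continuous_sub; first exact: cst_continuous.
  exact: cX.
pose g x : R := if x \in `[0, x0] then 0 else 1.
have gE : g = (fun x => 1 - \1_[set` `[0, x0]] x).
  apply/funext => x; rewrite /g indicE mem_setE.
  by case: (x \in _); rewrite /= ?mulr1n ?mulr0n ?subrr ?subr0.
have mg : measurable_fun setT g.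
  rewrite gE; apply: measurable_funB; first exact: measurable_cst.
  exact: measurable_indic.
have gb x : `|g x| <= 1 by rewrite /g; case: ifP; rewrite ?normr0 ?normr1.
have mf : measurable_fun I f by exact: sqi_meas.
have lim : (fun n => \int[mu]_(x in I) (f x * P n x)) @ \oo --> \int[mu]_(x in I) (f x * g x).
  apply: (@Rdominated_cvg _ _ (fun x => `|f x|)).
  - move=> n; apply: measurable_funM => //.
    by apply: measurable_funTS; exact: measurable_continuous.
  - by apply: measurable_funM => //; exact: measurable_funTS.
  - have := sqi_integ hf; exact: integrable_norm.
  (* At 0, [x0] and [L] the quantity [K * q] equals 1, and [threshold_cvg] says nothing there. *)
  - have := ae_and (ae_neq 0) (ae_and (ae_neq x0) (ae_neq L)).
    apply: ae_imp => x [/eqP xn0 [/eqP xnx0 /eqP xnL]]; rewrite /= in_itv/= => /andP[x_0 xL].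
    apply: cvgM; first exact: cvg_cst.
    have {}x_0 : 0 < x by rewrite lt_neqAle eq_sym xn0.
    have {}xL : x < L by rewrite lt_neqAle xnL.
    have [xlt|xge] := ltP x x0.
      have cc : c < cos (w * (x - y)).
        apply: cos_gt_cos => //; rewrite /al -mulrN !ltr_pM2l//.
        by rewrite /y; apply/andP; split; lra.
      have k1 : 1 < K%:R * q x by rewrite Kq ltr_pdivlMr// mul1r ltrD2l.
      have := threshold_cvg (K := K) (q01 x) (negbT (gt_eqF k1)).
      by rewrite ltNge (ltW k1)/= /g in_itv/= (ltW x_0) (ltW xlt).
    have {}xge : x0 < x by rewrite lt_neqAle eq_sym xnx0.
    have cc : cos (w * (x - y)) < c.
      apply: cos_lt_cos => //; rewrite -wL /al -mulrBr !ltr_pM2l//.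
      by rewrite /y; apply/andP; split; lra.
    have k1 : K%:R * q x < 1 by rewrite Kq ltr_pdivrMr// mul1r ltrD2l.
    have := threshold_cvg (K := K) (q01 x) (negbT (lt_eqF k1)).
    by rewrite k1 /g in_itv/= (ltW x_0)/= leNgt xge.
  - move=> n x _; rewrite normrM ler_piMr//.
    have [/andP[P0 P1] _ _] := threshold_bounds K n (q01 x).
    by rewrite ger0_norm.
have z n : \int[mu]_(x in I) (f x * P n x) = 0.
  have := annihilate_poly L0 hf f0 fk (p n) y.
  by rewrite /pairing -/w; under eq_Rintegral do rewrite pP.
have fg0 : \int[mu]_(x in I) (f x * g x) = 0.
  have : (fun n => \int[mu]_(x in I) (f x * P n x)) @ \oo --> (0 : R).
    by under eq_fun do rewrite z; exact: cvg_cst.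
  exact: (@cvg_unique _ (@Rhausdorff R) _ _ _ _ lim).
have ifg : integ L (fun x => f x * g x).
  apply: sqi_mul => //; apply: sqi_bounded; first exact: mg.
  exact: gb.
have : \int[mu]_(x in I) (f x - f x * g x) = 0.
  by rewrite RintegralB//; [rewrite fg0 subr0; exact: f0|exact: sqi_integ].
rewrite (_ : (fun x => f x - f x * g x) = f \_ [set` `[0, x0]]); last first.
  apply/funext => x; rewrite patchE gE indicE /=.
  by case: (_ \in _); rewrite ?subrr ?subr0 ?mulr0 ?mulr1 ?subr0 ?subrr.
rewrite -Rintegral_mkcondr (_ : I `&` _ = [set` `[0, x0]])//.
apply/seteqP; split => x /=; rewrite !in_itv/=; first by case.
by move=> /andP[h1 h2]; rewrite h1 h2 (le_trans h2 (ltW x0L)).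
Qed.

(** The integrals over [0, x] vanish for 0 < x < L, so the primitive of [f] is locally constant on
    ]0, L[; by Lebesgue's differentiation theorem its derivative is [f] almost everywhere. *)
Lemma annihilator_eq0 : {ae mu, forall x, I x -> f x = 0}.
Proof.
pose F := f \_ I.
have hF := integrable_locally mI (sqi_integ hf).
have iF y : mu.-integrable [set` `]-oo, y]] (EFin \o F).
  apply: (@integrableS _ _ _ _ setT) => //.
  have := sqi_integ hf; rewrite /integ (@integrable_mkcond _ _ _ mu I)//.
  by apply: eq_integrable => // x _; rewrite /F restrict_EFin.
have := FTC1Ny iF hF.
move=> h; have := ae_and h (ae_and (ae_neq 0) (ae_neq L)).
apply: ae_imp => x [hx [/eqP xn0 /eqP xnL]] /=; rewrite in_itv/= => /andP[x0 xL].
have {}x0 : 0 < x by rewrite lt_neqAle eq_sym xn0.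
have {}xL : x < L by rewrite lt_neqAle xnL.
have [_] := hx.
rewrite derive1E.
have -> : 'D_1 (fun x1 : R => \int[mu]_(t in [set` `]-oo, x1]]) F t) x
    = 'D_1 (cst 0 : R -> R) x.
  apply: near_eq_derive.
  have : \forall z \near x, z \in `]0, L[ by apply: near_in_itvoo; rewrite in_itv/= x0 xL.
  apply: filterS => z; rewrite in_itv/= => zL.
  rewrite -(integral_initial_eq0 zL) /F -Rintegral_mkcondr; congr (Rintegral _ _ _).
  apply/seteqP; split => u /=; rewrite !in_itv/=; first by move=> [h1 /andP[-> _]].
  by case/andP: zL => _ zL /andP[h1 h2]; rewrite h1 h2 (le_trans h2 (ltW zL)).
rewrite derive_cst /F patchE mem_set//=.
by rewrite in_itv/= (ltW x0) (ltW xL).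
Qed.

End AnnihilatorVanishes.

(** The mean appears because it is the one Fourier coefficient that the system [tb] does not
    carry. *)
Lemma coef_inj f g : L2_per L f -> L2_per L g -> mean L f = mean L g ->
  (forall k, coef f k = coef g k) -> eq_ae f g.
Proof.
move=> [mf pf hf] [mg pg hg] m0 ck.
have sf : sqi L f by []. have sg : sqi L g by [].
apply: (ae_periodic L0 pf pg).
have sB := sqi_sub sf sg.
have : {ae mu, forall x, I x -> f x - g x = 0}.
  apply: (@annihilator_eq0 (fun x => f x - g x)) => //.
    by rewrite meanE pairingBl// -?meanE ?m0 ?subrr//; exact: sqi_cst.
  by move=> k; rewrite coefB// ck subrr.
by apply: ae_imp => x h Ix; apply/eqP; rewrite -subr_eq0 h.
Qed.

End CompletenessTheorem.

(** * Completeness of the space of square-integrable functions *)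

Section RieszFischer.
Context {R : realType}.
Notation mu := (@lebesgue_measure R).
Set Implicit Arguments.
Unset Strict Implicit.
Variable L : R.
Implicit Types (x : R) (N n : nat).
Notation coef := (coef L).
Notation tsum := (tsum L).
Notation I := [set` `[(0 : R), L]].

Let mI : measurable (I : set (measurableTypeR R)). Proof. exact: measurable_itv. Qed.

(** Fatou's lemma, arranged to give the integrability of the limit together with the bound on its
    integral. *)
Lemma Rfatou (u : nat -> R -> R) (v : R -> R) (C : R) :
  (forall n x, I x -> 0 <= u n x) -> measurable_fun I v -> (forall x, I x -> 0 <= v x) ->
  (forall n, integ L (u n)) ->
  {ae mu, forall x, I x -> u^~ x @ \oo --> v x} ->
  (forall n, \int[mu]_(x in I) u n x <= C) ->
  integ L v /\ \int[mu]_(x in I) v x <= C.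
Proof.
move=> u0 mv v0 iu uv uC.
have mu_ n : measurable_fun I (fun x => (u n x)%:E).
  by have /integrableP[] := iu n.
have h1 : (\int[mu]_(x in I) (v x)%:E <= C%:E)%E.
  have -> : (\int[mu]_(x in I) (v x)%:E = \int[mu]_(x in I) limn_einf (fun n => (u n x)%:E))%E.
    apply: ae_eq_integral => //; first by move/measurable_EFinP: mv.
    - have -> : (fun x => limn_einf (fun n => (u n x)%:E)) =
         (fun x => (- limn_esup (fun n => (- (u n x)%:E)%E))%E).
        by apply/funext => x; rewrite -[LHS]oppeK -limn_esupN.
      apply: measurableT_comp => //; apply: measurable_fun_limn_esup => n.
      by apply: (measurableT_comp _ (mu_ n)).
    - apply: ae_imp uv => x hx Ix.
      have cv : (fun n => (u n x)%:E) @ \oo --> (v x)%:E.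
        by apply: cvg_EFin; [exact: nearW|exact: hx].
      by have [-> _] := cvg_limn_einf_sup cv.
  apply: (le_trans (fatou mu mI mu_ _)).
    by move=> n x Ix; rewrite lee_fin; exact: u0.
  rewrite limn_einf_lim; apply: lime_le; first exact: is_cvg_einfs.
  apply: nearW => n; apply: (@le_trans _ _ (\int[mu]_(x in I) (u n x)%:E)%E).
    by apply: ereal_inf_lbound; exists n => /=.
  by rewrite (integE (iu n)) lee_fin.
have iv : integ L v.
  apply/integrableP; split; first by move/measurable_EFinP: mv.
  apply: (@le_lt_trans _ _ (\int[mu]_(x in I) (v x)%:E)%E); last exact: le_lt_trans h1 (ltry C).
  apply: eq_ler; apply: eq_integral => x /set_mem Ix /=.
  by rewrite ger0_norm// v0.
by split=> //; rewrite -lee_fin -integE.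
Qed.

(** By monotone convergence the sum of the [|d n|] has a finite integral, so it is finite almost
    everywhere, and absolute convergence follows. *)
Lemma ae_cvg_series (d : nat -> R -> R) (C : R) : (forall n, integ L (d n)) ->
  (forall n, \int[mu]_(x in I) `|d n x| <= C * (2^-1) ^+ n) ->
  {ae mu, forall x, I x -> cvgn (series (fun n => d n x))}.
Proof.
move=> id dC.
have idn n : integ L (fun x => `|d n x|) by exact: integrable_norm (id n).
have mD n : measurable_fun I (fun x => (`|d n x|)%:E).
  by have /integrableP[] := idn n.
have E := @integral_nneseries _ _ R mu I mI (fun n x => (`|d n x|)%:E) mD
  (fun n x _ => normr_ge0 (d n x)).
have C0 : 0 <= C.
  by have := dC 0%N; rewrite expr0 mulr1; apply: le_trans; exact: Rintegral_ge0.
have fin : (\int[mu]_(x in I) (\sum_(n <oo) (`|d n x|)%:E) < +oo)%E.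
  rewrite E; apply: (@le_lt_trans _ _ ((2 * C)%:E)); last exact: ltry.
  apply: lime_le.
    by apply: is_cvg_nneseries => n _ _; apply: integral_ge0.
  apply: nearW => n.
  rewrite (eq_bigr (fun k => (\int[mu]_(x in I) `|d k x|)%:E)); last first.
    by move=> k _; rewrite integE.
  rewrite sumEFin lee_fin.
  apply: (@le_trans _ _ (C * (2 - 2 * (2^-1) ^+ n))); last first.
    have : 0 <= (2^-1 : R) ^+ n by rewrite exprn_ge0// invr_ge0.
    by move: (_ ^+ n) => q q0; nra.
  elim: n => [|n IH]; first by rewrite big_geq// expr0 mulr1 subrr mulr0.
  rewrite big_nat_recr//=; apply: le_trans (lerD IH (dC n)) _.
  by rewrite exprS; apply: eq_ler; field.
have int : mu.-integrable I (fun x => (\sum_(n <oo) (`|d n x|)%:E)%E).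
  apply/integrableP; split.
    apply: ge0_emeasurable_sum => [n x Ix _|n _]; last exact: mD.
    by rewrite lee_fin.
  apply: le_lt_trans fin.
  apply: eq_ler; apply: eq_integral => x _.
  by rewrite gee0_abs//; apply: nneseries_ge0 => n _ _; rewrite lee_fin.
apply: ae_imp (integrable_ae mI int) => x hx Ix.
apply: normed_cvg; apply: nondecreasing_is_cvgn.
  by apply/nondecreasing_seqP => n; rewrite [leRHS](seriesSr (fun n => `|d n x|)) lerDl.
have /fineK e := hx Ix.
exists (fine (\sum_(n <oo) (`|d n x|)%:E)) => _ [n _ <-].
rewrite -lee_fin e /series/= -sumEFin; apply: nneseries_lim_ge => k _ _.
by rewrite lee_fin.
Qed.

End RieszFischer.

Section Parseval.
Context {R : realType}.
Notation mu := (@lebesgue_measure R).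
Set Implicit Arguments.
Unset Strict Implicit.
Variable L : R.
Hypothesis L0 : 0 < L.
Implicit Types (f g h : R -> R) (x : R) (N n : nat).
Notation coef := (coef L).
Notation tsum := (tsum L).
Notation I := [set` `[(0 : R), L]].

Lemma sqi_of_sub f g : measurable_fun setT f -> sqi L g ->
  integ L (fun x => (f x - g x) ^+ 2) -> sqi L f.
Proof.
move=> mf hg hfg; have h : sqi L (fun x => f x - g x).
  by split=> //; exact: measurable_funB mf hg.1.
have := sqi_add h hg.
by rewrite (_ : (fun x => f x - g x + g x) = f)//; apply/funext => x; rewrite subrK.
Qed.

(** The increments are summable in L^1, which gives a pointwise limit almost everywhere; Fatou's
    lemma then carries the L^2 rate over to the limit. *)
Lemma square_limit (g : nat -> R -> R) (C : R) : (forall n, sqi L (g n)) ->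
  (forall n, periodic (g n) L) ->
  (forall j m, \int[mu]_(x in I) (g (j + m)%N x - g j x) ^+ 2 <= C * (4^-1) ^+ j) ->
  exists f, L2_per L f /\ forall j, \int[mu]_(x in I) (f x - g j x) ^+ 2 <= C * (4^-1) ^+ j.
Proof.
move=> hg pg hC.
pose d n x := g n.+1 x - g n x.
have hd n : sqi L (d n) by exact: sqi_sub.
have C0 : 0 <= C.
  by have := hC 0%N 0%N; rewrite expr0 mulr1; apply: le_trans; apply: Rintegral_ge0 => x _; exact: sqr_ge0.
(* Young's inequality z <= (2^n z^2 + 2^-n) / 2 turns the rate 4^-n of the squares into a rate 2^-n
   in L^1. *)
have dC n : \int[mu]_(x in I) `|d n x| <= ((C + L) / 2) * (2^-1) ^+ n.
  have s1 : sqi L (fun=> (1 : R)) by exact: sqi_cst.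
  have q0 : 0 < (2 : R) ^+ n by rewrite exprn_gt0.
  have ib := integ_add (integ_scale ((2^-1) * 2 ^+ n) (hd n).2) (integ_cont L (@cst_continuous R R ((2^-1) * (2^-1) ^+ n))).
  apply: (@le_trans _ _ (\int[mu]_(x in I) ((2^-1) * 2 ^+ n * d n x ^+ 2 + (2^-1) * (2^-1) ^+ n))).
    apply: le_Rintegral => //; first exact: integrable_norm (sqi_integ (hd n)).
    move=> x _; rewrite exprVn -[X in _ * X + _]real_normK ?num_real//.
    move: `|d n x| (2 ^+ n) q0 => z q q0; rewrite -subr_ge0.
    have -> : 2^-1 * q * z ^+ 2 + 2^-1 * q^-1 - z = 2^-1 * q^-1 * (q * z - 1) ^+ 2.
      by field; rewrite gt_eqF.
    by rewrite mulr_ge0 ?sqr_ge0// mulr_ge0 ?invr_ge0 ?(ltW q0).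
  rewrite RintegralD//; last 2 first.
    exact: integ_scale (hd n).2.
    by apply: integ_cont; exact: cst_continuous.
  rewrite RintegralZl//; last exact: (hd n).2.
  rewrite Rintegral_cst//= lebesgue_measure_itv/= lte_fin L0 -EFinB/= subr0.
  have h1 := hC n 1%N; rewrite addn1 in h1.
  have h2 := ler_wpM2l (ltW q0) h1.
  have e4 : 2 ^+ n * (C * 4^-1 ^+ n) = C * 2^-1 ^+ n :> R.
    rewrite mulrCA -exprMn; congr (_ * _ ^+ _); by field.
  rewrite e4 in h2; rewrite /d.
  by move: h2; move: (\int[mu]_(_ in _) _) => z; move: (2 ^+ n) (2^-1 ^+ n) => a b; lra.
have cv := ae_cvg_series (fun n => sqi_integ (hd n)) dC.
(* A superior limit is defined and measurable everywhere and inherits the periodicity of the [g n];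
   it agrees with the limit wherever the sequence converges. *)
pose f x := fine (limn_esup (fun n => (g n x)%:E)).
have mf : measurable_fun setT f.
  apply: measurableT_comp => //; apply: measurable_fun_limn_esup => n.
  by apply/measurable_EFinP; exact: (hg n).1.
have gf : {ae mu, forall x, I x -> g^~ x @ \oo --> f x}.
  apply: ae_imp cv => x hx Ix; have {}hx := hx Ix.
  have : cvgn (g^~ x).
    have E : g^~ x = (fun n => series (fun n => d n x) n + g 0%N x).
      apply/funext => n; have := telescopeK (g^~ x) => /(congr1 (fun F => F n)).
      by rewrite /telescope /series /d /= => ->; rewrite subrK.
    by rewrite E; apply: is_cvgD => //; exact: is_cvg_cst.
  move=> cg; have cE : (fun n => (g n x)%:E) @ \oo --> (limn (g^~ x))%:E.
    by apply: cvg_EFin; [exact: nearW|exact: cg].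
  by have [_ e] := cvg_limn_einf_sup cE; rewrite /f e.
have key j : integ L (fun x => (f x - g j x) ^+ 2) /\
    \int[mu]_(x in I) (f x - g j x) ^+ 2 <= C * (4^-1) ^+ j.
  apply: (Rfatou (u := fun m x => (g (j + m)%N x - g j x) ^+ 2)) => //.
  - by move=> n x _; exact: sqr_ge0.
  - by apply: measurable_funTS; apply: measurable_funX; apply: measurable_funB mf (hg j).1.
  - by move=> x _; exact: sqr_ge0.
  - by move=> n; exact: (sqi_sub (hg _) (hg _)).2.
  apply: ae_imp gf => x hx Ix; have {}hx := hx Ix.
  under eq_fun do rewrite expr2; rewrite expr2.
  have hs : (fun m => g (j + m)%N x) @ \oo --> f x.
    under eq_fun do rewrite addnC.
    suff : [sequence g (n + j)%N x]_n @ \oo --> f x by [].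
    by rewrite (cvg_shiftn j (g^~ x)).
  by apply: cvgM; apply: cvgB => //; exact: cvg_cst.
exists f; split=> [|j]; last exact: (key j).2.
have sf := sqi_of_sub mf (hg 0%N) (key 0%N).1.
split; [exact: mf| |exact: sf.2].
by move=> x; rewrite /f; under eq_fun do rewrite pg.
Qed.

Lemma tsum_periodic c m N : periodic (tsum c m N) L.
Proof. by move=> x; apply: eq_bigr => k _; rewrite tb_periodic. Qed.

Lemma tsum_sub c m N x : (m <= N)%N -> tsum c 0 N x - tsum c 0 m x = tsum c m N x.
Proof. by move=> mN; rewrite /tsum (big_cat_nat (n := m))//= [X in X - _]addrC addrK. Qed.

Lemma pairing_sqr f : pairing L f f = \int[mu]_(x in I) f x ^+ 2.
Proof. by apply: eq_Rintegral => x _; rewrite expr2. Qed.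

(** Along suitable indices the partial sums converge at the rate 4^-j that [square_limit] asks for.
    The last clause bounds the norm by the coefficients; completeness will turn it into Parseval's
    identity. *)
Lemma riesz_fischer (c : nat -> R) (S : R) : (forall N, \sum_(0 <= k < N) c k ^+ 2 <= S) ->
  exists f, [/\ L2_per L f, mean L f = 0, forall k, coef f k = c k &
   forall e, 0 < e -> exists N, pairing L f f <= \sum_(0 <= k < N) c k ^+ 2 + e].
Proof.
move=> hS.
have /choice [m hm] : forall j : nat, exists m, forall N, \sum_(m <= k < N) c k ^+ 2 <= (4^-1) ^+ j.
  move=> j; apply: (@tail_small _ (fun k => c k ^+ 2) S) => [k|N|].
  - exact: sqr_ge0.
  - exact: hS.
  - by rewrite exprn_gt0// invr_gt0.
(* These indices dominate every [m j], increase with [j], and satisfy [j <= n j], so that each mode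
   is eventually included. *)
pose n j := (j + \sum_(0 <= i < j.+1) m i)%N.
have nj j : (j <= n j)%N by exact: leq_addr.
have nm j : (m j <= n j)%N by rewrite /n big_nat_recr//= addnA leq_addl.
have nd i j : (i <= j)%N -> (n i <= n j)%N.
  move=> ij; apply: leq_add => //.
  by rewrite [leqRHS](big_cat_nat (n := i.+1))//= leq_addr.
pose g j := tsum c 0 (n j).
have tail j N : (n j <= N)%N -> \sum_(n j <= k < N) c k ^+ 2 <= (4^-1) ^+ j.
  move=> nN; apply: le_trans (hm j N).
  rewrite [leRHS](big_cat_nat (n := n j))//= lerDr sumr_ge0// => k _; exact: sqr_ge0.
have [||| f [hf hfg]] := @square_limit g 1.
- by move=> j; exact: sqi_tsum.
- by move=> j; exact: tsum_periodic.
- move=> i j; rewrite mul1r.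
  have ij : (n i <= n (i + j))%N by apply: nd; exact: leq_addr.
  apply: le_trans (tail i (n (i + j)%N) ij).
  under eq_Rintegral do rewrite (tsum_sub _ _ ij).
  by rewrite -pairing_sqr pairing_tsum.
have sf : sqi L f by case: hf.
have sg j : sqi L (g j) by exact: sqi_tsum.
have sd j : sqi L (fun x => f x - g j x) by exact: sqi_sub.
have s1 : sqi L (fun=> (1 : R)) by exact: sqi_cst.
have hd j : pairing L (fun x => f x - g j x) (fun x => f x - g j x) <= (4^-1) ^+ j.
  by rewrite pairing_sqr; apply: le_trans (hfg j) _; rewrite mul1r.
have m0 : mean L f = 0.
  apply/eqP; rewrite -sqrf_eq0 eq_le sqr_ge0 andbT.
  apply: (@le0_geometric _ _ (pairing L (fun=> 1) (fun=> 1))) => j.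
  have -> : mean L f = pairing L (fun x => f x - g j x) (fun=> 1).
    by rewrite pairingBl// -!meanE /g mean_tsum// subr0.
  apply: le_trans (cauchy_schwarz (sd j) s1) _.
  by rewrite mulrC ler_wpM2l ?pairing_ge0.
have ck k : coef f k = c k.
  apply/eqP; rewrite -subr_eq0 -sqrf_eq0 eq_le sqr_ge0 andbT.
  apply: (@le0_geometric _ _ 1) => j; pose i := (j + k.+1)%N.
  have -> : c k = coef (g i) k.
    rewrite coef_tsum//= ifT// (leq_trans _ (nj i))// /i.
    by rewrite addnS ltnS leq_addl.
  rewrite -coefB//; apply: (@le_trans _ _ (\sum_(k <= l < k.+1) coef (fun x => f x - g i x) l ^+ 2)).
    by rewrite big_nat1.
  apply: le_trans (bessel L0 _ _ (sd i)) _; apply: le_trans (hd i) _.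
  rewrite mul1r /i exprD ler_piMr ?exprn_ge0 ?invr_ge0//.
  by rewrite exprn_ile1 ?invr_ge0// invf_le1//; lra.
exists f; split=> // e e0.
have [j hj] : exists j, (4^-1 : R) ^+ j <= e.
  apply/not_existsP => hn; have : e <= 0; last by rewrite leNgt e0.
  apply: (@le0_geometric _ _ 1) => j; rewrite mul1r ltW// ltNge; exact/negP/hn.
exists (n j).
have := pairing_sub_tsum L0 0 (n j) sf.
have E : tsum (coef f) 0 (n j) = g j by apply/funext => x; apply: eq_bigr => k _; rewrite ck.
rewrite E (eq_bigr (fun k => c k ^+ 2)); last by move=> k _; rewrite ck.
by move=> H; have := le_trans (hd j) hj; rewrite H; lra.
Qed.

(** The Riesz-Fischer function with the same coefficients satisfies the estimate, and by
    completeness it equals [f] almost everywhere. *)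
Lemma parseval f : sqi L f -> mean L f = 0 -> forall e, 0 < e ->
  exists N0, forall N, (N0 <= N)%N -> pairing L f f <= \sum_(0 <= k < N) coef f k ^+ 2 + e.
Proof.
move=> hf mf e e0.
have [g [gL mg cg hg]] := riesz_fischer (fun N => bessel L0 0 N hf).
have [N0 hN] := hg e e0; exists N0 => N NN.
have sg : sqi L g by case: gL.
have s1 : sqi L (fun=> (1 : R)) by exact: sqi_cst.
have sd := sqi_sub hf sg.
have ae : {ae mu, forall x, I x -> f x = g x}.
  have : {ae mu, forall x, I x -> f x - g x = 0}.
    apply: (@annihilator_eq0 _ _ L0 (fun x => f x - g x)) => //.
      by rewrite meanE pairingBl// -!meanE mf mg subrr.
    by move=> k; rewrite coefB// cg subrr.
  by apply: ae_imp => x h Ix; apply/eqP; rewrite -subr_eq0 h.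
rewrite (pairing_ae ae hf sg hf) pairingC (pairing_ae ae hf sg sg).
apply: (le_trans hN); rewrite lerD2r; apply: le_sum_widen => // k; exact: sqr_ge0.
Qed.

Lemma pairing_sub_sum f g N : sqi L f -> sqi L g ->
  (pairing L f g - \sum_(0 <= k < N) coef f k * coef g k) ^+ 2 <=
  (pairing L f f - \sum_(0 <= k < N) coef f k ^+ 2) * pairing L g g.
Proof.
move=> hf hg; rewrite -pairing_sub_tsum//.
have st := sqi_tsum L (coef f) 0 N.
apply: le_trans (cauchy_schwarz (sqi_sub hf st) hg).
by rewrite pairingBl// pairing_tsuml.
Qed.

Lemma parseval_cvg f g : sqi L f -> mean L f = 0 -> sqi L g ->
  (fun N => \sum_(0 <= k < N) coef f k * coef g k) @ \oo --> pairing L f g.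
Proof.
move=> hf mf hg; apply/cvgrPdist_le => e e0.
have g1 : 0 < pairing L g g + 1 by rewrite ltr_wpDl// pairing_ge0.
have d0 : 0 < e ^+ 2 / (pairing L g g + 1) by rewrite divr_gt0// exprn_gt0.
have [N0 hN0] := parseval hf mf d0.
exists N0 => // N /= NN; have {}hN0 := hN0 N NN.
rewrite -(@ler_pXn2r _ 2)//; [|by rewrite nnegrE..|by rewrite nnegrE ltW].
rewrite real_normK ?num_real//; apply: le_trans (pairing_sub_sum N hf hg) _.
apply: (@le_trans _ _ (e ^+ 2 / (pairing L g g + 1) * pairing L g g)).
  by rewrite ler_wpM2r ?pairing_ge0//; lra.
rewrite mulrAC ler_pdivrMr// ler_wpM2l ?sqr_ge0//; lra.
Qed.

Lemma pairing_le_sum f S : sqi L f -> mean L f = 0 ->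
  (forall N, \sum_(0 <= k < N) coef f k ^+ 2 <= S) -> pairing L f f <= S.
Proof.
move=> hf mf hS; apply/ler_addgt0Pr => e e0.
have [N0 /(_ N0 (leqnn _)) h] := parseval hf mf e0.
by apply: (le_trans h); rewrite lerD2r.
Qed.

End Parseval.

(** * Sobolev norms and Fourier coefficients *)

Section SobolevCoefficients.
Context {R : realType}.
Notation mu := (@lebesgue_measure R).
Set Implicit Arguments.
Unset Strict Implicit.
Variable L : R.
Hypothesis L0 : 0 < L.
Implicit Types (f h : R -> R) (x : R) (N n : nat).
Notation coef := (coef L).
Notation I := [set` `[(0 : R), L]].

(** The weight involves the integer index of the frequency, not the frequency itself; comparing it
    with [lam] therefore costs factors of 2 pi / L. *)
Definition hweight (s : R) (k : nat) : R := (1 + (k./2.+1)%:R ^+ 2) `^ s.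

Lemma hweight_ge0 s k : 0 <= hweight s k.
Proof. exact: powR_ge0. Qed.

Lemma hweight0 k : hweight 0 k = 1.
Proof. by rewrite /hweight powRr0. Qed.

Lemma hweight1 k : hweight 1 k = 1 + (k./2.+1)%:R ^+ 2.
Proof. by rewrite /hweight powRr1// addr_ge0// sqr_ge0. Qed.

(** The complex coefficients of indices m + 1 and -(m + 1), the latter being [Negz m], are conjugate
    and built from the same cosine and sine integrals. *)
Lemma fourier_coef_sqr f (m : nat) : sqi L f ->
  L * (Normc.normc (fourier_coef L f (Posz m.+1)) ^+ 2 +
       Normc.normc (fourier_coef L f (Negz m)) ^+ 2) =
  coef f m.*2 ^+ 2 + coef f m.*2.+1 ^+ 2.
Proof.
move=> hf.
pose C := \int[mu]_(x in I) (f x * cos (freq L m.*2 * x)).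
pose D := \int[mu]_(x in I) (f x * sin (freq L m.*2 * x)).
have fr : freq L m.*2 = 2 * pi / L * m.+1%:R by rewrite /freq half_double.
have fr1 : freq L m.*2.+1 = freq L m.*2 by rewrite /freq /= uphalf_double half_double.
have arg x : 2 * pi * (Posz m.+1)%:~R * x / L = freq L m.*2 * x.
  by rewrite fr -pmulrn; move: (m.+1%:R) => r; ring.
have argN x : 2 * pi * (Negz m)%:~R * x / L = - (freq L m.*2 * x).
  by rewrite fr NegzE mulrNz -pmulrn; move: (m.+1%:R) => r; ring.
have nn (a b : R) : Normc.normc (Complex a b) ^+ 2 = a ^+ 2 + b ^+ 2.
  by rewrite /Normc.normc sqr_sqrtr// addr_ge0 ?sqr_ge0.
have cs : sqi L (fun x => sin (freq L m.*2 * x)) by apply: sqi_cont; exact: continuous_sinZ.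
have cc : sqi L (fun x => cos (freq L m.*2 * x)) by apply: sqi_cont; exact: continuous_cosZ.
have -> : fourier_coef L f (Posz m.+1) = Complex (L^-1 * C) (- (L^-1 * D)).
  rewrite /fourier_coef /C /D; congr Complex.
    by under eq_Rintegral do rewrite arg.
  by under eq_Rintegral do rewrite arg.
have -> : fourier_coef L f (Negz m) = Complex (L^-1 * C) (L^-1 * D).
  rewrite /fourier_coef /C /D; congr Complex.
    by under eq_Rintegral do rewrite argN cosN.
  under eq_Rintegral do rewrite argN sinN mulrN -mulN1r.
  by rewrite RintegralZl//; [rewrite mulN1r mulrN opprK|exact: sqi_mul].
have c0 : 0 <= 2 / L by rewrite divr_ge0// ltW.
have E1 : coef f m.*2 = Num.sqrt (2 / L) * C.
  rewrite /coef /pairing /tb odd_double.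
  under eq_Rintegral do rewrite mulrCA.
  by rewrite RintegralZl//; exact: sqi_mul.
have E2 : coef f m.*2.+1 = Num.sqrt (2 / L) * D.
  rewrite /coef /pairing /tb /= odd_double/= fr1.
  under eq_Rintegral do rewrite mulrCA.
  by rewrite RintegralZl//; exact: sqi_mul.
rewrite !nn E1 E2 !exprMn sqr_sqrtr//; clear E1 E2; clearbody C D.
by field; rewrite gt_eqF.
Qed.

Lemma fourier_coef0 f : mean L f = 0 -> Normc.normc (fourier_coef L f (Posz 0)) = 0.
Proof.
move=> mf; rewrite /fourier_coef.
under eq_Rintegral do rewrite mulr0 !mul0r cos0 mulr1.
under [X in Complex _ (- (_ * X))]eq_Rintegral do rewrite mulr0 !mul0r sin0 mulr0.
rewrite [X in _ * X]mf Rintegral_cst// mul0r mulr0 oppr0.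
by rewrite /Normc.normc expr0n/= addr0 sqrtr0.
Qed.

(** The sum over the integers splits into nonnegative and negative indices, which pair up into
    cosine and sine modes, while index 0 contributes nothing for a mean-zero function. The two
    inequalities together identify the squared norm with the supremum of the weighted partial
    sums. *)
Lemma Hs_sqnormE s f : sqi L f -> mean L f = 0 ->
  (forall N, ((\sum_(0 <= k < N) hweight s k * coef f k ^+ 2)%:E <= Hs_sqnorm L s f)%E) /\
  (forall S, (forall N, \sum_(0 <= k < N) hweight s k * coef f k ^+ 2 <= S) ->
    (Hs_sqnorm L s f <= S%:E)%E).
Proof.
move=> hf mf.
pose a (n : int) : R := ((1 + n%:~R ^+ 2) `^ s) * Normc.normc (fourier_coef L f n) ^+ 2.
have a0 (n : int) : 0 <= a n by rewrite mulr_ge0 ?powR_ge0 ?sqr_ge0.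
pose u k := hweight s k * coef f k ^+ 2.
have u0 k : 0 <= u k by rewrite mulr_ge0 ?hweight_ge0 ?sqr_ge0.
have ua m : u m.*2 + u m.*2.+1 = L * (a (Posz m.+1) + a (Negz m)).
  pose w : R := (1 + m.+1%:R ^+ 2) `^ s.
  have -> : u m.*2 = w * coef f m.*2 ^+ 2 by rewrite /u /hweight half_double.
  have -> : u m.*2.+1 = w * coef f m.*2.+1 ^+ 2 by rewrite /u /hweight /= uphalf_double.
  have -> : a (Posz m.+1) = w * Normc.normc (fourier_coef L f (Posz m.+1)) ^+ 2.
    by rewrite /a -pmulrn.
  have -> : a (Negz m) = w * Normc.normc (fourier_coef L f (Negz m)) ^+ 2.
    by rewrite /a [in LHS]NegzE mulrNz sqrrN -pmulrn.
  by rewrite -mulrDr -(fourier_coef_sqr m hf) -mulrDr mulrCA.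
have a00 : a (Posz 0) = 0 by rewrite /a fourier_coef0// expr0n/= mulr0.
have su M : \sum_(0 <= k < M.*2) u k = L * (\sum_(0 <= m < M.+1) a (Posz m) + \sum_(0 <= m < M) a (Negz m)).
  elim: M => [|M IH].
    by rewrite big_nat1 a00 [X in _ = L * (_ + X)]big_geq// big_geq// addr0 mulr0.
  rewrite doubleS (big_nat_recr M.*2.+1)//= (big_nat_recr M.*2)//= IH -addrA ua.
  rewrite [X in _ = L * (X + _)]big_nat_recr//= [X in _ = L * (_ + X)]big_nat_recr//=.
  by move: (\sum_(_ <= _ < M.+1) _) (\sum_(_ <= _ < M) _) => X Y; ring.
pose X := (\sum_(m <oo) (a (Posz m))%:E)%E.
pose Y := (\sum_(m <oo) (a (Negz m))%:E)%E.
have E : Hs_sqnorm L s f = (L%:E * (X + Y))%E.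
  have -> : Hs_sqnorm L s f = (L%:E * \esum_(n in [set: int]) (a n)%:E)%E by [].
  congr (_ * _)%E.
  rewrite (esumID (range Posz)); last by move=> i _; rewrite lee_fin; exact: a0.
  rewrite setTI (_ : [set: int] `&` ~` range Posz = range Negz); last first.
    rewrite setTI; apply/seteqP; split => [[n|n]/= h|_ [n _ <-] [m _]//]; last by exists n.
    by exfalso; apply: h; exists n.
  rewrite !esum_image; [|by move=> ? ? _ _ []..].
  by rewrite -!nneseries_esumT// => n; rewrite lee_fin; exact: a0.
have X0 : (0 <= X)%E by apply: nneseries_ge0 => n _ _; rewrite lee_fin.
have Y0 : (0 <= Y)%E by apply: nneseries_ge0 => n _ _; rewrite lee_fin.
split=> [N|S hS].
  apply: (@le_trans _ _ (\sum_(0 <= k < N.*2) u k)%:E).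
    by rewrite lee_fin; apply: le_sum_widen => //; rewrite -addnn leq_addl.
  rewrite E su EFinM lee_pmul2l ?lte_fin// EFinD; apply: leeD.
    by rewrite -sumEFin; apply: nneseries_lim_ge => k _ _; rewrite lee_fin.
  by rewrite -sumEFin; apply: nneseries_lim_ge => k _ _; rewrite lee_fin.
have XY : (X + Y <= (L^-1 * S)%:E)%E.
  rewrite /X /Y -nneseriesD//; [|by move=> i _ _; rewrite lee_fin..].
  apply: lime_le.
    by apply: is_cvg_nneseries => n _ _; rewrite -EFinD lee_fin addr_ge0.
  apply: nearW => n; under eq_bigr do rewrite -EFinD.
  rewrite sumEFin lee_fin ler_pdivlMl//; apply: le_trans (hS n.*2).
  rewrite su ler_pM2l// big_split lerD2r/= big_nat_recr//= lerDl; exact: a0.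
rewrite E; apply: (@le_trans _ _ (L%:E * (L^-1 * S)%:E)%E).
  by rewrite lee_pmul2l ?lte_fin.
by rewrite -EFinM mulrA divff ?mul1r// gt_eqF.
Qed.

Lemma Hs_per_mE s f : Hs_per_m L s f <->
  [/\ L2_per L f, mean L f = 0 &
   exists S, forall N, \sum_(0 <= k < N) hweight s k * coef f k ^+ 2 <= S].
Proof.
split=> [[[h1 h2] h3]|[h1 h2 [S hS]]].
  have sf : sqi L f by case: h1.
  split=> //; have [hA _] := Hs_sqnormE s sf h3.
  have f0 : (0 <= Hs_sqnorm L s f)%E by have := hA 0%N; rewrite big_geq.
  exists (fine (Hs_sqnorm L s f)) => N; rewrite -lee_fin fineK ?ge0_fin_numE//.
have sf : sqi L f by case: h1.
have [_ hB] := Hs_sqnormE s sf h2.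
by split=> //; split=> //; apply: le_lt_trans (hB S hS) (ltry _).
Qed.

Lemma Hs_norm_ge s f N : Hs_per_m L s f ->
  \sum_(0 <= k < N) hweight s k * coef f k ^+ 2 <= Hs_norm L s f ^+ 2.
Proof.
move=> [[h1 h2] h3].
have sf : sqi L f by case: h1.
have [hA _] := Hs_sqnormE s sf h3.
have f0 : (0 <= Hs_sqnorm L s f)%E by have := hA 0%N; rewrite big_geq.
by rewrite /Hs_norm sqr_sqrtr ?fine_ge0// -lee_fin fineK ?ge0_fin_numE.
Qed.

Lemma Hs_norm_le s f S : sqi L f -> mean L f = 0 ->
  (forall N, \sum_(0 <= k < N) hweight s k * coef f k ^+ 2 <= S) -> Hs_norm L s f ^+ 2 <= S.
Proof.
move=> sf mf hS; have [hA /(_ S hS) hB] := Hs_sqnormE s sf mf.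
have f0 : (0 <= Hs_sqnorm L s f)%E by have := hA 0%N; rewrite big_geq.
rewrite /Hs_norm sqr_sqrtr ?fine_ge0// -lee_fin fineK// ge0_fin_numE//.
exact: le_lt_trans hB (ltry _).
Qed.

End SobolevCoefficients.

(** * Uniformly convergent series of finite energy *)

Section Synthesis.
Context {R : realType}.
Notation mu := (@lebesgue_measure R).
Set Implicit Arguments.
Unset Strict Implicit.
Variable L : R.
Hypothesis L0 : 0 < L.
Implicit Types (f h : R -> R) (x : R) (N n k : nat) (c : nat -> R).
Notation coef := (coef L).
Notation tsum := (tsum L).
Notation I := [set` `[(0 : R), L]].

Definition lam k : R := freq L k ^+ 2.
(* [sum_k (lam k)^-1 <= sig], and hence [Phi c x ^+ 2 <= kap * sum_k lam k * c k ^+ 2]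
   by Cauchy-Schwarz. *)
Definition sig : R := 8 / (2 * pi / L) ^+ 2.
Definition kap : R := 2 / L * sig.

Let w : R := 2 * pi / L.
Let w0 : 0 < w. Proof. by rewrite divr_gt0// mulr_gt0// pi_gt0. Qed.

Lemma lamE k : lam k = freq L k ^+ 2. Proof. by []. Qed.

Lemma lam_gt0 k : 0 < lam k.
Proof. by rewrite exprn_gt0// freq_gt0. Qed.

Lemma lam_ge0 k : 0 <= lam k. Proof. exact/ltW/lam_gt0. Qed.

Lemma lam_ge k : w ^+ 2 <= lam k.
Proof.
rewrite /lam /freq -/w [leRHS]exprMn ler_peMr ?sqr_ge0// -[leLHS](expr1n _ 2).
by rewrite ler_pXn2r ?nnegrE// ler1n.
Qed.

Lemma sig_gt0 : 0 < sig. Proof. by rewrite divr_gt0// exprn_gt0. Qed.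

Lemma kap_gt0 : 0 < kap. Proof. by rewrite mulr_gt0 ?sig_gt0// divr_gt0. Qed.

Lemma cauchy_sum (s : seq nat) (y z : nat -> R) :
  (\sum_(k <- s) y k * z k) ^+ 2 <= (\sum_(k <- s) y k ^+ 2) * (\sum_(k <- s) z k ^+ 2).
Proof.
elim: s => [|k s IH]; first by rewrite !big_nil mul0r expr0n.
rewrite !big_cons; move: IH.
have A0 : 0 <= \sum_(j <- s) y j ^+ 2 by apply: sumr_ge0 => j _; exact: sqr_ge0.
have B0 : 0 <= \sum_(j <- s) z j ^+ 2 by apply: sumr_ge0 => j _; exact: sqr_ge0.
move: A0 B0; set A := \sum_(j <- s) y j ^+ 2; set B := \sum_(j <- s) z j ^+ 2.
move: (\sum_(j <- s) y j * z j) A B (y k) (z k) => P A B a b A0 B0 h.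
suff : 2 * (P * (a * b)) <= A * b ^+ 2 + B * a ^+ 2 by move: h; rewrite !expr2; lra.
have Q0 : 0 <= A * b ^+ 2 + B * a ^+ 2 by rewrite addr_ge0// mulr_ge0// sqr_ge0.
apply: (le_trans (ler_norm _)); rewrite -(@ler_pXn2r _ 2)// ?nnegrE//.
rewrite real_normK ?num_real//.
apply: (@le_trans _ _ (4 * (A * B) * (a * b) ^+ 2)).
  have -> : (2 * (P * (a * b))) ^+ 2 = 4 * P ^+ 2 * (a * b) ^+ 2 by ring.
  by rewrite ler_wpM2r ?sqr_ge0// ler_pM2l.
rewrite -subr_ge0 (_ : _ - _ = (A * b ^+ 2 - B * a ^+ 2) ^+ 2) ?sqr_ge0//; ring.
Qed.

(** The terms are dominated by the telescoping differences sig (1 / (k + 1) - 1 / (k + 2)). The 8 in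
    [sig] makes room for the pairing of indices: k + 1 <= 2 p with p = [k./2.+1] gives (k + 1) (k +
    2) <= 8 p^2. *)
Lemma sum_inv_lam m N : \sum_(m <= k < N) (lam k)^-1 <= sig / m.+1%:R.
Proof.
have key k : (lam k)^-1 <= sig * (k.+1%:R^-1 - k.+2%:R^-1).
  rewrite /lam /freq -/w /sig -/w [X in X^-1]exprMn invfM [8 / _]mulrC -mulrA.
  apply: ler_wpM2l; first by rewrite invr_ge0 sqr_ge0.
  have k2 : (k.+1%:R : R) <= 2 * (k./2.+1)%:R.
    rewrite -natrM ler_nat -ltnS mul2n doubleS.
    by rewrite -{1}(odd_double_half k); case: odd.
  have k0 : 0 < (k./2.+1)%:R :> R by rewrite ltr0n.
  have -> : k.+2%:R = k.+1%:R + 1 :> R by rewrite -addn1 natrD.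
  have k1 : 1 <= k.+1%:R :> R by rewrite ler1n.
  move: (k./2.+1)%:R (k.+1%:R) k2 k0 k1 => n p pn n0 p1.
  have -> : 8 * (p^-1 - (p + 1)^-1) = 8 / (p * (p + 1)).
    by field; apply/andP; split; rewrite gt_eqF//; lra.
  rewrite -[leLHS]mul1r ler_pdivrMr ?exprn_gt0// mulrAC ler_pdivlMr; last by nra.
  by nra.
have [Nm|mN] := leqP N m; first by rewrite big_geq// divr_ge0// ltW// sig_gt0.
apply: (@le_trans _ _ (sig * (m.+1%:R^-1 - N.+1%:R^-1))); last first.
  by rewrite ler_pM2l ?sig_gt0// lerBlDr lerDl invr_ge0.
have {mN} mN := ltnW mN.
elim: N mN => [|N IH] mN.
  by move: mN; rewrite leqn0 => /eqP->; rewrite big_geq// subrr mulr0.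
move: mN; rewrite leq_eqVlt => /orP[/eqP->|mN]; first by rewrite big_geq// subrr mulr0.
rewrite big_nat_recr//=; apply: le_trans (lerD (IH mN) (key N)) _.
by apply: eq_ler; ring.
Qed.

(** The Sobolev embedding of H^1 in the bounded functions, with a rate for tails: Cauchy-Schwarz
    after splitting each term as a factor 1 / freq times a factor freq. *)
Lemma tsum_bound c m N S x : (forall M, \sum_(0 <= k < M) lam k * c k ^+ 2 <= S) ->
  tsum c m N x ^+ 2 <= kap * S / m.+1%:R.
Proof.
move=> hS.
have E : tsum c m N x = \sum_(m <= k < N) (freq L k)^-1 * (freq L k * c k * tb L k x).
  by apply: eq_bigr => k _; rewrite -[X in _ = _ * X]mulrA mulKf// gt_eqF// freq_gt0.
rewrite E; apply: (le_trans (cauchy_sum _ _ _)).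
have h1 : \sum_(m <= k < N) (freq L k)^-1 ^+ 2 <= sig / m.+1%:R.
  by apply: le_trans (sum_inv_lam m N); apply: ler_sum => k _; rewrite exprVn.
have h2 : \sum_(m <= k < N) (freq L k * c k * tb L k x) ^+ 2 <= 2 / L * S.
  apply: (@le_trans _ _ (2 / L * \sum_(m <= k < N) lam k * c k ^+ 2)).
    rewrite mulr_sumr; apply: ler_sum => k _.
    have -> : (freq L k * c k * tb L k x) ^+ 2 = tb L k x ^+ 2 * (lam k * c k ^+ 2).
      by rewrite /lam; move: (freq L k) (tb L k x) => p q; ring.
    by rewrite ler_wpM2r ?tb_sqr_bound// mulr_ge0 ?lam_ge0 ?sqr_ge0.
  rewrite ler_pM2l ?divr_gt0//; apply: le_trans (hS N).
  by apply: (le_tail_sum (u := fun k => lam k * c k ^+ 2)) => k; rewrite mulr_ge0 ?lam_ge0 ?sqr_ge0.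
apply: (@le_trans _ _ (sig / m.+1%:R * (2 / L * S))).
  apply: ler_pM => //; apply: sumr_ge0 => k _; exact: sqr_ge0.
by rewrite /kap; apply: eq_ler; move: (m.+1%:R^-1) (L^-1) => p q; ring.
Qed.

Lemma cvg_inv_nat (C : R) : (fun n => C / n.+1%:R) @ \oo --> (0 : R).
Proof.
rewrite -(mulr0 C); apply: cvgM; first exact: cvg_cst.
exact: cvg_harmonic.
Qed.

Lemma inv_nat_small (C e : R) : 0 < e -> exists N0, forall N, (N0 <= N)%N -> C / N.+1%:R <= e.
Proof.
move=> e0; have [N0 _ h] := (@cvgrPdist_le _ _ _ _ _ _ _).1 (cvg_inv_nat C) _ e0.
exists N0 => N NN; have := h N NN; rewrite sub0r normrN; exact: le_trans (ler_norm _).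
Qed.

Lemma le0_inv_nat (x C : R) : (forall n, x <= C / n.+1%:R) -> x <= 0.
Proof.
move=> h; apply/ler_addgt0Pr => e e0; rewrite add0r.
by have [N /(_ N (leqnn _)) hN] := inv_nat_small C e0; apply: le_trans hN.
Qed.

(** A canonical representative, defined at every point as the sum of the series; the limit is
    meaningful for coefficients of finite energy. *)
Definition Phi c x : R := limn (fun N => tsum c 0 N x).

Notation energy_le c S := (forall M, \sum_(0 <= k < M) lam k * c k ^+ 2 <= S).

Lemma Phi_cvg c S x : energy_le c S -> (fun N => tsum c 0 N x) @ \oo --> Phi c x.
Proof.
move=> hS; suff : cvgn (fun N => tsum c 0 N x) by [].
apply: cauchy_cvg; apply: cauchy_exP => e e0.
have e2 : 0 < e ^+ 2 / 2 by rewrite divr_gt0 ?exprn_gt0.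
have [N0 hN] := inv_nat_small (kap * S) e2.
exists (tsum c 0 N0 x), N0 => // n /= Nn.
rewrite -ball_normE/= distrC tsum_sub//.
rewrite -(@ltr_pXn2r _ 2)//; [|by rewrite nnegrE..|by rewrite nnegrE ltW].
rewrite real_normK ?num_real//; apply: le_lt_trans (tsum_bound N0 n x hS) _.
apply: le_lt_trans (hN N0 (leqnn _)) _.
by have := exprn_gt0 2 e0; lra.
Qed.

Lemma cvg_sqr_le (u : nat -> R) (l C : R) : u @ \oo --> l ->
  (\forall n \near \oo, u n ^+ 2 <= C) -> l ^+ 2 <= C.
Proof.
move=> ul uC; have u2 : (fun n => u n ^+ 2) @ \oo --> l ^+ 2.
  by under eq_fun do rewrite expr2; rewrite expr2; exact: cvgM.
by apply: (@ler_cvg_to _ _ _ _ _ (cst C) _ _ u2) => //; exact: cvg_cst.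
Qed.

Lemma Phi_sub_tsum c S N x : energy_le c S -> (Phi c x - tsum c 0 N x) ^+ 2 <= kap * S / N.+1%:R.
Proof.
move=> hS; apply: (@cvg_sqr_le (fun M => tsum c 0 M x - tsum c 0 N x)).
  by apply: cvgB; [exact: (Phi_cvg hS)|exact: cvg_cst].
by exists N => // M /= NM; rewrite tsum_sub//; exact: tsum_bound.
Qed.

Lemma Phi_bound c S x : energy_le c S -> Phi c x ^+ 2 <= kap * S.
Proof.
move=> hS; have := Phi_sub_tsum 0 x hS.
by rewrite /tsum big_geq// subr0 divr1.
Qed.

Lemma Phi_sub_bound c c' S x : finite_energy lam c -> finite_energy lam c' ->
  energy_le (fun k => c k - c' k) S -> (Phi c x - Phi c' x) ^+ 2 <= kap * S.
Proof.
move=> [S1 h1] [S2 h2] hS.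
apply: (@cvg_sqr_le (fun N => tsum c 0 N x - tsum c' 0 N x)).
  by apply: cvgB; [exact: (Phi_cvg h1)|exact: (Phi_cvg h2)].
apply: nearW => N; have := tsum_bound 0 N x hS; rewrite divr1.
rewrite (_ : tsum (fun k => c k - c' k) 0 N x = tsum c 0 N x - tsum c' 0 N x)//.
by rewrite /tsum -sumrB; apply: eq_bigr => k _; rewrite mulrBl.
Qed.

Lemma Phi_meas c : finite_energy lam c -> measurable_fun setT (Phi c).
Proof.
move=> [S hS]; apply: (@measurable_fun_cvg _ _ _ setT (fun N => tsum c 0 N)).
- by move=> N; apply: measurable_continuous; exact: tsum_continuous.
- by move=> x _; exact: (Phi_cvg hS).
Qed.

Lemma sqr_bound_norm (y C : R) : y ^+ 2 <= C -> `|y| <= Num.sqrt C.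
Proof. by move=> h; rewrite -sqrtr_sqr ler_sqrt// (le_trans _ h)// sqr_ge0. Qed.

Lemma sqi_Phi c : finite_energy lam c -> sqi L (Phi c).
Proof.
move=> fc; have [S hS] := fc.
apply: (sqi_bounded L (M := Num.sqrt (kap * S))); first exact: Phi_meas.
by move=> x; apply: sqr_bound_norm; exact: Phi_bound.
Qed.

Lemma Phi_periodic c : periodic (Phi c) L.
Proof. by move=> x; rewrite /Phi; under eq_fun do rewrite (tsum_periodic L0). Qed.

Lemma pairing_sqr_bound f (C : R) : sqi L f -> (forall x, I x -> f x ^+ 2 <= C) ->
  pairing L f f <= L * C.
Proof.
move=> hf hC; have -> : L * C = \int[mu]_(x in I) C.
  by rewrite Rintegral_cst//= lebesgue_measure_itv/= lte_fin L0 -EFinB/= subr0 mulrC.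
rewrite pairing_sqr; apply: le_Rintegral => //; first exact: hf.2.
by apply: integ_cont; exact: cst_continuous.
Qed.

Lemma coef_Phi c k : finite_energy lam c -> coef (Phi c) k = c k.
Proof.
move=> fc; have [S hS] := fc.
have hP := sqi_Phi fc.
apply/eqP; rewrite -subr_eq0 -sqrf_eq0 eq_le sqr_ge0 andbT.
apply: (@le0_inv_nat _ (L * (kap * S))) => n.
(* The summand [k.+1] puts the mode [k] into the partial sum, the summand [n] makes the remainder
   small. *)
pose N := (n + k.+1)%N.
have -> : c k = coef (tsum c 0 N) k.
  by rewrite coef_tsum//= ifT// /N addnS ltnS leq_addl.
have ht := sqi_tsum L c 0 N; have hd := sqi_sub hP ht.
rewrite -coefB//.
apply: (@le_trans _ _ (\sum_(k <= l < k.+1) coef (fun x => Phi c x - tsum c 0 N x) l ^+ 2)).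
  by rewrite big_nat1.
apply: le_trans (bessel L0 _ _ hd) _; rewrite -mulrA; apply: pairing_sqr_bound => // x _.
apply: (le_trans (Phi_sub_tsum N x hS)).
have kS : 0 <= kap * S by apply: le_trans (Phi_bound 0 hS); exact: sqr_ge0.
by apply: ler_wpM2l => //; rewrite lef_pV2 ?posrE// ler_nat ltnS /N leq_addr.
Qed.

Lemma mean_Phi c : finite_energy lam c -> mean L (Phi c) = 0.
Proof.
move=> fc; have [S hS] := fc; have hP := sqi_Phi fc.
have s1 : sqi L (fun=> (1 : R)) by exact: sqi_cst.
apply/eqP; rewrite -sqrf_eq0 eq_le sqr_ge0 andbT.
apply: (@le0_inv_nat _ (L * (kap * S) * pairing L (fun=> 1) (fun=> 1))) => n.
have ht := sqi_tsum L c 0 n; have hd := sqi_sub hP ht.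
have -> : mean L (Phi c) = pairing L (fun x => Phi c x - tsum c 0 n x) (fun=> 1).
  by rewrite pairingBl// -!meanE mean_tsum// subr0.
apply: le_trans (cauchy_schwarz hd s1) _.
rewrite mulrAC ler_wpM2r ?pairing_ge0// -mulrA; apply: pairing_sqr_bound => // x _.
exact: Phi_sub_tsum.
Qed.

Lemma Phi_L2_per c : finite_energy lam c -> L2_per L (Phi c).
Proof. by move=> fc; have [h1 h2] := sqi_Phi fc; split => //; exact: Phi_periodic. Qed.

End Synthesis.

(** * H^1 and the weak derivative in terms of coefficients *)

Section WeakDerivative.
Context {R : realType}.
Notation mu := (@lebesgue_measure R).
Set Implicit Arguments.
Unset Strict Implicit.
Variable L : R.
Hypothesis L0 : 0 < L.
Implicit Types (f g h p q : R -> R) (x : R) (N M k : nat) (c : nat -> R).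
Notation coef := (coef L).
Notation tsum := (tsum L).
Notation lam := (lam L).
Notation dfreq := (dfreq L).
Notation Phi := (Phi L).
Notation energy_le c S := (forall M, \sum_(0 <= k < M) lam k * c k ^+ 2 <= S).

Let w : R := 2 * pi / L.
Let w0 : 0 < w. Proof. by rewrite divr_gt0// mulr_gt0// pi_gt0. Qed.

Lemma lam_le_hweight k : lam k <= w ^+ 2 * hweight 1 k.
Proof.
rewrite hweight1 !lamE /freq -/w [leLHS]exprMn ler_wpM2l ?sqr_ge0//.
by rewrite lerDr.
Qed.

(** The factor 2 comes from 1 + n^2 <= 2 n^2, valid because the frequency indices start at 1. *)
Lemma hweight_le_lam k : hweight 1 k <= 2 / w ^+ 2 * lam k.
Proof.
rewrite hweight1 !lamE /freq -/w [X in _ <= _ * X]exprMn.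
have w2 : w ^+ 2 != 0 by rewrite sqrf_eq0 gt_eqF.
rewrite mulrA divfK//.
have : 1 <= (k./2.+1)%:R :> R by rewrite ler1n.
by move: (k./2.+1)%:R => r r1; rewrite expr2; nra.
Qed.

Lemma Hs1_energy f N : Hs_per_m L 1 f ->
  \sum_(0 <= k < N) lam k * coef f k ^+ 2 <= w ^+ 2 * Hs_norm L 1 f ^+ 2.
Proof.
move=> hf; apply: (@le_trans _ _ (w ^+ 2 * \sum_(0 <= k < N) hweight 1 k * coef f k ^+ 2)).
  rewrite mulr_sumr; apply: ler_sum => k _; rewrite [leRHS]mulrA ler_wpM2r ?sqr_ge0//.
  exact: lam_le_hweight.
by rewrite ler_wpM2l ?sqr_ge0// Hs_norm_ge.
Qed.

Lemma hweight_sum_le c S N : energy_le c S ->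
  \sum_(0 <= k < N) hweight 1 k * c k ^+ 2 <= 2 / w ^+ 2 * S.
Proof.
move=> hS; apply: (@le_trans _ _ (2 / w ^+ 2 * \sum_(0 <= k < N) lam k * c k ^+ 2)).
  rewrite mulr_sumr; apply: ler_sum => k _; rewrite [leRHS]mulrA ler_wpM2r ?sqr_ge0//.
  exact: hweight_le_lam.
by rewrite ler_wpM2l// divr_ge0// sqr_ge0.
Qed.

Lemma Hs1P f : Hs_per_m L 1 f <->
  [/\ L2_per L f, mean L f = 0 & finite_energy lam (coef f)].
Proof.
split=> [hf|[h1 h2 [S hS]]].
  have [h1 h2 _] := (Hs_per_mE L0 1 f).1 hf; split=> //.
  by exists (w ^+ 2 * Hs_norm L 1 f ^+ 2) => N; exact: Hs1_energy.
apply/Hs_per_mE => //; split=> //.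
by exists (2 / w ^+ 2 * S) => N; exact: hweight_sum_le.
Qed.

Lemma Hs0P f : Hs_per_m L 0 f <-> L2_per L f /\ mean L f = 0.
Proof.
split=> [hf|[h1 h2]].
  by have [h1 h2 _] := (Hs_per_mE L0 0 f).1 hf.
apply/Hs_per_mE => //; split=> //.
exists (pairing L f f) => N; under eq_bigr do rewrite hweight0 mul1r.
by apply: bessel => //; case: h1.
Qed.

Lemma Hs1_Phi f : Hs_per_m L 1 f -> eq_ae f (Phi (coef f)).
Proof.
move=> /Hs1P[h1 h2 h3]; apply: (coef_inj L0) => //.
- exact: Phi_L2_per.
- by rewrite h2 mean_Phi.
- by move=> k; rewrite coef_Phi.
Qed.

Lemma Phi_Hs1 c : finite_energy lam c -> Hs_per_m L 1 (Phi c).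
Proof.
move=> fc; apply/Hs1P; split; [exact: Phi_L2_per|exact: mean_Phi|].
by have [S hS] := fc; exists S => N; under eq_bigr do rewrite coef_Phi//.
Qed.

(** An initial segment of even length consists of whole cosine-sine pairs, which [partner] permutes.
    This is why sums involving derivatives run up to [M.*2]. *)
Lemma sum_partner (F : nat -> R) M :
  \sum_(0 <= k < M.*2) F (partner k) = \sum_(0 <= k < M.*2) F k.
Proof.
elim: M => [|M IH]; first by rewrite !big_geq.
rewrite doubleS !(big_nat_recr M.*2.+1)//= !(big_nat_recr M.*2)//= IH -!addrA.
by congr (_ + _); rewrite /partner /= odd_double /= addrC.
Qed.

Lemma cvg_double (u : nat -> R) (l : R) : u @ \oo --> l -> (fun M => u M.*2) @ \oo --> l.
Proof.
move=> ul; apply/cvgrPdist_le => e e0.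
have [N0 _ h] := (@cvgrPdist_le _ _ _ _ _ _ _).1 ul _ e0.
by exists N0 => // M NM; apply: h => /=; rewrite (leq_trans NM)// -addnn leq_addr.
Qed.

(** Integration by parts over one period; the boundary terms cancel by periodicity. *)
Lemma coef_derive q k : periodic q L -> is_C1 q ->
  coef (derive1 q) k = - (dfreq k * coef q (partner k)).
Proof.
move=> pq [dq cq'].
have isd x : is_derive x 1 q (derive1 q x) by rewrite derive1E; exact/derivableP/dq.
have cq : continuous q by move=> x; exact: (is_derive_continuous (isd x)).
have := @Rintegral_derive _ 0 L
  (fun x => q x * (dfreq k * tb L (partner k) x) + tb L k x * derive1 q x)
  (fun x => q x * tb L k x) (ltW L0).
have -> : q L * tb L k L - q 0 * tb L k 0 = 0.
  by rewrite -[L in q L]add0r -[X in tb L k X]add0r pq tb_periodic// subrr.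
have ct j : continuous (tb L j) by exact: tb_continuous.
move=> /(_ _ _)-H; have {H} : \int[mu]_(x in `[0, L])
   (q x * (dfreq k * tb L (partner k) x) + tb L k x * derive1 q x) = 0.
  apply: H.
    apply: continuous_add; last exact: continuous_mul.
    by apply: continuous_mul => //; exact: continuous_scale.
  by move=> x; apply: is_derive_mul => //; exact: is_derive_tb.
rewrite RintegralD//; last 2 first.
- by apply: integ_cont; apply: continuous_mul => //; exact: continuous_scale.
- by apply: integ_cont; exact: continuous_mul.
move=> /eqP; rewrite addrC addr_eq0 => /eqP h.
rewrite /coef pairingC /pairing h; congr (- _).
rewrite -RintegralZl//; last by apply: integ_cont; exact: continuous_mul.
by apply: eq_Rintegral => x _; rewrite mulrCA.
Qed.

Lemma is_C1_tb k : is_C1 (tb L k).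
Proof.
have h x := is_derive_tb L k x.
split; first by move=> x; case: (h x).
have -> : derive1 (tb L k) = (fun x => dfreq k * tb L (partner k) x).
  by apply/funext => x; rewrite derive1E; case: (h x).
by apply: continuous_scale; exact: tb_continuous.
Qed.

Lemma coef_is_weak_dx f g k : sqi L f -> is_weak_dx L f g -> coef g k = - (dfreq k * coef f (partner k)).
Proof.
move=> hf [_ h]; have := h (tb L k) (tb_periodic L0 k) (is_C1_tb k).
move=> /eqP; rewrite -eqr_oppLR => /eqP E; rewrite /coef /pairing -E; congr (- _).
rewrite -RintegralZl//; last by apply: sqi_mul => //; exact: sqi_tb.
apply: eq_Rintegral => x _; rewrite derive1E mulrCA; congr (_ * _).
by case: (is_derive_tb L k x).
Qed.

Lemma mean_is_weak_dx f g : is_weak_dx L f g -> mean L g = 0.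
Proof.
move=> [_ h]; have c1 : is_C1 (cst 1 : R -> R).
  split; first by move=> x; exact: derivable_cst.
  by have -> : derive1 (cst 1 : R -> R) = cst 0; [apply/funext => x; rewrite derive1_cst|exact: cst_continuous].
have := h (cst 1) (fun=> erefl) c1.
under eq_Rintegral do rewrite derive1_cst mulr0.
rewrite Rintegral_cst// mul0r => /esym/eqP; rewrite oppr_eq0 => /eqP.
by under eq_Rintegral do rewrite mulr1.
Qed.

(** The candidate is the Riesz-Fischer function with the differentiated coefficients; the
    integration by parts formula is checked mode by mode through Parseval's identity on both
    sides. *)
Lemma weak_dx_exists f : Hs_per_m L 1 f -> exists g, is_weak_dx L f g.
Proof.
move=> /Hs1P[[mf pf if2] mf0 [S hS]].
have hf : sqi L f by [].
pose c k := - (dfreq k * coef f (partner k)).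
have c2 k : c k ^+ 2 = lam (partner k) * coef f (partner k) ^+ 2.
  by rewrite /c sqrrN exprMn dfreq_sqr !lamE freq_partner.
have hc N : \sum_(0 <= k < N) c k ^+ 2 <= S.
  apply: (@le_trans _ _ (\sum_(0 <= k < N.*2) c k ^+ 2)).
    by apply: le_sum_widen => [k|]; [exact: sqr_ge0|rewrite -addnn leq_addl].
  under eq_bigr do rewrite c2.
  by rewrite (sum_partner (fun k => lam k * coef f k ^+ 2)).
have [g [gL mg cg _]] := riesz_fischer L0 hc.
have hg : sqi L g by case: gL.
exists g; split=> // q pq c1q.
have [dq cq'] := c1q.
have isd x : is_derive x 1 q (derive1 q x) by rewrite derive1E; exact/derivableP/dq.
have cq : continuous q by move=> x; exact: (is_derive_continuous (isd x)).
have h1 := cvg_double (parseval_cvg L0 hf mf0 (sqi_cont L cq')).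
have h2 : (fun M => - \sum_(0 <= k < M.*2) coef g k * coef q k) @ \oo --> - pairing L g q.
  exact: cvgN (cvg_double (parseval_cvg L0 hg mg (sqi_cont L cq))).
have E : (fun M => \sum_(0 <= k < M.*2) coef f k * coef (derive1 q) k) =
         (fun M => - \sum_(0 <= k < M.*2) coef g k * coef q k).
  apply/funext => M; rewrite -sumrN -(sum_partner (fun k => - (coef g k * coef q k))).
  apply: eq_bigr => k _; rewrite cg /c partnerK dfreq_partner coef_derive//.
  by ring.
rewrite E in h1.
have := cvg_unique (@Rhausdorff R) h1 h2; exact.
Qed.

Lemma weak_dxP f : Hs_per_m L 1 f -> is_weak_dx L f (weak_dx L f).
Proof.
by move=> /weak_dx_exists[g hg]; rewrite /weak_dx; apply: (xgetPex (cst 0)); exists g.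
Qed.

Lemma sqi_weak_dx f : Hs_per_m L 1 f -> sqi L (weak_dx L f).
Proof. by move=> /weak_dxP[[]]. Qed.

Lemma mean_weak_dx f : Hs_per_m L 1 f -> mean L (weak_dx L f) = 0.
Proof. by move=> /weak_dxP; exact: mean_is_weak_dx. Qed.

Lemma coef_weak_dx f k : Hs_per_m L 1 f ->
  coef (weak_dx L f) k = - (dfreq k * coef f (partner k)).
Proof.
move=> hf; apply: coef_is_weak_dx; last exact: weak_dxP.
by have /Hs1P[[]] := hf.
Qed.

(** The Dirichlet form is diagonal in the basis with eigenvalues [lam], which are thus the
    stiffnesses of the oscillators. *)
Lemma weak_dx_pairing_cvg f p : Hs_per_m L 1 f -> Hs_per_m L 1 p ->
  (fun M => \sum_(0 <= k < M.*2) lam k * coef f k * coef p k) @ \oo -->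
  pairing L (weak_dx L f) (weak_dx L p).
Proof.
move=> hf hp.
have h := cvg_double (parseval_cvg L0 (sqi_weak_dx hf) (mean_weak_dx hf) (sqi_weak_dx hp)).
have E : (fun M => \sum_(0 <= k < M.*2) coef (weak_dx L f) k * coef (weak_dx L p) k) =
         (fun M => \sum_(0 <= k < M.*2) lam k * coef f k * coef p k).
  apply/funext => M; rewrite -[RHS](sum_partner (fun k => lam k * coef f k * coef p k)).
  apply: eq_bigr => k _; rewrite !coef_weak_dx// lamE freq_partner -dfreq_sqr.
  by ring.
by rewrite E in h.
Qed.

Lemma pairing_weak_dx_le f S : Hs_per_m L 1 f -> energy_le (coef f) S ->
  pairing L (weak_dx L f) (weak_dx L f) <= S.
Proof.
move=> hf hS; apply: (pairing_le_sum L0 (sqi_weak_dx hf) (mean_weak_dx hf)) => N.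
apply: (@le_trans _ _ (\sum_(0 <= k < N.*2) coef (weak_dx L f) k ^+ 2)).
  by apply: le_sum_widen => [k|]; [exact: sqr_ge0|rewrite -addnn leq_addl].
apply: le_trans (hS N.*2); rewrite -(sum_partner (fun k => lam k * coef f k ^+ 2)).
apply: ler_sum => k _; rewrite coef_weak_dx// sqrrN exprMn dfreq_sqr !lamE freq_partner.
by [].
Qed.

End WeakDerivative.

(** * The truncated equation *)

Section TruncatedCubic.
Context {R : realType}.
Set Implicit Arguments.
Unset Strict Implicit.
Variable K : R.
Hypothesis K0 : 0 <= K.
Implicit Types (s t : R).

(** The projection onto [-K, K], written with absolute values so that its continuity is
    immediate. *)
Definition clip s : R := (`|s + K| - `|s - K|) / 2.
Definition cubic s : R := clip s ^+ 3.
(* The primitive of [cubic] vanishing at 0. *)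
Definition quartic s : R := clip s ^+ 4 / 4 + clip s ^+ 3 * (s - clip s).

Lemma clip_cases s : [\/ s <= - K /\ clip s = - K, - K <= s <= K /\ clip s = s |
  K <= s /\ clip s = K].
Proof.
have K0' := K0.
rewrite /clip; have [h1|h1] := lerP s (- K).
  by apply: Or31; split=> //; rewrite !ler0_norm; lra.
have [h2|h2] := lerP s K.
  by apply: Or32; split; [apply/andP; split; lra|rewrite ger0_norm ?ler0_norm; lra].
by apply: Or33; split; [lra|rewrite !ger0_norm; lra].
Qed.

Lemma clip_id s : `|s| <= K -> clip s = s.
Proof.
by rewrite ler_norml => /andP[h1 h2]; case: (clip_cases s) => -[]; lra.
Qed.

Lemma clip_bound s : - K <= clip s <= K.
Proof.
have K0' := K0.
by case: (clip_cases s) => -[h ->]; apply/andP; split; move: h => //; try lra; case/andP; lra.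
Qed.

Lemma clip_mono s t : s <= t -> 0 <= clip t - clip s <= t - s.
Proof.
have K0' := K0.
by case: (clip_cases s) => -[hs ->]; case: (clip_cases t) => -[ht ->] st;
  apply/andP; split; try lra; try (case/andP: hs => *; lra); case/andP: ht => *;
  try lra; case/andP: hs => *; lra.
Qed.

Lemma cube_diff (p q : R) : - K <= p <= K -> - K <= q <= K -> p <= q ->
  0 <= q ^+ 3 - p ^+ 3 <= 3 * K ^+ 2 * (q - p).
Proof.
move=> /andP[p1 p2] /andP[q1 q2] pq.
have -> : q ^+ 3 - p ^+ 3 = (q ^+ 2 + q * p + p ^+ 2) * (q - p) by ring.
have h0 : 0 <= q ^+ 2 + q * p + p ^+ 2.
  rewrite (_ : _ + _ = (q + p / 2) ^+ 2 + 3 / 4 * p ^+ 2); last by field.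
  by rewrite addr_ge0 ?sqr_ge0// mulr_ge0 ?sqr_ge0.
have hp : p ^+ 2 <= K ^+ 2 by rewrite -subr_ge0 (_ : _ - _ = (K - p) * (K + p)); [rewrite mulr_ge0; lra|ring].
have hq : q ^+ 2 <= K ^+ 2 by rewrite -subr_ge0 (_ : _ - _ = (K - q) * (K + q)); [rewrite mulr_ge0; lra|ring].
have hpq : q * p <= K ^+ 2.
  have := sqr_ge0 (q - p); rewrite (_ : (q - p) ^+ 2 = q ^+ 2 + p ^+ 2 - 2 * (q * p)); [lra|ring].
rewrite mulr_ge0 ?subr_ge0//=; apply: ler_wpM2r; first by rewrite subr_ge0.
by lra.
Qed.

Lemma cubic_mono s t : s <= t -> 0 <= cubic t - cubic s <= 3 * K ^+ 2 * (t - s).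
Proof.
move=> st; have /andP[c1 c2] := clip_mono st.
have /andP[h1 h2] := cube_diff (clip_bound s) (clip_bound t) (etrans (esym (subr_ge0 _ _)) c1).
rewrite /cubic h1/=; apply: (le_trans h2); apply: ler_wpM2l => //.
by rewrite mulr_ge0// sqr_ge0.
Qed.

Lemma cubic_lipschitz s t : (cubic t - cubic s) ^+ 2 <= 9 * K ^+ 4 * (t - s) ^+ 2.
Proof.
wlog st : s t / s <= t.
  move=> H; case: (leP s t) => [|/ltW] /H//.
  by rewrite -sqrrN opprB -[in X in _ -> _ <= X]sqrrN opprB.
have /andP[h1 h2] := cubic_mono st.
have -> : 9 * K ^+ 4 * (t - s) ^+ 2 = (3 * K ^+ 2 * (t - s)) ^+ 2 by ring.
by rewrite ler_pXn2r ?nnegrE// (le_trans h1).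
Qed.

(** The remainder is a sum of squares plus [(clip t ^+ 3 - clip s ^+ 3) * (t - clip t)]. The last
    factor vanishes unless [t] leaves [-K, K], and then [clip t] is the extreme value on that side,
    so both factors have the same sign. *)
Lemma quartic_convex s t : 0 <= quartic t - quartic s - cubic s * (t - s).
Proof.
rewrite /quartic /cubic.
have -> : clip t ^+ 4 / 4 + clip t ^+ 3 * (t - clip t) -
   (clip s ^+ 4 / 4 + clip s ^+ 3 * (s - clip s)) - clip s ^+ 3 * (t - s) =
   (clip t - clip s) ^+ 2 * ((clip t + clip s) ^+ 2 + 2 * clip s ^+ 2) / 4 +
   (clip t ^+ 3 - clip s ^+ 3) * (t - clip t) by field.
apply: addr_ge0.
  rewrite divr_ge0// mulr_ge0 ?sqr_ge0// addr_ge0 ?sqr_ge0// mulr_ge0// sqr_ge0//.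
have bs := clip_bound s; have bt := clip_bound t.
have K0' := K0; have bK : - K <= K <= K by apply/andP; split; lra.
have bN : - K <= - K <= K by apply/andP; split; lra.
case: (clip_cases t) => -[ht et].
- have /andP[h _] := cube_diff bN bs (andP bs).1.
  by rewrite et -mulrNN mulr_ge0// ?opprB//; lra.
- by rewrite et subrr mulr0.
- have /andP[h _] := cube_diff bs bK (andP bs).2.
  by rewrite et mulr_ge0//; lra.
Qed.

(** Adding the convexity inequalities at [s] and at [t] bounds the remainder by
    [(cubic t - cubic s) * (t - s)]. This form allows the potential to be differentiated in time
    after integration in space. *)
Lemma quartic_remainder s t :
  `|quartic t - quartic s - cubic s * (t - s)| <= 3 * K ^+ 2 * (t - s) ^+ 2.
Proof.
rewrite ger0_norm ?quartic_convex//.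
have h := quartic_convex t s.
apply: (@le_trans _ _ ((cubic t - cubic s) * (t - s))).
  rewrite -subr_ge0; move: h; congr (0 <= _); ring.
case: (leP s t) => st.
  have /andP[h1 h2] := cubic_mono st.
  by rewrite [(t - s) ^+ 2]expr2 [leRHS]mulrA ler_wpM2r// subr_ge0.
have /andP[h1 h2] := cubic_mono (ltW st).
rewrite -[leLHS]mulrNN !opprB -[(t - s) ^+ 2]sqrrN opprB [(s - t) ^+ 2]expr2 [leRHS]mulrA.
rewrite ler_wpM2r// subr_ge0.
exact: ltW.
Qed.

(** The upper bound is the primitive of the full cube: the initial potential energy is controlled
    independently of [K]. *)
Lemma quartic_bounds s : 0 <= quartic s <= s ^+ 4 / 4.
Proof.
have c0 : clip 0 = 0 by apply: clip_id; rewrite normr0.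
have q0 : quartic 0 = 0 by rewrite /quartic c0 subrr mulr0 expr0n/= mul0r addr0.
have := quartic_convex 0 s; rewrite q0 /cubic c0 expr0n/= mul0r !subr0 => -> /=.
rewrite -subr_ge0 /quartic.
have -> : s ^+ 4 / 4 - (clip s ^+ 4 / 4 + clip s ^+ 3 * (s - clip s)) =
  (s - clip s) ^+ 2 * ((s + clip s) ^+ 2 + 2 * clip s ^+ 2) / 4 by field.
by rewrite divr_ge0// mulr_ge0 ?sqr_ge0// addr_ge0 ?sqr_ge0// mulr_ge0// sqr_ge0.
Qed.

Lemma clip_continuous : continuous clip.
Proof.
have cn (c : R) : continuous (fun s : R => `|s + c|).
  move=> s; apply: (@continuous_comp _ _ _ (fun s : R => s + c) (fun s : R => `|s|)).
    by apply: cvgD; [exact: cvg_id|exact: cvg_cst].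
  exact: norm_continuous.
apply: continuous_mul; last exact: cst_continuous.
by apply: continuous_sub; exact: cn.
Qed.

Lemma continuous_expr (T : topologicalType) (f : T -> R) (n : nat) : continuous f ->
  continuous (fun x => f x ^+ n).
Proof.
move=> cf; elim: n => [|n IH]; first by under eq_fun do rewrite expr0; exact: cst_continuous.
by under eq_fun do rewrite exprS; exact: continuous_mul.
Qed.

Lemma cubic_continuous : continuous cubic.
Proof. exact/continuous_expr/clip_continuous. Qed.

Lemma quartic_continuous : continuous quartic.
Proof.
apply: continuous_add.
  apply: continuous_mul; last exact: cst_continuous.
  exact/continuous_expr/clip_continuous.
apply: continuous_mul; first exact: cubic_continuous.
apply: continuous_sub; last exact: clip_continuous.
by move=> s; exact: cvg_id.
Qed.

Lemma cubic_bound s : `|cubic s| <= K ^+ 3.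
Proof.
rewrite normrX ler_pXn2r ?nnegrE//.
by rewrite ler_norml clip_bound.
Qed.

Lemma cubic_id s : `|s| <= K -> cubic s = s ^+ 3.
Proof. by move=> h; rewrite /cubic clip_id. Qed.

End TruncatedCubic.

(** * The truncated force and its potential *)

Section Energy.
Context {R : realType}.
Notation mu := (@lebesgue_measure R).
Set Implicit Arguments.
Unset Strict Implicit.
Variable L : R.
Hypothesis L0 : 0 < L.
Implicit Types (f h : R -> R) (x t : R) (N k : nat) (c : nat -> R).
Notation coef := (coef L).
Notation tsum := (tsum L).
Notation lam := (lam L).
Notation kap := (kap L).
Notation Phi := (Phi L).
Notation I := [set` `[(0 : R), L]].

Let mI : measurable (I : set (measurableTypeR R)). Proof. exact: measurable_itv. Qed.

(** [F] minus its linear part [P] is dominated by [V], which vanishes at [t] together with its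
    derivative; hence [F] and [P] have the same derivative there. *)
Lemma is_derive_remainder (F : R -> R) (a : nat -> R -> R) (b gam : nat -> R) N (C t : R) :
  (forall k, is_derive t 1 (a k) (b k)) ->
  (forall s, `|F s - F t - \sum_(0 <= k < N) gam k * (a k s - a k t)| <=
     C * \sum_(0 <= k < N) (a k s - a k t) ^+ 2) ->
  is_derive t 1 F (\sum_(0 <= k < N) gam k * b k).
Proof.
move=> da hF.
pose P s := \sum_(0 <= k < N) gam k * (a k s - a k t).
pose V s := C * \sum_(0 <= k < N) (a k s - a k t) ^+ 2.
have dak k : is_derive t 1 (fun s => a k s - a k t) (b k).
  by have := is_derive_add (da k) (is_derive_cst (- a k t) t 1); rewrite addr0.
have dP : is_derive t 1 P (\sum_(0 <= k < N) gam k * b k).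
  apply: (@is_derive_bigsum _ _ (fun k s => gam k * (a k s - a k t)) (fun k _ => gam k * b k)).
have [dV eV] : is_derive t 1 V 0.
  rewrite -(mulr0 C); apply: (@is_derive_scale _ (fun s => \sum_(0 <= k < N) (a k s - a k t) ^+ 2)).
  rewrite -[X in is_derive _ _ _ X](@big1_eq _ 0 +%R _ (index_iota 0 N) xpredT).
  apply: (@is_derive_bigsum _ _ (fun k s => (a k s - a k t) ^+ 2) (fun _ _ => 0)) => k.
  apply: (is_derive_congr (is_derive_mul (dak k) (dak k))); first by move=> s; rewrite expr2.
  by rewrite subrr !mul0r addr0.
have V0 : V t = 0.
  by rewrite /V big1 ?mulr0// => k _; rewrite subrr expr0n.
have P0 : P t = 0 by rewrite /P big1// => k _; rewrite subrr mulr0.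
pose U s := F s - P s.
have hU s : `|U s - U t| <= V s.
  by have := hF s; rewrite /U -/(P s) P0 subr0 addrAC.
have cV : (fun r : R => r^-1 *: ((V \o shift t) (r *: 1) - V t)) @ 0^' --> 'D_1 V t.
  by exact: dV.
rewrite eV in cV.
have cU : (fun r : R => r^-1 *: ((U \o shift t) (r *: 1) - U t)) @ 0^' --> (0 : R).
  apply/norm_cvg0P.
  have cV' : (fun r : R => `|r^-1 *: ((V \o shift t) (r *: 1) - V t)|) @ 0^' --> (0 : R).
    by apply/norm_cvg0P; exact: cV.
  apply: (@squeeze_cvgr _ _ _ _ (fun=> 0) _ _ _ _ _ cV'); last exact: cvg_cst.
  apply: nearW => h; rewrite normr_ge0/= !normrZ ler_wpM2l// V0 subr0.
  exact: le_trans (hU _) (ler_norm _).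
have dU : is_derive t 1 U 0.
  split; first by apply/cvg_ex; exists 0; exact: cU.
  exact: (cvg_lim (@Rhausdorff R) cU).
apply: (is_derive_congr (is_derive_add dU dP)); last by rewrite add0r.
by move=> s; rewrite /U subrK.
Qed.

Lemma continuous_remainder (F : R -> R) (a : nat -> R -> R) (gam : R -> nat -> R) N (C : R) :
  (forall k, continuous (a k)) ->
  (forall s t, `|F s - F t - \sum_(0 <= k < N) gam t k * (a k s - a k t)| <=
     C * \sum_(0 <= k < N) (a k s - a k t) ^+ 2) ->
  continuous F.
Proof.
move=> ca hF t.
pose P s := \sum_(0 <= k < N) gam t k * (a k s - a k t).
pose V s := C * \sum_(0 <= k < N) (a k s - a k t) ^+ 2.
have csum (u : nat -> R -> R) : (forall k, continuous (u k)) ->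
    continuous (fun s => \sum_(0 <= k < N) u k s).
  move=> cu; elim: (index_iota 0 N) => [|k l IH].
    by under eq_fun do rewrite big_nil; exact: cst_continuous.
  by under eq_fun do rewrite big_cons; exact: continuous_add.
have cd k : continuous (fun s => a k s - a k t).
  by apply: continuous_sub => //; exact: cst_continuous.
have cW : continuous (fun s => V s + `|P s|).
  apply: continuous_add.
    by apply: continuous_scale; apply: csum => k; exact: continuous_sqr.
  move=> s; apply: (@continuous_comp _ _ _ P (fun s : R => `|s|)); last exact: norm_continuous.
  by apply: csum => k; exact: continuous_scale.
have W0 : V t + `|P t| = 0.
  rewrite /V /P !big1 ?mulr0 ?normr0 ?addr0// => k _; rewrite subrr ?mulr0//.
  by rewrite expr0n.
apply/cvgrPdist_le => e e0.
have [d d0 hd] := (@cvgrPdist_le _ _ _ _ _ _ _).1 (cW t) _ e0.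
exists d => // s /= ts; have := hd s ts; rewrite W0 sub0r normrN => h.
have := hF s t; rewrite -/(P s) -/(V s) => h1.
rewrite distrC; apply: le_trans h.
apply: le_trans (ler_norm _).
have := ler_normD (F s - F t - P s) (P s); rewrite subrK => /le_trans; apply.
by rewrite lerD2r.
Qed.

Section Truncation.
Variable K : R.
Hypothesis K0 : 0 <= K.
Notation cubic := (cubic K).
Notation quartic := (quartic K).

Definition source c k : R := c k - coef (fun x => cubic (Phi c x)) k.

Lemma sqi_cubic f : measurable_fun setT f -> sqi L (fun x => cubic (f x)).
Proof.
move=> mf; apply: (sqi_bounded L (M := K ^+ 3)).
  by apply: measurableT_comp => //; apply: measurable_continuous; exact: cubic_continuous.
by move=> x; exact: cubic_bound.
Qed.

Lemma coef_cubic_le f f' (C : R) m N : measurable_fun setT f -> measurable_fun setT f' ->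
  (forall x, (f x - f' x) ^+ 2 <= C) ->
  \sum_(m <= k < N) (coef (fun x => cubic (f x)) k - coef (fun x => cubic (f' x)) k) ^+ 2
  <= 9 * K ^+ 4 * (L * C).
Proof.
move=> mf mf' hC; have h1 := sqi_cubic mf; have h2 := sqi_cubic mf'.
have h3 := sqi_sub h1 h2.
rewrite (eq_bigr (fun k => coef (fun x => cubic (f x) - cubic (f' x)) k ^+ 2)); last first.
  by move=> k _; rewrite coefB.
apply: le_trans (bessel L0 _ _ h3) _.
rewrite mulrCA; apply: pairing_sqr_bound => // x _.
apply: le_trans (cubic_lipschitz K0 _ _) _; apply: ler_wpM2l => //.
by rewrite mulr_ge0// exprn_ge0.
Qed.

(** The first term comes from the linear part and the lower bound (2 pi / L)^2 on [lam]. In the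
    second, [9 * K ^+ 4] is the squared Lipschitz constant of the truncated cube and [L * kap]
    passes from the energy through the sup norm to L^2. Both are doubled by (x - y)^2 <= 2 (x^2 +
    y^2). *)
Definition source_lipschitz_cst : R :=
  2 * ((2 * pi / L) ^+ 2)^-1 + 2 * (9 * K ^+ 4 * (L * kap)).

Lemma source_lipschitz_cst_ge0 : 0 <= source_lipschitz_cst.
Proof.
rewrite addr_ge0//; first by rewrite mulr_ge0// invr_ge0 sqr_ge0.
rewrite mulr_ge0//.
apply: mulr_ge0; first by rewrite mulr_ge0// exprn_ge0.
by rewrite mulr_ge0// ltW// kap_gt0.
Qed.

Lemma source_lipschitz : lipschitz_source lam source source_lipschitz_cst.
Proof.
move=> c c' fc fc' S hS N.
have h2 := coef_cubic_le 0 N (Phi_meas L0 fc) (Phi_meas L0 fc')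
  (fun x => Phi_sub_bound L0 x fc fc' hS).
have w0 : 0 < (2 * pi / L) ^+ 2.
  by rewrite exprn_gt0// divr_gt0// mulr_gt0// pi_gt0.
have h1 : \sum_(0 <= k < N) (c k - c' k) ^+ 2 <= ((2 * pi / L) ^+ 2)^-1 * S.
  rewrite ler_pdivlMl//; apply: le_trans (hS N); rewrite mulr_sumr; apply: ler_sum => k _.
  by rewrite ler_wpM2r ?sqr_ge0// lam_ge.
apply: (@le_trans _ _ (\sum_(0 <= k < N) (2 * (c k - c' k) ^+ 2 +
   2 * (coef (fun x => cubic (Phi c x)) k - coef (fun x => cubic (Phi c' x)) k) ^+ 2))).
  apply: ler_sum => k _; rewrite /source -mulrDr.
  have -> : c k - coef (fun x => cubic (Phi c x)) k - (c' k - coef (fun x => cubic (Phi c' x)) k)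
    = (c k - c' k) - (coef (fun x => cubic (Phi c x)) k - coef (fun x => cubic (Phi c' x)) k) by ring.
  exact: sqr_sub_le.
rewrite big_split/= -!mulr_sumr /source_lipschitz_cst.
have := lerD (ler_wpM2l (ler0n R 2) h1) (ler_wpM2l (ler0n R 2) h2).
move/le_trans; apply; apply: eq_ler.
by move: (_ ^-1) => p; ring.
Qed.

Lemma source0 k : source (fun=> 0) k = 0.
Proof.
have P0 x : Phi (fun=> 0) x = 0.
  rewrite /Phi (_ : (fun N => tsum (fun=> 0) 0 N x) = (fun=> 0)) ?lim_cst//.
  by apply/funext => N; apply: big1 => i _; rewrite mul0r.
rewrite /source sub0r /coef /pairing.
under eq_Rintegral do rewrite P0 /cubic clip_id ?normr0// expr0n/= mul0r.
by rewrite Rintegral_cst// mul0r oppr0.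
Qed.

(** The potential is evaluated on a partial sum, so that its time derivative involves finitely many
    modes. *)
Definition Gam (a : nat -> R -> R) N t : R := \int[mu]_(x in I) quartic (tsum (a^~ t) 0 N x).

Lemma integ_quartic c N : integ L (fun x => quartic (tsum c 0 N x)).
Proof.
apply: integ_cont => x; apply: (@continuous_comp _ _ _ (tsum c 0 N) quartic).
  exact: tsum_continuous.
exact: quartic_continuous.
Qed.

Lemma tsumB c c' N x : tsum (fun k => c k - c' k) 0 N x = tsum c 0 N x - tsum c' 0 N x.
Proof. by rewrite /tsum -sumrB; apply: eq_bigr => k _; rewrite mulrBl. Qed.

Lemma Gam_remainder (a : nat -> R -> R) N s t :
  `|Gam a N s - Gam a N t - \sum_(0 <= k < N)
      coef (fun x => cubic (tsum (a^~ t) 0 N x)) k * (a k s - a k t)| <=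
  3 * K ^+ 2 * \sum_(0 <= k < N) (a k s - a k t) ^+ 2.
Proof.
set A := tsum (a^~ s) 0 N; set B := tsum (a^~ t) 0 N.
have hg : sqi L (fun x => cubic (B x)).
  by apply: sqi_cubic; apply: measurable_continuous; exact: tsum_continuous.
have iA : integ L (fun x => quartic (A x)) by exact: integ_quartic.
have iB : integ L (fun x => quartic (B x)) by exact: integ_quartic.
have AB : (fun x => A x - B x) = tsum (fun k => a k s - a k t) 0 N.
  by apply/funext => x; rewrite tsumB.
have hAB : sqi L (fun x => A x - B x) by rewrite AB; exact: sqi_tsum.
have E : Gam a N s - Gam a N t - \sum_(0 <= k < N)
      coef (fun x => cubic (B x)) k * (a k s - a k t) =
   \int[mu]_(x in I) (quartic (A x) - quartic (B x) - cubic (B x) * (A x - B x)).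
  rewrite RintegralB//; last 2 first.
  - have := integ_add iA (integ_scale (-1) iB).
    by under [X in integ L X -> _]eq_fun do rewrite mulN1r.
  - exact: sqi_mul.
  rewrite RintegralB//; congr (_ - _).
  have -> : \int[mu]_(x in I) (cubic (B x) * (A x - B x)) = pairing L (fun x => A x - B x) (fun x => cubic (B x)).
    by rewrite pairingC.
  by rewrite AB pairing_tsuml//; apply: eq_bigr => k _; rewrite mulrC.
have bd : integ L (fun x => 3 * K ^+ 2 * (A x - B x) ^+ 2) by apply: integ_scale; exact: hAB.2.
have iR : integ L (fun x => quartic (A x) - quartic (B x) - cubic (B x) * (A x - B x)).
  have := integ_add (integ_add iA (integ_scale (-1) iB)) (integ_scale (-1) (sqi_mul hg hAB)).
  by under [X in integ L X -> _]eq_fun do rewrite !mulN1r.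
rewrite E; apply: le_trans (le_normr_Rintegral mI iR) _.
apply: (@le_trans _ _ (\int[mu]_(x in I) (3 * K ^+ 2 * (A x - B x) ^+ 2))).
  apply: le_Rintegral => //; first exact: integrable_norm iR.
  by move=> x _; exact: quartic_remainder.
rewrite RintegralZl//; last exact: hAB.2.
by rewrite -(pairing_sqr L (fun x => A x - B x)) AB pairing_tsum.
Qed.

End Truncation.
End Energy.

(** * The a priori bound *)

Section EnergyBound.
Context {R : realType}.
Notation mu := (@lebesgue_measure R).
Set Implicit Arguments.
Unset Strict Implicit.
Variable L : R.
Hypothesis L0 : 0 < L.
Hypothesis L2pi : 1 < 2 * pi / L.
Implicit Types (h : R -> R) (x t : R) (N M k : nat).
Notation coef := (coef L).
Notation tsum := (tsum L).
Notation lam := (lam L).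
Notation kap := (kap L).
Notation Phi := (Phi L).
Notation I := [set` `[(0 : R), L]].

(** The condition L < 2 pi in spectral form: it makes the quadratic form of - d^2/dx^2 - 1 positive
    on mean-zero functions. *)
Lemma lam_gt1 k : 1 < lam k.
Proof.
apply: (@lt_le_trans _ _ ((2 * pi / L) ^+ 2)); last exact: lam_ge.
rewrite -[ltLHS](expr1n _ 2) ltr_pXn2r ?nnegrE//.
by rewrite ltW// (lt_trans _ L2pi).
Qed.

Variable K : R.
Hypothesis K0 : 0 <= K.
Variables (a b : nat -> R -> R) (B LL E0 : R).
Hypothesis LL0 : 0 <= LL.
Hypothesis osc : oscillators lam a b (fun k t => source L K (a^~ t) k).
Hypothesis bnd : forall t, 0 <= t -> forall N,
  energy lam a b (index_iota 0 N) t <= B * expR (LL * t).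
Hypothesis ini : forall N, energy lam a b (index_iota 0 N) 0 <= E0.

Notation lam1 := (fun k => lam k - 1).
Notation cub := (fun k t => coef (fun x => cubic K (Phi (a^~ t) x)) k).

Let fe t : 0 <= t -> finite_energy lam (a^~ t).
Proof.
move=> t0; exists (B * expR (LL * t)) => N.
exact: le_trans (energy_potential_le lam a b _ t) (bnd t0 N).
Qed.

Let lam10 k : 0 <= lam k - 1. Proof. by rewrite subr_ge0 ltW// lam_gt1. Qed.

(** The linear term of the source is absorbed into the stiffness, leaving as source the cubic term,
    whose work [Gam] is to compensate. *)
Lemma osc1 : oscillators lam1 a b (fun k t => - cub k t).
Proof.
have [ca cb da db] := osc; split=> // k t t0.
by apply: (is_derive_congr (db k t t0)) => //; rewrite /source; ring.
Qed.

Lemma Gam_ge0 N t : 0 <= Gam L K a N t.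
Proof. by apply: Rintegral_ge0 => x _; have /andP[] := quartic_bounds K0 (tsum (a^~ t) 0 N x). Qed.

(** The constant is 2 L (kap E0)^2 / 4, from the quartic bound and the sup bound [kap * E0] on the
    square of the initial partial sum. *)
Lemma Gam0_le N : 2 * Gam L K a N 0 <= L / 2 * (kap * E0) ^+ 2.
Proof.
have e0 M : \sum_(0 <= k < M) lam k * a k 0 ^+ 2 <= E0.
  exact: le_trans (energy_potential_le lam a b _ 0) (ini M).
have h : Gam L K a N 0 <= \int[mu]_(x in I) ((kap * E0) ^+ 2 / 4).
  apply: le_Rintegral => //; first exact: integ_quartic.
    by apply: integ_cont; exact: cst_continuous.
  move=> x _; have /andP[_ h] := quartic_bounds K0 (tsum (a^~ 0) 0 N x).
  apply: (le_trans h); rewrite ler_pM2r ?invr_gt0//.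
  have h1 := tsum_bound L0 0 N x e0; rewrite divr1 in h1.
  rewrite -[4%N]/(2 * 2)%N exprM ler_pXn2r ?nnegrE ?sqr_ge0//.
  by apply: le_trans h1; exact: sqr_ge0.
rewrite Rintegral_cst//= lebesgue_measure_itv/= lte_fin L0 -EFinB/= subr0 in h.
by move: h; move: (_ ^+ 2) (Gam _ _ _ _ _) => p q; lra.
Qed.

(* The bound does not involve the truncation height [K]. Conservation is applied
   to the first [Q] modes, with an error that tends to 0 with [Q]. *)
Theorem energy_bound t N : 0 <= t ->
  energy lam1 a b (index_iota 0 N) t <= E0 + L / 2 * (kap * E0) ^+ 2.
Proof.
move=> t0; apply/ler_addgt0Pr => e e0.
pose A := B * expR (LL * t).
have B0 : 0 <= B.
  by have := bnd (lexx 0) 0%N; rewrite /energy big_geq// mulr0 expR0 mulr1.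
have A0 : 0 <= A by rewrite mulr_ge0// expR_ge0.
have hA (s : R) : 0 <= s <= t -> forall M, energy lam a b (index_iota 0 M) s <= A.
  move=> /andP[s0 st] M; apply: le_trans (bnd s0 M) _; apply: ler_wpM2l => //.
  by rewrite ler_expR ler_wpM2l.
pose ep := e / (t + 1).
have t1 : 0 < t + 1 by rewrite ltr_wpDl.
have ep0 : 0 < ep by rewrite divr_gt0.
(* This Young parameter makes the kinetic half of the error at most [ep / 2] for every number of
   modes; [Q] is chosen afterwards to make the other half small. *)
pose eta := ep / (2 * (A + 1)).
have A1 : 0 < 2 * (A + 1) by rewrite mulr_gt0// ltr_wpDl.
have eta0 : 0 < eta by rewrite divr_gt0.
have etaA : eta * A <= ep / 2.
  rewrite /eta mulrAC ler_pdivrMr//.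
  have -> : ep / 2 * (2 * (A + 1)) = ep * (A + 1) by field.
  by rewrite ler_pM2l// lerDl.
have ep2 : 0 < ep / 2 by rewrite divr_gt0.
have [N0 hN0] := inv_nat_small (eta^-1 * (9 * K ^+ 4 * (L * (kap * A)))) ep2.
pose Q := maxn N N0.
have NQ : (N <= Q)%N by exact: leq_maxl.
have {hN0} hQ := hN0 Q (leq_maxr _ _).
have [cE dE] := oscillators_energy (index_iota 0 Q) osc1.
have [ca cb da db] := osc.
pose gq s k := coef (fun x => cubic K (tsum (a^~ s) 0 Q x)) k.
have cG : continuous (fun s : R => Gam L K a Q `|s|).
  apply: (@continuous_remainder _ (fun s : R => Gam L K a Q `|s|) (fun k s => a k `|s|)
    (fun s k => gq `|s| k) Q (3 * K ^+ 2)) => //.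
  by move=> s r; exact: Gam_remainder.
have dG (s : R) : 0 < s -> is_derive s 1 (Gam L K a Q) (\sum_(0 <= k < Q) gq s k * b k s).
  move=> s0; apply: (@is_derive_remainder _ _ a (b^~ s) (gq s) Q (3 * K ^+ 2)).
    by move=> k; exact: da.
  by move=> r; exact: Gam_remainder.
(* The quantity would be conserved if the force were computed from the partial sum. The actual force
   uses the full series [Phi], and [dD] is the work of the mismatch. *)
pose D (s : R) := energy lam1 a b (index_iota 0 Q) s + 2 * Gam L K a Q s.
pose dD (s : R) := 2 * \sum_(0 <= k < Q) (- cub k s) * b k s + 2 * \sum_(0 <= k < Q) gq s k * b k s.
have dDle (s : R) : 0 < s < t -> dD s <= ep.
  move=> /andP[s0 st]; have s0' := ltW s0.
  have -> : dD s = 2 * \sum_(0 <= k < Q) (gq s k - cub k s) * b k s.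
    rewrite /dD -mulrDr -big_split/=; congr (_ * _); apply: eq_bigr => k _.
    by rewrite mulrBl mulNr addrC.
  apply: le_trans (sum_prod_le _ _ _ eta0) _.
  have sI : 0 <= s <= t by rewrite s0' ltW.
  have hk : \sum_(0 <= k < Q) b k s ^+ 2 <= A.
    exact: le_trans (energy_kinetic_le a b _ s (lam_ge0 L0)) (hA s sI Q).
  have hp M : \sum_(0 <= k < M) lam k * a k s ^+ 2 <= A.
    exact: le_trans (energy_potential_le lam a b _ s) (hA s sI M).
  have hc : \sum_(0 <= k < Q) (gq s k - cub k s) ^+ 2 <= 9 * K ^+ 4 * (L * (kap * A / Q.+1%:R)).
    apply: coef_cubic_le => //.
    - by apply: measurable_continuous; exact: tsum_continuous.
    - by apply: Phi_meas => //; exact: fe.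
    - by move=> x; rewrite -sqrrN opprB; exact: Phi_sub_tsum.
  have h1 := ler_wpM2l (ltW eta0) hk.
  have ei0 : 0 <= eta^-1 by rewrite invr_ge0 ltW.
  have h2 := ler_wpM2l ei0 hc.
  have h3 := le_trans h1 etaA.
  have h4 : eta^-1 * (9 * K ^+ 4 * (L * (kap * A / Q.+1%:R))) <= ep / 2.
    apply: le_trans hQ; apply: eq_ler.
    by move: (Q.+1%:R^-1) (eta^-1) => p q; ring.
  have h5 := le_trans h2 h4.
  by have := lerD h3 h5; rewrite -splitr.
have hD : D t - D 0 <= ep * (t - 0).
  apply: (@growth_le _ D dD ep 0 t (lexx _) t0) => //.
    by apply: continuous_add => //; exact: continuous_scale.
  move=> s s0; apply: is_derive_add; first exact: dE.
  exact: (is_derive_scale 2 (dG s s0)).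
have ept : ep * (t - 0) <= e.
  by rewrite subr0 /ep mulrAC ler_pdivrMr// ler_pM2l// lerDl.
have D0 : D 0 <= E0 + L / 2 * (kap * E0) ^+ 2.
  apply: lerD; last exact: Gam0_le.
  apply: le_trans (ini Q); apply: ler_sum => k _; rewrite lerD2l ler_wpM2r ?sqr_ge0//.
  by rewrite lerBlDr lerDl.
have ND : energy lam1 a b (index_iota 0 N) t <= D t.
  apply: (@le_trans _ _ (energy lam1 a b (index_iota 0 Q) t)).
    apply: le_sum_widen => // k; rewrite addr_ge0 ?sqr_ge0// mulr_ge0 ?sqr_ge0//.
  by rewrite lerDl mulr_ge0// Gam_ge0.
by move: ND hD ept D0; lra.
Qed.

End EnergyBound.

(** * Removing the truncation *)

Section Modes.
Context {R : realType}.
Set Implicit Arguments.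
Unset Strict Implicit.
Variable L : R.
Hypothesis L0 : 0 < L.
Hypothesis L2pi : 1 < 2 * pi / L.
Implicit Types (x t : R) (N M k : nat) (c : nat -> R).
Notation coef := (coef L).
Notation lam := (lam L).
Notation kap := (kap L).
Notation Phi := (Phi L).

Definition cubic_source c k : R := c k - coef (fun x => Phi c x ^+ 3) k.

Theorem modes_exist (a0 b0 : nat -> R) (E0 : R) :
  (forall N, \sum_(0 <= k < N) (b0 k ^+ 2 + lam k * a0 k ^+ 2) <= E0) ->
  exists a b, [/\ oscillators lam a b (fun k t => cubic_source (a^~ t) k),
    strongly_continuous lam a b,
    (forall k, a k 0 = a0 k /\ b k 0 = b0 k) &
    exists S, forall t, 0 <= t -> forall N, energy lam a b (index_iota 0 N) t <= S].
Proof.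
move=> ini.
pose w2 := (2 * pi / L) ^+ 2.
have w21 : 1 < w2.
  rewrite -[ltLHS](expr1n _ 2) ltr_pXn2r ?nnegrE//.
  by rewrite ltW// (lt_trans _ L2pi).
have w20 : 0 < w2 by exact: lt_trans w21.
(* Since [lam k >= w2], one has [th * lam k <= lam k - 1]: a bound [F0] on the reduced energy gives
   the bound [F0 / th] on the full one. *)
pose th := 1 - w2^-1.
have th0 : 0 < th by rewrite subr_gt0 invf_lt1.
have th1 : th <= 1 by rewrite lerBlDr lerDl invr_ge0 ltW.
pose F0 := E0 + L / 2 * (kap * E0) ^+ 2.
pose S := F0 / th.
have E00 : 0 <= E0 by have := ini 0%N; rewrite big_geq.
have F00 : 0 <= F0 by rewrite addr_ge0// mulr_ge0 ?sqr_ge0// divr_ge0// ltW.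
have S0 : 0 <= S by rewrite divr_ge0// ltW.
have kS0 : 0 <= kap * S by rewrite mulr_ge0// ltW// kap_gt0.
(* [S] does not involve [K], so the choice is not circular; the added 1 ensures [kap * S <= K ^+ 2],
   hence [|Phi| <= K] along the solution. *)
pose K := kap * S + 1.
have K0 : 0 <= K by rewrite addr_ge0.
have [[a b] [osc ab0 [sc hB]]] := oscillators_exist (lam_gt0 L0)
  (source_lipschitz_cst_ge0 L0 K0) (source_lipschitz L0 K0) (source0 L K0) ini.
rewrite /= in osc ab0 sc hB.
have LL0 : 0 <= 4 * (source_lipschitz_cst L K + 1).
  by rewrite mulr_ge0// addr_ge0// source_lipschitz_cst_ge0.
have iniE N : energy lam a b (index_iota 0 N) 0 <= E0.
  apply: le_trans (ini N); apply: eq_ler.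
  by apply: eq_bigr => k _; have [-> ->] := ab0 k.
have hF t N : 0 <= t -> energy (fun k => lam k - 1) a b (index_iota 0 N) t <= F0.
  by move=> t0; exact: (energy_bound L0 L2pi K0 LL0 osc hB iniE N t0).
have hS t : 0 <= t -> forall N, energy lam a b (index_iota 0 N) t <= S.
  move=> t0 N; rewrite ler_pdivlMr// mulrC; apply: le_trans (hF t N t0).
  rewrite /energy mulr_sumr; apply: ler_sum => k _; rewrite mulrDr; apply: lerD.
    by rewrite ler_piMl ?sqr_ge0.
  rewrite mulrA ler_wpM2r ?sqr_ge0// /th mulrBl mul1r lerD2l lerN2.
  rewrite mulrC ler_pdivlMr// mul1r.
  exact: lam_ge.
have hP t x : 0 <= t -> `|Phi (a^~ t) x| <= K.
  move=> t0; rewrite -(@ler_pXn2r _ 2)// ?nnegrE// real_normK ?num_real//.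
  apply: (@le_trans _ _ (kap * S)).
    apply: Phi_bound => // M; exact: le_trans (energy_potential_le lam a b _ t) (hS t t0 M).
  rewrite /K; move: (kap * S) kS0 => y y0; rewrite expr2; nra.
exists a, b; split => //; last by exists S.
have [ca cb da db] := osc; split=> // k t t0.
apply: (is_derive_congr (db k t t0)) => //; congr (_ + (_ - _)).
by congr (coef _ k); apply/funext => x; rewrite cubic_id// hP// ltW.
Qed.

End Modes.

(** * Weak derivatives in time *)

Section TimeDerivative.
Context {R : realType}.
Notation mu := (@lebesgue_measure R).
Set Implicit Arguments.
Unset Strict Implicit.
Implicit Types (U V Z f F th : R -> R) (s t a b : R).

Lemma Rintegral_support f a b : 0 < a -> (forall t, ~ (a <= t <= b) -> f t = 0) ->
  \int[mu]_(t in `]0, +oo[) f t = \int[mu]_(t in `[a, b]) f t.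
Proof.
move=> a0 f0; rewrite Rintegral_mkcond [RHS]Rintegral_mkcond; congr (Rintegral _ _ _).
apply/funext => t; rewrite !patchE /=.
have [tab|tab] := pselect (a <= t <= b).
  by rewrite !mem_set//= ?in_itv//= andbT (lt_le_trans a0)//; case/andP: tab.
by rewrite f0//; do 2 case: ifP.
Qed.

Lemma Rintegral_derive_pos f F a b : 0 < a -> a < b -> continuous (fun t => f `|t|) ->
  (forall t, 0 < t -> is_derive t 1 F (f t)) ->
  \int[mu]_(t in `[a, b]) f t = F b - F a.
Proof.
move=> a0 ab cf dF; have b0 : 0 < b by exact: lt_trans ab.
have cF t : 0 < t -> {for t, continuous F} by move=> /dF; exact: is_derive_continuous.
rewrite /Rintegral (@continuous_FTC2 R f F a b ab)//.
- exact: continuous_halfline_within (ltW a0) cf.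
- split.
  + by move=> t; rewrite in_itv/= => /andP[t0 _]; case: (dF t (lt_trans a0 t0)).
  + by apply: cvg_at_right_filter; exact: cF.
  + by apply: cvg_at_left_filter; exact: cF.
- by move=> t; rewrite in_itv/= => /andP[t0 _]; rewrite derive1E; case: (dF t (lt_trans a0 t0)).
Qed.

Lemma time_test_derive0 th a b : (forall t, ~ (a <= t <= b) -> th t = 0) ->
  forall t, ~ (a <= t <= b) -> derive1 th t = 0.
Proof.
move=> h t tab; rewrite derive1E.
have -> : 'D_1 th t = 'D_1 (cst 0 : R -> R) t; last exact: derive_cst.
apply: near_eq_derive.
have [ta|ta] := ltP t a.
  near=> s; apply: h => /andP[sa _].
  by have : s < a; [near: s; exact: lt_nbhsl|rewrite ltNge sa].
have tb : b < t by rewrite ltNge; apply/negP => tb; apply: tab; rewrite ta.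
near=> s; apply: h => /andP[_ sb].
by have : b < s; [near: s; exact: lt_nbhsr|rewrite ltNge sb].
Unshelve. all: by end_near. Qed.

Lemma time_test_is_derive th : is_C1 th -> forall t, is_derive t 1 th (derive1 th t).
Proof. by move=> [dth _] t; rewrite derive1E; exact/derivableP/dth. Qed.

Lemma is_C1_continuous th : is_C1 th -> continuous th.
Proof. by move=> h t; exact: is_derive_continuous (time_test_is_derive h t). Qed.

Lemma continuous_abs f : continuous f -> continuous (fun t : R => f `|t|).
Proof.
move=> cf t; apply: (@continuous_comp _ _ _ (fun t : R => `|t|) f); last exact: cf.
exact: norm_continuous.
Qed.

(** Integration by parts against the test function, whose support is compact in the open
    half-line. *)
Lemma C1_weak_dt U V : continuous (fun t : R => U `|t|) -> continuous (fun t : R => V `|t|) ->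
  (forall t, 0 < t -> is_derive t 1 U (V t)) -> is_weak_dt U V.
Proof.
move=> cU cV dU th [c1 [a [b0 [a0 th0]]]].
(* The support is strictly enlarged so that [th] vanishes at both new ends; the maximum covers the
   case where [a, b0] is empty. *)
pose a' := a / 2; pose b := Num.max b0 a + 1.
have a'0 : 0 < a' by rewrite divr_gt0.
have a'a : a' < a by rewrite /a'; lra.
have b0b : b0 < b by rewrite /b; apply: (@le_lt_trans _ _ (Num.max b0 a)); rewrite ?le_max ?lexx ?ltrDl.
have ab : a < b by rewrite /b; apply: (@le_lt_trans _ _ (Num.max b0 a)); rewrite ?le_max ?lexx ?orbT ?ltrDl.
have th0' t : ~ (a' <= t <= b) -> th t = 0.
  move=> h; apply: th0 => /andP[h1 h2]; apply: h.
  by rewrite (le_trans (ltW a'a) h1) (le_trans h2 (ltW b0b)).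
have dth0 := time_test_derive0 th0'.
rewrite (@Rintegral_support _ a' b)//; last by move=> t /dth0 ->; rewrite mulr0.
rewrite (@Rintegral_support (fun t => V t * th t) a' b)//; last first.
  by move=> t /th0' ->; rewrite mulr0.
have cth := continuous_abs (is_C1_continuous c1).
have cdth := continuous_abs c1.2.
have c1' := continuous_mul cU cdth; have c2' := continuous_mul cV cth.
have ii f : continuous (fun t : R => f `|t|) -> mu.-integrable `[a', b] (EFin \o f).
  move=> cf; apply: continuous_compact_integrable; first exact: segment_compact.
  exact: continuous_halfline_within (ltW a'0) cf.
apply/eqP; rewrite -addr_eq0 -RintegralD//; [|exact: ii|exact: ii].
have dUth t : 0 < t -> is_derive t 1 (fun t => U t * th t) (U t * derive1 th t + V t * th t).
  move=> t0; apply: (is_derive_congr (is_derive_mul (dU t t0) (time_test_is_derive c1 t))) => //.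
  by rewrite [th t * _]mulrC.
have := Rintegral_derive_pos a'0 (lt_trans a'a ab) (continuous_add c1' c2') dUth.
move=> ->; rewrite !th0 ?mulr0 ?subrr//.
- by move=> /andP[]; rewrite leNgt a'a.
- by move=> /andP[_]; rewrite leNgt b0b.
Qed.

(** The primitive is nondecreasing and takes the same value at [a] and [b], so it is constant
    between them. *)
Lemma continuous_integral0 f a b : 0 <= a -> continuous f -> (forall t, 0 <= f t) ->
  0 < a -> a < b -> \int[mu]_(t in `[a, b]) f t = 0 -> forall t, a < t < b -> f t = 0.
Proof.
move=> _ cf f0 a0 ab i0 t /andP[at_ tb].
have [F [_ dF]] := primitive_halfline cf.
have cF : continuous (fun t : R => F `|t|).
  move=> s; apply: (@continuous_comp _ _ _ (fun s : R => `|s|) F); first exact: norm_continuous.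
  exact: is_derive_continuous (dF _ (normr_ge0 s)).
have dF' s : 0 < s -> is_derive s 1 F (f s) by move=> /ltW; exact: dF.
have Fab : F b - F a = 0.
  by rewrite -(@Rintegral_derive_pos f F a b a0 ab _ dF')//; exact: continuous_abs.
have mono s r : 0 <= s -> s <= r -> F s <= F r.
  move=> s0 sr; have := @growth_le _ (fun y => -1 * F y) (fun y => -1 * f y) 0 s r s0 sr.
  rewrite mul0r !mulN1r => h; have {h} : - F r - - F s <= 0.
    apply: h => [|x x0|x _]; first exact: continuous_scale.
      by apply: is_derive_scale; exact: dF'.
    by rewrite mulN1r oppr_le0.
  by lra.
have t0 := lt_trans a0 at_.
have Fc s : a < s < b -> F s = F a.
  move=> /andP[as_ sb]; have := mono a s (ltW a0) (ltW as_).
  have := mono s b (ltW (lt_trans a0 as_)) (ltW sb); move: Fab; lra.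
have [_ <-] := dF' t t0.
have -> : 'D_1 F t = 'D_1 (cst (F a) : R -> R) t; last exact: derive_cst.
apply: near_eq_derive.
have : \forall z \near t, z \in `]a, b[ by apply: near_in_itvoo; rewrite in_itv/= at_.
by apply: filterS => z; rewrite in_itv/= => /Fc.
Qed.

(* The du Bois-Reymond lemma, with the test function whose derivative is
   [(Z - m) * bump] where [m] makes the integral of the latter vanish. *)
Lemma weak_dt0_const Z : continuous (fun t : R => Z `|t|) -> is_weak_dt Z (fun=> 0) ->
  forall a b, 0 < a -> a < b -> exists m, forall t, a < t < b -> Z t = m.
Proof.
move=> cZ wZ a b a0 ab; have b0 := lt_trans a0 ab.
pose bm t := ((t - a) * (b - t) + `|(t - a) * (b - t)|) / 2.
(* The bump is the positive part of (t - a) (b - t), continuous and positive exactly on ]a, b[. *)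
have bm_in t : a <= t <= b -> bm t = (t - a) * (b - t).
  move=> /andP[ta tb]; rewrite /bm ger0_norm; last by rewrite mulr_ge0 ?subr_ge0.
  by field.
have bm_out t : ~ (a < t < b) -> bm t = 0.
  move=> h; rewrite /bm ler0_norm ?addrN ?mul0r//.
  have [ta|ta] := leP t a.
    by rewrite mulr_le0_ge0// ?subr_le0// subr_ge0 (le_trans ta (ltW ab)).
  have bt : b <= t by rewrite leNgt; apply/negP => tb; apply: h; rewrite ta tb.
  by rewrite mulr_ge0_le0 ?subr_ge0 ?subr_le0// ltW.
have bm_ge0 t : 0 <= bm t.
  have [tab|/negP tab] := boolP (a < t < b); last by rewrite bm_out.
  by case/andP: tab => ta tb; rewrite bm_in ?mulr_ge0 ?subr_ge0 ?ltW.
have cid_ : continuous (fun t : R => t) by move=> t; exact: cvg_id.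
have cc (r : R) : continuous (fun _ : R => r) by exact: cst_continuous.
have cp : continuous (fun t => (t - a) * (b - t)).
  by apply: continuous_mul; apply: continuous_sub.
have cbm : continuous bm.
  apply: continuous_mul => //; apply: continuous_add => // t.
  apply: (@continuous_comp _ _ _ (fun t => (t - a) * (b - t)) (fun x : R => `|x|)).
    exact: cp.
  exact: norm_continuous.
have ii f : continuous f -> mu.-integrable `[a, b] (EFin \o f).
  move=> cf; apply: continuous_compact_integrable; first exact: segment_compact.
  exact: continuous_subspaceT.
pose B := \int[mu]_(t in `[a, b]) bm t.
have B0 : 0 < B.
  rewrite lt_neqAle eq_sym Rintegral_ge0 ?andbT//; apply/eqP => B0.
  have mid : a < (a + b) / 2 < b by apply/andP; split; lra.
  have := continuous_integral0 (ltW a0) cbm bm_ge0 a0 ab B0 mid.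
  have mid' : a <= (a + b) / 2 <= b by apply/andP; split; lra.
  rewrite bm_in// => /eqP; rewrite mulf_eq0 => /orP[] /eqP; lra.
(* This extension is continuous on the whole line and agrees with [Z] on [a, b]. *)
pose Z' t := Z `|t|.
pose m := (\int[mu]_(t in `[a, b]) (Z' t * bm t)) / B.
pose psi t := (Z' t - m) * bm t.
have cZb : continuous (fun t => Z' t * bm t) by exact: continuous_mul.
have cpsi : continuous psi.
  by apply: continuous_mul => //; apply: continuous_sub.
have ipsi : \int[mu]_(t in `[a, b]) psi t = 0.
  under eq_Rintegral do rewrite /psi mulrBl.
  rewrite RintegralB//; [|exact: ii|by apply: ii; exact: continuous_scale].
  rewrite RintegralZl//; last exact: ii.
  by rewrite -/B /m divfK ?subrr// gt_eqF.
have psi_out t : ~ (a < t < b) -> psi t = 0 by move=> /bm_out h; rewrite /psi h mulr0.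
have [H [H0 dH]] := primitive_halfline cpsi.
have cH : continuous (fun t : R => H `|t|).
  move=> s; apply: (@continuous_comp _ _ _ (fun s : R => `|s|) H); first exact: norm_continuous.
  exact: is_derive_continuous (dH _ (normr_ge0 s)).
have dH' s : 0 < s -> is_derive s 1 H (psi s) by move=> /ltW; exact: dH.
have Ha t : 0 <= t <= a -> H t = 0.
  move=> /andP[t0 ta].
  have := @growth_abs_le _ H psi 0 0 t (lexx 0) t0 cH dH' _.
  rewrite H0 subr0 mul0r normr_le0 => h; apply/eqP/h => x /andP[_ xt].
  by rewrite psi_out ?normr0// => /andP[]; rewrite ltNge (le_trans (ltW xt) ta).
have Hb : H b = 0.
  have := @Rintegral_derive_pos psi H a b a0 ab (continuous_abs cpsi) dH'.
  have Haa : H a = 0 by apply: Ha; rewrite lexx (ltW a0).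
  by rewrite ipsi Haa subr0.
have Hbt t : b <= t -> H t = 0.
  move=> bt; have := @growth_abs_le _ H psi 0 b t (ltW b0) bt cH dH' _.
  rewrite Hb subr0 mul0r normr_le0 => h; apply/eqP/h => x /andP[bx _].
  by rewrite psi_out ?normr0// => /andP[_]; rewrite ltNge ltW.
(* [H] is a primitive of [psi] on the half-line only, and vanishes on [0, a]; extending it by zero
   gives a C^1 function on the line. *)
pose th t := if 0 < t then H t else 0.
have th_out t : ~ (a <= t <= b) -> th t = 0.
  rewrite /th => h; case: ifP => // t0.
  have [ta|ta] := leP t a; first by rewrite Ha// ltW.
  by apply: Hbt; rewrite leNgt; apply/negP => tb; apply: h; rewrite !ltW.
have dth t : is_derive t 1 th (psi t).
  have [t0|t0] := ltP 0 t.
    apply: near_eq_is_derive (dH' t t0).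
    near=> s; rewrite /th ifT//; near: s; exact: lt_nbhsr.
  rewrite psi_out; last by move=> /andP[] /(lt_trans a0); rewrite ltNge t0.
  apply: near_eq_is_derive (is_derive_cst 0 t 1).
  near=> s; rewrite th_out// => /andP[as_ _].
  have : s < a by near: s; apply: lt_nbhsl; exact: le_lt_trans a0.
  by rewrite ltNge as_.
have dthE : derive1 th = psi.
  by apply/funext => t; rewrite derive1E; case: (dth t).
have tt : time_test th.
  split; last by exists a, b; split.
  split; first by move=> t; case: (dth t).
  by rewrite dthE.
have := wZ th tt; rewrite dthE.
under [X in _ = - X]eq_Rintegral do rewrite mul0r.
rewrite Rintegral_cst// mul0r oppr0.
rewrite (@Rintegral_support _ a b)//; last first.
  move=> t h; rewrite psi_out ?mulr0// => /andP[h1 h2]; apply: h; by rewrite !ltW.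
move=> iZ.
have iZ' : \int[mu]_(t in `[a, b]) (Z' t * psi t) = 0.
  rewrite -iZ; apply: eq_Rintegral => t; rewrite inE/= in_itv/= => /andP[ta _].
  by rewrite /Z' ger0_norm// (le_trans (ltW a0)).
have cZp : continuous (fun t => Z' t * psi t) by exact: continuous_mul.
(* The weighted square integrates to the integral of [Z' * psi], which the weak equation
   annihilates, minus [m] times the integral of [psi], which is zero by the choice of [m]. *)
have sq0 : \int[mu]_(t in `[a, b]) ((Z' t - m) ^+ 2 * bm t) = 0.
  have -> : \int[mu]_(t in `[a, b]) ((Z' t - m) ^+ 2 * bm t) =
     \int[mu]_(t in `[a, b]) (Z' t * psi t - m * psi t).
    by apply: eq_Rintegral => t _; rewrite /psi; ring.
  rewrite RintegralB//; [|exact: ii|by apply: ii; exact: continuous_scale].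
  by rewrite RintegralZl ?ipsi ?iZ' ?mulr0 ?subrr//; exact: ii.
exists m => t tab; have /andP[at_ tb] := tab.
have csq : continuous (fun t => (Z' t - m) ^+ 2 * bm t).
  by apply: continuous_mul => //; apply: continuous_sqr; exact: continuous_sub.
have sq_ge0 s : 0 <= (Z' s - m) ^+ 2 * bm s by rewrite mulr_ge0 ?sqr_ge0.
have := continuous_integral0 (ltW a0) csq sq_ge0 a0 ab sq0 tab.
move=> /eqP; rewrite mulf_eq0 => /orP[|].
  rewrite sqrf_eq0 subr_eq0 /Z' ger0_norm; last exact: ltW (lt_trans a0 at_).
  by move=> /eqP.
by rewrite bm_in ?ltW// mulf_eq0 !subr_eq0 (gt_eqF at_) (gt_eqF tb).
Unshelve. all: by end_near. Qed.

(** Subtracting a primitive of [V] leaves a function with zero weak derivative, which is locally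
    constant. *)
Lemma weak_dt_is_derive U V : continuous (fun t : R => U `|t|) ->
  continuous (fun t : R => V `|t|) -> is_weak_dt U V ->
  forall t, 0 < t -> is_derive t 1 U (V t).
Proof.
move=> cU cV wUV t t0.
have [H [H0 dH]] := primitive_halfline cV.
have cH : continuous (fun t : R => H `|t|).
  move=> s; apply: (@continuous_comp _ _ _ (fun s : R => `|s|) H); first exact: norm_continuous.
  exact: is_derive_continuous (dH _ (normr_ge0 s)).
have dH' s : 0 < s -> is_derive s 1 H (V s).
  by move=> s0; have := dH s (ltW s0); rewrite ger0_norm// ltW.
have wH := C1_weak_dt cH cV dH'.
pose Z s := U s - H s.
have cZ : continuous (fun t : R => Z `|t|) by exact: continuous_sub.
have wZ : is_weak_dt Z (fun=> 0).
  move=> th tth; have := wUV th tth; have := wH th tth.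
  have [c1 [a [b [a0 th0]]]] := tth.
  have dth0 := time_test_derive0 th0.
  have cdth := continuous_abs c1.2.
  have ii f : continuous (fun t : R => f `|t|) -> mu.-integrable `[a, b] (EFin \o f).
    move=> cf; apply: continuous_compact_integrable; first exact: segment_compact.
    exact: continuous_halfline_within (ltW a0) cf.
  rewrite (@Rintegral_support (fun t => H t * derive1 th t) a b)//; last by move=> s /dth0 ->; rewrite mulr0.
  rewrite (@Rintegral_support (fun t => U t * derive1 th t) a b)//; last by move=> s /dth0 ->; rewrite mulr0.
  rewrite (@Rintegral_support (fun t => Z t * derive1 th t) a b)//; last by move=> s /dth0 ->; rewrite mulr0.
  move=> h1 h2; under [X in _ = - X]eq_Rintegral do rewrite mul0r.
  rewrite Rintegral_cst// mul0r oppr0.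
  under eq_Rintegral do rewrite /Z mulrBl.
  rewrite RintegralB//; last 2 first.
  - by apply: (ii (fun t => U t * derive1 th t)); exact: continuous_mul.
  - by apply: (ii (fun t => H t * derive1 th t)); exact: continuous_mul.
  by rewrite h1 h2 subrr.
have t2 : 0 < t / 2 by rewrite divr_gt0.
have t2t : t / 2 < t + 1 by lra.
have [m hm] := weak_dt0_const cZ wZ t2 t2t.
have dZ : is_derive t 1 Z 0.
  apply: near_eq_is_derive (is_derive_cst m t 1).
  have : \forall z \near t, z \in `]t / 2, t + 1[.
    by apply: near_in_itvoo; rewrite in_itv/=; apply/andP; split; lra.
  by apply: filterS => z; rewrite in_itv/= => /hm.
apply: (is_derive_congr (is_derive_add dZ (dH' t t0))); last by rewrite add0r.
by move=> s; rewrite /Z subrK.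
Qed.

End TimeDerivative.

(** * The space Y and energy trajectories *)

Section Trajectories.
Context {R : realType}.
Set Implicit Arguments.
Unset Strict Implicit.
Variable L : R.
Hypothesis L0 : 0 < L.
Implicit Types (f g h p q : R -> R) (x t : R) (N M n k : nat) (c : nat -> R).
Notation coef := (coef L).
Notation lam := (lam L).
Notation kap := (kap L).
Notation Phi := (Phi L).

Let w : R := 2 * pi / L.

Lemma sum_le_weighted (W p q y z : R) : 0 <= W -> 0 <= p -> 0 <= q ->
  y <= q -> z <= W * p -> y + z <= (W + 1) * (p + q).
Proof.
move=> W0 p0 q0 yq zp; rewrite mulrDl mulrDr mul1r.
by have := mulr_ge0 W0 q0; lra.
Qed.

Lemma L2_per_lin (a : R) f g : L2_per L f -> L2_per L g ->
  L2_per L (fun x => a * f x + g x).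
Proof.
move=> [mf pf hf] [mg pg hg].
have [h1 h2] : sqi L (fun x => a * f x + g x) by apply: sqi_add => //; exact: sqi_scale.
by split=> // x; rewrite pf pg.
Qed.

Lemma mean_lin (a : R) f g : sqi L f -> sqi L g ->
  mean L (fun x => a * f x + g x) = a * mean L f + mean L g.
Proof.
move=> hf hg; have s1 : sqi L (fun=> (1 : R)) by exact: sqi_cst.
by rewrite !meanE pairingDl ?pairingZl//; exact: sqi_scale.
Qed.

Lemma coef_lin (a : R) f g k : sqi L f -> sqi L g ->
  coef (fun x => a * f x + g x) k = a * coef f k + coef g k.
Proof. by move=> hf hg; rewrite coefD// ?coefZ//; exact: sqi_scale. Qed.

Lemma Hs1_sqi f : Hs_per_m L 1 f -> sqi L f.
Proof. by move=> /(Hs1P L0)[[h1 h2 h3]]. Qed.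

Lemma Hs0_sqi f : Hs_per_m L 0 f -> sqi L f.
Proof. by move=> /(Hs0P L0)[[h1 h2 h3]]. Qed.

Lemma Hs1_lin (a : R) f g : Hs_per_m L 1 f -> Hs_per_m L 1 g ->
  Hs_per_m L 1 (fun x => a * f x + g x).
Proof.
move=> hf hg; have sf := Hs1_sqi hf; have sg := Hs1_sqi hg.
have [h1 h2 [S hS]] := (Hs1P L0 f).1 hf; have [h3 h4 [S' hS']] := (Hs1P L0 g).1 hg.
apply/(Hs1P L0); split; first exact: L2_per_lin.
  by rewrite mean_lin// h2 h4 mulr0 addr0.
exists (2 * (a ^+ 2 * S + S')) => N.
apply: (@le_trans _ _ (2 * (a ^+ 2 * \sum_(0 <= k < N) lam k * coef f k ^+ 2 +
   \sum_(0 <= k < N) lam k * coef g k ^+ 2))); last first.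
  by rewrite ler_pM2l// lerD// ler_wpM2l// sqr_ge0.
rewrite [X in X + _]mulr_sumr -big_split/= mulr_sumr; apply: ler_sum => k _.
rewrite coef_lin//.
have := sqr_sub_le (a * coef f k) (- coef g k); rewrite opprK sqrrN => h.
have := ler_wpM2l (lam_ge0 L0 k) h; move/le_trans; apply.
by apply: eq_ler; ring.
Qed.

Lemma Hs1_sub f g : Hs_per_m L 1 f -> Hs_per_m L 1 g -> Hs_per_m L 1 (fun x => f x - g x).
Proof.
move=> hf hg; have := Hs1_lin (-1) hg hf.
by under [X in Hs_per_m L 1 X -> _]eq_fun do rewrite mulN1r addrC.
Qed.

Lemma Hs0_sub f g : Hs_per_m L 0 f -> Hs_per_m L 0 g -> Hs_per_m L 0 (fun x => f x - g x).
Proof.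
move=> hf hg; have sf := Hs0_sqi hf; have sg := Hs0_sqi hg.
have [h1 h2] := (Hs0P L0 f).1 hf; have [h3 h4] := (Hs0P L0 g).1 hg.
apply/(Hs0P L0); split; last by rewrite meanE pairingBl -?meanE ?h2 ?h4 ?subr0//;
  exact: sqi_cst.
have := L2_per_lin (-1) h3 h1.
by under [X in L2_per L X -> _]eq_fun do rewrite mulN1r addrC.
Qed.

Lemma Hs1_Hs0 f : Hs_per_m L 1 f -> Hs_per_m L 0 f.
Proof. by move=> /(Hs1P L0)[h1 h2 _]; apply/(Hs0P L0). Qed.

Lemma tb_Hs1 k : Hs_per_m L 1 (tb L k).
Proof.
apply/(Hs1P L0); split; [|exact: mean_tb|].
  by have [h1 h2] := sqi_tb L k; split => //; exact: tb_periodic.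
exists (\sum_(0 <= j < k.+1) lam j) => N.
apply: (@le_trans _ _ (\sum_(0 <= j < maxn N k.+1) lam j * coef (tb L k) j ^+ 2)).
  apply: le_sum_widen => [j|]; last exact: leq_maxl.
  by rewrite mulr_ge0 ?sqr_ge0 ?(lam_ge0 L0).
have E j : coef (tb L k) j = (j == k)%:R.
  by rewrite /coef tb_orthonormal// eq_sym.
rewrite (big_cat_nat (n := k.+1))//=; last exact: leq_maxr.
have -> : \sum_(k.+1 <= j < maxn N k.+1) lam j * coef (tb L k) j ^+ 2 = 0.
  rewrite big_seq big1// => j; rewrite mem_index_iota => kj.
  by rewrite E gtn_eqF ?expr0n/= ?mulr0//; case/andP: kj.
rewrite addr0.
apply: ler_sum => j _; rewrite E ler_piMr ?(lam_ge0 L0)//.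
by case: eqP => _ /=; rewrite ?expr1n ?expr0n.
Qed.

Notation modes u := (fun k t => coef (u t) k).

Lemma diff_energy (u v : R -> R -> R) s t N : Hs_per_m L 1 (u s) -> Hs_per_m L 1 (u t) ->
  Hs_per_m L 0 (v s) -> Hs_per_m L 0 (v t) ->
  energy lam (fun k r => coef (u r) k - coef (u t) k) (fun k r => coef (v r) k - coef (v t) k)
    (index_iota 0 N) s =
  \sum_(0 <= k < N) (coef (fun x => v s x - v t x) k ^+ 2
    + lam k * coef (fun x => u s x - u t x) k ^+ 2).
Proof.
move=> us ut vs vt; apply: eq_bigr => k _.
by rewrite !coefB//; [exact: Hs1_sqi|exact: Hs1_sqi|exact: Hs0_sqi|exact: Hs0_sqi].
Qed.

(** The norm of Y and the energy norm differ by the constants comparing [hweight 1] with [lam]. This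
    direction serves existence, the converse below uniqueness. *)
Lemma strongly_continuous_Y (u v : R -> R -> R) :
  (forall t, 0 <= t -> Y_space L (u t, v t)) ->
  strongly_continuous lam (modes u) (modes v) -> continuous_Y L u v.
Proof.
move=> hY sc; split=> // t0 t00.
apply/cvgrPdist_le => e e0.
pose C := 2 / w ^+ 2 + 1.
have C0 : 0 < C by rewrite ltr_wpDl// divr_ge0// sqr_ge0.
have e1 : 0 < e ^+ 2 / C by rewrite divr_gt0// exprn_gt0.
have [d d0 hd] := sc t0 t00 _ e1.
exists d => // t /= td t_0; rewrite sub0r normrN ger0_norm ?sqrtr_ge0//.
have [us vs] := hY t t_0; have [ut vt] := hY t0 t00.
rewrite /= in us vs ut vt.
have hN N : \sum_(0 <= k < N) (coef (fun x => v t x - v t0 x) k ^+ 2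
    + lam k * coef (fun x => u t x - u t0 x) k ^+ 2) <= e ^+ 2 / C.
  by rewrite -(diff_energy _ us ut vs vt); apply: hd => //; rewrite distrC.
have d1 := Hs1_sub us ut; have d2 := Hs0_sub vs vt.
have [_ m1 _] := (Hs1P L0 _).1 d1; have [_ m2] := (Hs0P L0 _).1 d2.
have h1 : Hs_norm L 1 (u t \- u t0) ^+ 2 <= 2 / w ^+ 2 * (e ^+ 2 / C).
  apply: (Hs_norm_le L0 (Hs1_sqi d1) m1) => N; apply: hweight_sum_le => // M.
  by apply: le_trans (hN M); apply: ler_sum => k _; rewrite lerDr sqr_ge0.
have h2 : Hs_norm L 0 (v t \- v t0) ^+ 2 <= e ^+ 2 / C.
  apply: (Hs_norm_le L0 (Hs0_sqi d2) m2) => N; under eq_bigr do rewrite hweight0 mul1r.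
  apply: le_trans (hN N); apply: ler_sum => k _.
  by rewrite lerDl mulr_ge0 ?(lam_ge0 L0) ?sqr_ge0.
rewrite /Y_norm -[leRHS]ger0_norm ?(ltW e0)// -sqrtr_sqr ler_sqrt ?sqr_ge0//=.
apply: (le_trans (lerD h1 h2)).
have -> : 2 / w ^+ 2 * (e ^+ 2 / C) + e ^+ 2 / C = C * (e ^+ 2 / C).
  by move: (e ^+ 2 / C) => y; rewrite [RHS]mulrDl mul1r.
by rewrite mulrC divfK// gt_eqF.
Qed.

Lemma Y_strongly_continuous (u v : R -> R -> R) :
  continuous_Y L u v -> strongly_continuous lam (modes u) (modes v).
Proof.
move=> [hY cY] t0 t00 e e0.
pose C := w ^+ 2 + 1.
have C0 : 0 < C by rewrite ltr_wpDl// sqr_ge0.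
have e1 : 0 < e / C by rewrite divr_gt0.
have s0 : 0 < Num.sqrt (e / C) by rewrite sqrtr_gt0.
have [d /= d0 hd] := (@cvgrPdist_le _ _ _ _ _ _ _).1 (cY t0 t00) _ s0.
exists d => // t t_0 td N.
have [us vs] := hY t t_0; have [ut vt] := hY t0 t00.
rewrite /= in us vs ut vt; rewrite (diff_energy _ us ut vs vt).
have := hd t; rewrite /= distrC => /(_ td t_0).
rewrite sub0r normrN ger0_norm ?sqrtr_ge0// /Y_norm ler_sqrt ?(ltW e1)//= => h.
have d1 := Hs1_sub us ut; have d2 := Hs0_sub vs vt.
have h1 := Hs1_energy L0 N d1.
have h2 : \sum_(0 <= k < N) coef (fun x => v t x - v t0 x) k ^+ 2 <= Hs_norm L 0 (v t \- v t0) ^+ 2.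
  apply: le_trans (Hs_norm_ge L0 N d2); apply: ler_sum => k _.
  by rewrite hweight0 mul1r.
rewrite big_split/=.
apply: (@le_trans _ _ (C * (Hs_norm L 1 (u t \- u t0) ^+ 2 + Hs_norm L 0 (v t \- v t0) ^+ 2))).
  by apply: sum_le_weighted h2 h1; exact: sqr_ge0.
apply: (@le_trans _ _ (C * (e / C))); last by rewrite mulrC divfK// gt_eqF.
by apply: ler_wpM2l; [exact: ltW|exact: h].
Qed.

End Trajectories.

Section Limits.
Context {R : realType}.
Set Implicit Arguments.
Unset Strict Implicit.
Implicit Types (t s x e T : R).

Lemma continuous_halfline_deriv (H h : R -> R) : (forall t, 0 <= t -> is_derive t (1 : R) H (h t)) ->
  continuous (fun t : R => H `|t|).
Proof.
move=> dH s; apply: (@continuous_comp _ _ _ (fun s : R => `|s|) H); first exact: norm_continuous.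
exact: is_derive_continuous (dH _ (normr_ge0 s)).
Qed.

(** Compared with a primitive of [V], the approximations show that the limit equals [U 0] plus that
    primitive; the derivatives have to converge uniformly on bounded intervals, the functions only
    pointwise. *)
Lemma derive_limit (U V : R -> R) (UN VN : nat -> R -> R) :
  (forall N, continuous (fun t : R => UN N `|t|)) ->
  (forall N (t : R), 0 < t -> is_derive t 1 (UN N) (VN N t)) ->
  (forall t, 0 <= t -> UN ^~ t @ \oo --> U t) ->
  (forall T e, 0 < e -> exists N0, forall N, (N0 <= N)%N -> forall t, 0 <= t <= T ->
     `|VN N t - V t| <= e) ->
  continuous (fun t : R => V `|t|) ->
  continuous (fun t : R => U `|t|) /\ forall t : R, 0 < t -> is_derive t 1 U (V t).
Proof.
move=> cU dU UU VV cV.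
have [H [H0 dH]] := primitive_halfline cV.
have cH := continuous_halfline_deriv dH.
have dH' (s : R) : 0 < s -> is_derive s 1 H (V s).
  by move=> s0; have := dH s (ltW s0); rewrite ger0_norm// ltW.
have UE t : 0 <= t -> U t = U 0 + H t.
  move=> t0; apply/eqP; rewrite -subr_eq0 -normr_le0; apply/ler_addgt0Pr => e e0; rewrite add0r.
  have t1 : 0 < t + 1 by rewrite ltr_wpDl.
  have e1 : 0 < e / (t + 1) by rewrite divr_gt0.
  have [N0 hN] := VV t _ e1.
  have key N : (N0 <= N)%N -> `|UN N t - (UN N 0 + H t)| <= e.
    move=> NN.
    have := @growth_abs_le _ (fun s => UN N s - H s) (fun s => VN N s - V s) (e / (t + 1)) 0 t (lexx 0) t0.
    rewrite subr0 H0 subr0 => h.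
    apply: (@le_trans _ _ (e / (t + 1) * t)); last first.
      by rewrite mulrAC ler_pdivrMr// ler_pM2l// lerDl.
    have -> : UN N t - (UN N 0 + H t) = UN N t - H t - UN N 0 by ring.
    apply: h; first exact: continuous_sub.
      move=> x x0; apply: (is_derive_congr (is_derive_add (dU N x x0) (is_derive_scale (-1) (dH' x x0)))).
        by move=> y; rewrite mulN1r.
      by rewrite mulN1r.
    by move=> x /andP[x0 xt]; apply: hN => //; rewrite !ltW.
  have cv : (fun N => `|UN N t - (UN N 0 + H t)|) @ \oo --> `|U t - (U 0 + H t)|.
    apply: cvg_norm; apply: cvgB; first exact: UU.
    by apply: cvgD; [exact: UU|exact: cvg_cst].
  apply: (@ler_cvg_to _ _ _ _ _ (cst e) _ _ cv); first exact: cvg_cst.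
  by exists N0 => // N /= NN; exact: key.
split.
  have -> : (fun t : R => U `|t|) = (fun t => U 0 + H `|t|) by apply/funext => t; rewrite UE.
  by apply: continuous_add => //; exact: cst_continuous.
move=> t t0; apply: (@near_eq_is_derive _ _ _ (fun s => U 0 + H s)).
  near=> s; rewrite [RHS]UE//; apply: ltW; near: s; exact: lt_nbhsr.
by apply: (is_derive_congr (is_derive_add (is_derive_cst (U 0) t 1) (dH' t t0))) => //; rewrite add0r.
Unshelve. all: by end_near. Qed.

End Limits.

(** * The force as a functional on H^1 *)

Section Force.
Context {R : realType}.
Set Implicit Arguments.
Unset Strict Implicit.
Variable L : R.
Hypothesis L0 : 0 < L.
Implicit Types (f g p q : R -> R) (x : R) (N M k : nat) (c : nat -> R).
Notation coef := (coef L).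
Notation lam := (lam L).
Notation kap := (kap L).
Notation Phi := (Phi L).
Notation energy_le c S := (forall M, \sum_(0 <= k < M) lam k * c k ^+ 2 <= S).

Let w : R := 2 * pi / L.
Let w0 : 0 < w. Proof. by rewrite divr_gt0// mulr_gt0// pi_gt0. Qed.

Lemma pairing_norm_le f g (A B : R) : sqi L f -> sqi L g ->
  pairing L f f <= A -> pairing L g g <= B -> `|pairing L f g| <= Num.sqrt A * Num.sqrt B.
Proof.
move=> hf hg fA gB.
have A0 : 0 <= A by apply: le_trans fA; exact: pairing_ge0.
rewrite -sqrtrM// -sqrtr_sqr ler_sqrt; last first.
  by rewrite mulr_ge0// (le_trans _ gB)// pairing_ge0.
apply: le_trans (cauchy_schwarz hf hg) _.
by apply: ler_pM => //; exact: pairing_ge0.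
Qed.

(** The error is controlled by the tail of [f] alone, so one [N0] serves a whole ball of functions
    [g]; this provides the uniformity in time for the passage to the limit. *)
Lemma uniform_parseval f (S e : R) : sqi L f -> mean L f = 0 -> 0 <= S -> 0 < e ->
  exists N0, forall N, (N0 <= N)%N -> forall g, sqi L g -> pairing L g g <= S ->
    `|\sum_(0 <= k < N) coef g k * coef f k - pairing L g f| <= e.
Proof.
move=> hf mf S0 e0.
have S1 : 0 < S + 1 by rewrite ltr_wpDl.
have d0 : 0 < e ^+ 2 / (S + 1) by rewrite divr_gt0// exprn_gt0.
have [N0 hN0] := parseval L0 hf mf d0.
exists N0 => N NN g hg gS; have {}hN0 := hN0 N NN.
rewrite distrC -(@ler_pXn2r _ 2)//; [|by rewrite nnegrE..|by rewrite nnegrE ltW].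
rewrite real_normK ?num_real// pairingC.
have -> : \sum_(0 <= k < N) coef g k * coef f k = \sum_(0 <= k < N) coef f k * coef g k.
  by apply: eq_bigr => k _; rewrite mulrC.
apply: le_trans (pairing_sub_sum L0 N hf hg) _.
apply: (@le_trans _ _ (e ^+ 2 / (S + 1) * pairing L g g)).
  by rewrite ler_wpM2r ?pairing_ge0// lerBlDr addrC.
rewrite mulrAC ler_pdivrMr// ler_wpM2l ?sqr_ge0// (le_trans gS)// lerDl.
exact: ler01.
Qed.

Lemma sum_coef_weak_dx f p M : Hs_per_m L 1 f -> Hs_per_m L 1 p ->
  \sum_(0 <= k < M.*2) coef (weak_dx L f) k * coef (weak_dx L p) k =
  \sum_(0 <= k < M.*2) lam k * coef f k * coef p k.
Proof.
move=> hf hp; rewrite -[RHS](sum_partner (fun k => lam k * coef f k * coef p k)).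
apply: eq_bigr => k _; rewrite !coef_weak_dx// lamE freq_partner -dfreq_sqr.
by ring.
Qed.

Lemma pairing_Hs_norm p : Hs_per_m L 1 p -> pairing L p p <= Hs_norm L 1 p ^+ 2.
Proof.
move=> hp; have [_ mp _] := (Hs1P L0 p).1 hp.
apply: (pairing_le_sum L0 (Hs1_sqi L0 hp) mp) => N.
apply: le_trans (Hs_norm_ge L0 N hp); apply: ler_sum => k _.
by rewrite ler_peMl ?sqr_ge0// hweight1 lerDl sqr_ge0.
Qed.

Lemma pairing_weak_dx_Hs_norm p : Hs_per_m L 1 p ->
  pairing L (weak_dx L p) (weak_dx L p) <= w ^+ 2 * Hs_norm L 1 p ^+ 2.
Proof. by move=> hp; apply: pairing_weak_dx_le => // M; exact: Hs1_energy. Qed.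

Lemma pairing_weak_dx_sub f g S : Hs_per_m L 1 f -> Hs_per_m L 1 g ->
  energy_le (fun k => coef f k - coef g k) S ->
  pairing L (fun x => weak_dx L f x - weak_dx L g x) (fun x => weak_dx L f x - weak_dx L g x) <= S.
Proof.
move=> hf hg hS.
have sf := sqi_weak_dx L0 hf; have sg := sqi_weak_dx L0 hg.
have s1 : sqi L (fun=> (1 : R)) by exact: sqi_cst.
apply: (pairing_le_sum L0 (sqi_sub sf sg)).
  by rewrite meanE pairingBl// -!meanE !mean_weak_dx// subrr.
move=> N; apply: (@le_trans _ _ (\sum_(0 <= k < N.*2) coef (fun x => weak_dx L f x - weak_dx L g x) k ^+ 2)).
  by apply: le_sum_widen => [k|]; [exact: sqr_ge0|rewrite -addnn leq_addl].
apply: le_trans (hS N.*2); rewrite -(sum_partner (fun k => lam k * (coef f k - coef g k) ^+ 2)).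
apply: ler_sum => k _; rewrite coefB// !coef_weak_dx// lamE freq_partner -dfreq_sqr.
by apply: eq_ler; ring.
Qed.

Lemma weak_dx_pairing_lin (a : R) f p q : Hs_per_m L 1 f -> Hs_per_m L 1 p -> Hs_per_m L 1 q ->
  pairing L (weak_dx L f) (weak_dx L (fun x => a * p x + q x)) =
  a * pairing L (weak_dx L f) (weak_dx L p) + pairing L (weak_dx L f) (weak_dx L q).
Proof.
move=> hf hp hq; have hl := Hs1_lin L0 a hp hq.
have h1 := weak_dx_pairing_cvg L0 hf hl.
have h2 := weak_dx_pairing_cvg L0 hf hp; have h3 := weak_dx_pairing_cvg L0 hf hq.
have E : (fun M => \sum_(0 <= k < M.*2) lam k * coef f k * coef (fun x => a * p x + q x) k) =
  (fun M => a * (\sum_(0 <= k < M.*2) lam k * coef f k * coef p k) +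
    \sum_(0 <= k < M.*2) lam k * coef f k * coef q k).
  apply/funext => M; rewrite mulr_sumr -big_split/=; apply: eq_bigr => k _.
  rewrite coef_lin; [|exact: Hs1_sqi|exact: Hs1_sqi].
  by move: (coef p k) (coef q k) (coef f k) => y z v; ring.
rewrite E in h1.
have h4 : (fun M => a * (\sum_(0 <= k < M.*2) lam k * coef f k * coef p k) +
    \sum_(0 <= k < M.*2) lam k * coef f k * coef q k) @ \oo -->
    a * pairing L (weak_dx L f) (weak_dx L p) + pairing L (weak_dx L f) (weak_dx L q).
  by apply: cvgD; [apply: cvgM; [exact: cvg_cst|exact: h2]|exact: h3].
exact: (cvg_unique (@Rhausdorff R) h1 h4).
Qed.

Lemma pairing_lin (a : R) f p q : sqi L f -> sqi L p -> sqi L q ->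
  pairing L f (fun x => a * p x + q x) = a * pairing L f p + pairing L f q.
Proof.
move=> hf hp hq; rewrite pairingC pairingDl ?pairingZl//; last exact: sqi_scale.
by rewrite pairingC [pairing L q f]pairingC.
Qed.

(* The value of [phi_tt] on [p] dictated by the equation. *)
Definition force (f p : R -> R) : R :=
  - pairing L (weak_dx L f) (weak_dx L p) + pairing L f p - pairing L (fun x => f x ^+ 3) p.

Lemma sqi_Phi_cube c : finite_energy lam c -> sqi L (fun x => Phi c x ^+ 3).
Proof.
move=> fc; have [S hS] := fc.
apply: (sqi_bounded L (M := Num.sqrt (kap * S) ^+ 3)).
  by apply: measurable_funX; exact: Phi_meas.
move=> x; rewrite normrX lerXn2r// ?nnegrE// ?sqrtr_ge0//.
by apply: sqr_bound_norm; exact: Phi_bound.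
Qed.

Lemma force_lin c (a : R) p q : finite_energy lam c -> Hs_per_m L 1 p -> Hs_per_m L 1 q ->
  force (Phi c) (fun x => a * p x + q x) = a * force (Phi c) p + force (Phi c) q.
Proof.
move=> fc hp hq; have sp := Hs1_sqi L0 hp; have sq := Hs1_sqi L0 hq.
rewrite /force (weak_dx_pairing_lin a (Phi_Hs1 L0 fc) hp hq).
rewrite !pairing_lin//; [|exact: sqi_Phi_cube|exact: sqi_Phi].
have aux (A B C A' B' C' : R) :
  - (a * A + A') + (a * B + B') - (a * C + C') = a * (- A + B - C) + (- A' + B' - C') by ring.
exact: aux.
Qed.

Lemma cube_sub_le (K y z : R) : 0 <= K -> `|y| <= K -> `|z| <= K ->
  (y ^+ 3 - z ^+ 3) ^+ 2 <= 9 * K ^+ 4 * (y - z) ^+ 2.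
Proof. by move=> K0 yK zK; have := cubic_lipschitz K0 z y; rewrite !cubic_id. Qed.

Lemma Phi_cube_sub c c' S e x : energy_le c S -> energy_le c' S ->
  energy_le (fun k => c k - c' k) e ->
  (Phi c x ^+ 3 - Phi c' x ^+ 3) ^+ 2 <= 9 * (Num.sqrt (kap * S)) ^+ 4 * (kap * e).
Proof.
move=> hS hS' he; have K0 := sqrtr_ge0 (kap * S).
apply: le_trans (cube_sub_le K0 _ _) _.
- by apply: sqr_bound_norm; exact: Phi_bound.
- by apply: sqr_bound_norm; exact: Phi_bound.
apply: ler_wpM2l; first by rewrite mulr_ge0// exprn_ge0.
by apply: Phi_sub_bound => //; [exists S|exists S].
Qed.

(** One summand for each term of [force]: the Dirichlet form, the linear term, and the cube on
    functions of energy at most [S]. *)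
Definition force_cst (S : R) : R :=
  w + Num.sqrt (L * kap) + Num.sqrt (L * (9 * (Num.sqrt (kap * S)) ^+ 4 * kap)).

Lemma force_cst_ge0 S : 0 <= force_cst S.
Proof. by rewrite addr_ge0 ?sqrtr_ge0// addr_ge0 ?sqrtr_ge0// ltW. Qed.

(** An estimate in the dual norm: each term is a pairing bounded by Cauchy-Schwarz, and [e] bounds
    the squared energy distance, whence its square root. *)
Lemma force_lipschitz c c' S e p : energy_le c S -> energy_le c' S ->
  energy_le (fun k => c k - c' k) e -> Hs_per_m L 1 p ->
  `|force (Phi c) p - force (Phi c') p| <= force_cst S * Num.sqrt e * Hs_norm L 1 p.
Proof.
move=> hS hS' he hp.
have fc : finite_energy lam c by exists S.
have fc' : finite_energy lam c' by exists S.
have e0 : 0 <= e by have := he 0%N; rewrite big_geq.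
have P0 : 0 <= Hs_norm L 1 p by exact: sqrtr_ge0.
have sp := Hs1_sqi L0 hp; have swp := sqi_weak_dx L0 hp.
have hf := Phi_Hs1 L0 fc; have hf' := Phi_Hs1 L0 fc'.
have sf := sqi_Phi L0 fc; have sf' := sqi_Phi L0 fc'.
have swf := sqi_weak_dx L0 hf; have swf' := sqi_weak_dx L0 hf'.
have sc := sqi_Phi_cube fc; have sc' := sqi_Phi_cube fc'.
have k0 : 0 <= kap by rewrite ltW// kap_gt0.
have E : force (Phi c) p - force (Phi c') p =
   - pairing L (fun x => weak_dx L (Phi c) x - weak_dx L (Phi c') x) (weak_dx L p)
   + pairing L (fun x => Phi c x - Phi c' x) p
   - pairing L (fun x => Phi c x ^+ 3 - Phi c' x ^+ 3) p.
  rewrite /force (pairingBl swf swf' swp) (pairingBl sf sf' sp) (pairingBl sc sc' sp).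
  have aux (A B C A' B' C' : R) :
      (- A + B - C) - (- A' + B' - C') = - (A - A') + (B - B') - (C - C') by ring.
  exact: aux.
have h1 : `|pairing L (fun x => weak_dx L (Phi c) x - weak_dx L (Phi c') x) (weak_dx L p)|
    <= Num.sqrt e * (w * Hs_norm L 1 p).
  have := pairing_norm_le (sqi_sub swf swf') swp _ (pairing_weak_dx_Hs_norm hp) (A := e).
  rewrite -exprMn sqrtr_sqr [`|w * _|]ger0_norm; last by rewrite mulr_ge0// ltW.
  apply; apply: pairing_weak_dx_sub => // M.
  by under eq_bigr do rewrite !coef_Phi//.
have h2 : `|pairing L (fun x => Phi c x - Phi c' x) p| <= Num.sqrt (L * kap) * Num.sqrt e * Hs_norm L 1 p.
  have := pairing_norm_le (sqi_sub sf sf') sp _ (pairing_Hs_norm hp) (A := L * kap * e).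
  have Lk0 : 0 <= L * kap by apply: mulr_ge0 => //; exact: ltW.
  rewrite (sqrtrM e Lk0) sqrtr_sqr [`|Hs_norm L 1 p|]ger0_norm//; apply.
  rewrite -mulrA; apply: pairing_sqr_bound => //; first exact: sqi_sub.
  by move=> x _; exact: Phi_sub_bound.
have h3 : `|pairing L (fun x => Phi c x ^+ 3 - Phi c' x ^+ 3) p| <=
    Num.sqrt (L * (9 * (Num.sqrt (kap * S)) ^+ 4 * kap)) * Num.sqrt e * Hs_norm L 1 p.
  have := pairing_norm_le (sqi_sub sc sc') sp _ (pairing_Hs_norm hp)
    (A := L * (9 * (Num.sqrt (kap * S)) ^+ 4 * kap) * e).
  have A0 : 0 <= L * (9 * (Num.sqrt (kap * S)) ^+ 4 * kap).
    by apply: mulr_ge0; [exact: ltW|apply: mulr_ge0 => //; apply: mulr_ge0 => //; rewrite exprn_ge0// sqrtr_ge0].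
  rewrite (sqrtrM e A0) sqrtr_sqr [`|Hs_norm L 1 p|]ger0_norm//; apply.
  rewrite -[leRHS]mulrA -[X in _ <= _ * X]mulrA; apply: pairing_sqr_bound => //; first exact: sqi_sub.
  by move=> x _; exact: Phi_cube_sub.
rewrite E; apply: le_trans (ler_normB _ _) _; apply: le_trans (lerD (ler_normD _ _) (lexx _)) _.
rewrite normrN; apply: le_trans (lerD (lerD h1 h2) h3) _.
rewrite /force_cst; apply: eq_ler.
have aux (A B C D E' : R) : D * (A * E') + B * D * E' + C * D * E' = (A + B + C) * D * E' by ring.
exact: aux.
Qed.

(** The Lipschitz estimate is applied against the zero sequence, whose force vanishes. *)
Lemma force_bound c S p : energy_le c S -> Hs_per_m L 1 p ->
  `|force (Phi c) p| <= force_cst S * Num.sqrt S * Hs_norm L 1 p.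
Proof.
move=> hS hp.
have S0 : 0 <= S by have := hS 0%N; rewrite big_geq.
have h0 : energy_le (fun=> 0) S by move=> M; rewrite big1// => k _; rewrite expr0n/= mulr0.
have f0 : finite_energy lam (fun=> 0) by exists S.
have he : energy_le (fun k => c k - 0) S by move=> M; under eq_bigr do rewrite subr0.
have := force_lipschitz hS h0 he hp.
suff -> : force (Phi (fun=> 0)) p = 0 by rewrite subr0.
have P0 : Phi (fun=> 0) = (fun=> 0).
  apply/funext => x; rewrite /Phi (_ : (fun N => tsum L (fun=> 0) 0 N x) = (fun=> 0)) ?lim_cst//.
  by apply/funext => N; apply: big1 => i _; rewrite mul0r.
have hP := Phi_Hs1 L0 f0.
have sp := Hs1_sqi L0 hp.
have z (q : R -> R) : pairing L (fun=> 0) q = 0.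
  by rewrite /pairing; under eq_Rintegral do rewrite mul0r; rewrite Rintegral_cst// mul0r.
rewrite /force {2 3}P0 (_ : (fun x => 0 ^+ 3) = (fun=> 0)); last by apply/funext => x; rewrite expr0n.
rewrite !z addr0 subr0; apply/eqP; rewrite oppr_eq0 -sqrf_eq0 eq_le sqr_ge0 andbT.
apply: le_trans (cauchy_schwarz (sqi_weak_dx L0 hP) (sqi_weak_dx L0 hp)) _.
rewrite mulr_le0_ge0 ?pairing_ge0//; apply: pairing_weak_dx_le => // M.
by rewrite big1// => k _; rewrite coef_Phi// expr0n/= mulr0.
Qed.

End Force.

(** * Existence *)

Section DualNorm.
Context {R : realType}.
Set Implicit Arguments.
Unset Strict Implicit.
Variable L : R.
Hypothesis L0 : 0 < L.
Implicit Types (p : R -> R).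

Lemma Hs1_zero : Hs_per_m L 1 (fun=> 0) /\ Hs_norm L 1 (fun=> 0) = 0.
Proof.
have z (q : R -> R) : pairing L (fun=> 0) q = 0.
  by rewrite /pairing; under eq_Rintegral do rewrite mul0r; rewrite Rintegral_cst// mul0r.
have s0 : sqi L (fun=> (0 : R)) by exact: sqi_cst.
have m0 : mean L (fun=> 0) = 0 by rewrite meanE z.
split.
  apply/(Hs1P L0); split=> //; first by have [h1 h2] := s0; split.
  by exists 0 => N; rewrite big1// => k _; rewrite /coef z expr0n/= mulr0.
apply/eqP; rewrite -sqrf_eq0 eq_le sqr_ge0 andbT.
by apply: (Hs_norm_le L0 s0 m0) => N; rewrite big1// => k _; rewrite /coef z expr0n/= mulr0.
Qed.

Lemma Hm1_norm_ge w p : Hs_per_m L 1 p -> Hs_norm L 1 p <= 1 ->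
  (`|w p|%:E <= Hm1_norm L w)%E.
Proof. by move=> hp p1; apply: ereal_sup_ubound; exists p. Qed.

Lemma Hm1_norm_le w (C : R) :
  (forall p, Hs_per_m L 1 p -> Hs_norm L 1 p <= 1 -> `|w p| <= C) -> (Hm1_norm L w <= C%:E)%E.
Proof.
by move=> h; apply: ge_ereal_sup => _ [p [hp p1] <-]; rewrite lee_fin; exact: h.
Qed.

Lemma Hm1_norm_ge0 w : (0 <= Hm1_norm L w)%E.
Proof.
have [h0 n0] := Hs1_zero.
apply: le_trans (Hm1_norm_ge w h0 _); first by rewrite lee_fin.
by rewrite n0.
Qed.

Lemma Hm1_norm_fin_num w (C : R) :
  (forall p, Hs_per_m L 1 p -> Hs_norm L 1 p <= 1 -> `|w p| <= C) -> Hm1_norm L w \is a fin_num.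
Proof.
by move=> /Hm1_norm_le h; rewrite ge0_fin_numE ?Hm1_norm_ge0// (le_lt_trans h)// ltry.
Qed.

Lemma Hm1_norm_sub w w' (C e : R) :
  (forall p, Hs_per_m L 1 p -> Hs_norm L 1 p <= 1 -> `|w p| <= C) ->
  (forall p, Hs_per_m L 1 p -> Hs_norm L 1 p <= 1 -> `|w' p| <= C) ->
  (forall p, Hs_per_m L 1 p -> Hs_norm L 1 p <= 1 -> `|w p - w' p| <= e) ->
  `|fine (Hm1_norm L w) - fine (Hm1_norm L w')| <= e.
Proof.
move=> wC w'C we.
have half v v' : (forall p, Hs_per_m L 1 p -> Hs_norm L 1 p <= 1 -> `|v p| <= C) ->
  (forall p, Hs_per_m L 1 p -> Hs_norm L 1 p <= 1 -> `|v' p| <= C) ->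
  (forall p, Hs_per_m L 1 p -> Hs_norm L 1 p <= 1 -> `|v p - v' p| <= e) ->
  fine (Hm1_norm L v) - fine (Hm1_norm L v') <= e.
  move=> vC v'C ve; rewrite lerBlDr.
  rewrite -lee_fin fineK; last exact: (Hm1_norm_fin_num vC).
  apply: Hm1_norm_le => p hp p1; have := ve p hp p1.
  have : `|v' p| <= fine (Hm1_norm L v').
    by rewrite -lee_fin fineK ?(Hm1_norm_fin_num v'C)//; exact: Hm1_norm_ge.
  have := ler_normD (v p - v' p) (v' p); rewrite subrK => h1 h2 h3.
  by apply: le_trans h1 _; exact: lerD.
rewrite ler_norml; apply/andP; split; last exact: half.
rewrite lerNl opprB; apply: half => // p hp p1.
by rewrite distrC; exact: we.
Qed.

End DualNorm.

Section Existence.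
Context {R : realType}.
Notation mu := (@lebesgue_measure R).
Set Implicit Arguments.
Unset Strict Implicit.
Variable L : R.
Hypothesis L0 : 0 < L.
Implicit Types (h p q : R -> R) (x t s : R) (N M k : nat) (c : nat -> R).
Notation coef := (coef L).
Notation lam := (lam L).
Notation kap := (kap L).
Notation Phi := (Phi L).
Notation energy_le c S := (forall M, \sum_(0 <= k < M) lam k * c k ^+ 2 <= S).

(** A quantity that is Lipschitz for the energy norm on bounded time intervals inherits continuity
    in time from the trajectory; [e] bounds a squared norm, whence [Num.sqrt e]. *)
Lemma strongly_continuous_comp (a b : nat -> R -> R) (F : R -> R) :
  strongly_continuous lam a b ->
  (forall T, exists2 C : R, 0 <= C & forall s t e, 0 <= s <= T -> 0 <= t <= T ->
     (forall N, energy lam (fun k r => a k r - a k t) (fun k r => b k r - b k t)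
        (index_iota 0 N) s <= e) -> `|F s - F t| <= C * Num.sqrt e) ->
  continuous (fun t : R => F `|t|).
Proof.
move=> sc hF t0.
have [C C0 hC] := hF (`|t0| + 1).
apply/cvgrPdist_le => eps eps0.
have C1 : 0 < C + 1 by rewrite ltr_wpDl.
have e0 : 0 < (eps / (C + 1)) ^+ 2 by rewrite exprn_gt0// divr_gt0.
have [d /= d0 hd] := sc _ (normr_ge0 t0) _ e0.
exists (Num.min d 1) => /= [|t]; first by rewrite lt_min d0 ltr01.
rewrite /ball/= lt_min => /andP[+ +]; rewrite distrC => td t1.
have tt : `| `|t| - `|t0| | <= `|t - t0| by exact: ler_dist_dist.
rewrite distrC; apply: le_trans (hC `|t| `|t0| _ _ _ (hd _ (normr_ge0 t) _)) _.
- rewrite normr_ge0/= -lerBlDl; apply: le_trans (ler_norm _) _.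
  by apply: le_trans tt _; exact: ltW.
- by rewrite normr_ge0 lerDl ler01.
- exact: le_lt_trans tt td.
- rewrite sqrtr_sqr ger0_norm; last by rewrite divr_ge0// ltW.
  by rewrite mulrCA ler_piMr ?(ltW eps0)// ler_pdivrMr// mul1r lerDl ler01.
Qed.

(** The velocities are only in L^2, where the pointwise series may fail; [v] stands for a choice of
    Riesz-Fischer representatives at nonnegative times. *)
Variables (a b : nat -> R -> R) (S : R) (v : R -> R -> R).
Hypothesis osc : oscillators lam a b (fun k t => cubic_source L (a^~ t) k).
Hypothesis sc : strongly_continuous lam a b.
Hypothesis bnd : forall t, 0 <= t -> forall N, energy lam a b (index_iota 0 N) t <= S.
Hypothesis hv : forall t, 0 <= t ->
  [/\ L2_per L (v t), mean L (v t) = 0 & forall k, coef (v t) k = b k t].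

Notation u := (fun t => Phi (a^~ t)).

Lemma energy_S_ge0 : 0 <= S.
Proof. by have := bnd (lexx 0) 0%N; rewrite /energy big_geq. Qed.

Lemma modes_energy t : 0 <= t -> energy_le (a^~ t) S.
Proof. by move=> t0 N; apply: le_trans (bnd t0 N); exact: energy_potential_le. Qed.

Lemma modes_finite t : 0 <= t -> finite_energy lam (a^~ t).
Proof. by move=> t0; exists S; exact: modes_energy. Qed.

Lemma velocity_sqi t : 0 <= t -> sqi L (v t).
Proof. by move=> /hv[[h1 h2 h3] _ _]. Qed.

Lemma velocity_pairing t : 0 <= t -> pairing L (v t) (v t) <= S.
Proof.
move=> t0; have [_ h2 h3] := hv t0; apply: (pairing_le_sum L0 (velocity_sqi t0) h2) => N.
under eq_bigr do rewrite h3.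
by apply: le_trans (bnd t0 N); apply: energy_kinetic_le => k; exact: lam_ge0.
Qed.

Lemma existence_continuous_Y : continuous_Y L u v.
Proof.
apply: strongly_continuous_Y => //.
  move=> t t0; split; first by apply: Phi_Hs1 => //; exact: modes_finite.
  by apply/(Hs0P L0); have [h1 h2 h3] := hv t0; split.
move=> t0 t00 e e0; have [d d0 hd] := sc t00 e0.
exists d => // t t_0 td N; apply: le_trans (hd t t_0 td N).
rewrite (@energy_congr _ _ _ _ (fun k r => a k r - a k t0) (fun k r => b k r - b k t0))// => k.
  by rewrite !coef_Phi//; exact: modes_finite.
by have [_ _ ->] := hv t_0; have [_ _ ->] := hv t00.
Qed.

Lemma pairing_velocity_continuous p : sqi L p -> mean L p = 0 ->
  continuous (fun t : R => pairing L (v `|t|) p).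
Proof.
move=> sp mp; apply: (@strongly_continuous_comp a b (fun t => pairing L (v t) p) sc) => T.
exists (Num.sqrt (pairing L p p)); first exact: sqrtr_ge0.
move=> s t e /andP[s0 _] /andP[t0 _] he.
have vs := velocity_sqi s0; have vt := velocity_sqi t0.
rewrite -pairingBl// mulrC.
apply: pairing_norm_le => //; first exact: sqi_sub.
have [_ ms hs] := hv s0; have [_ mt ht] := hv t0.
apply: (pairing_le_sum L0 (sqi_sub vs vt)).
  have s1 : sqi L (fun=> (1 : R)) by exact: sqi_cst.
  by rewrite meanE pairingBl// -!meanE ms mt subrr.
move=> N; under eq_bigr do rewrite coefB// hs ht.
apply: le_trans (he N).
exact: (@energy_kinetic_le _ lam (fun k r => a k r - a k t) (fun k r => b k r - b k t) _ _ (fun k => lam_ge0 L0 k)).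
Qed.

(** The finite sums of modes are differentiable, their derivatives converge uniformly in time by
    Parseval, and the classical derivative so obtained is also a weak one. *)
Lemma existence_phit : is_phit L u v.
Proof.
move=> p /(Hs0P L0)[hp mp].
have sp : sqi L p by case: hp.
have [ca cb da db] := osc.
have cV := pairing_velocity_continuous sp mp.
suff [cU dU] : continuous (fun t : R => pairing L (u `|t|) p) /\
    forall t : R, 0 < t -> is_derive t 1 (fun t => pairing L (u t) p) (pairing L (v t) p).
  exact: (C1_weak_dt cU cV dU).
apply: (@derive_limit _ _ _ (fun N t => \sum_(0 <= k < N) coef p k * a k t)
  (fun N t => \sum_(0 <= k < N) coef p k * b k t)) => //.
- move=> N; apply: (@continuous_sum_halfline _ _ (fun k t => coef p k * a k t)) => k.
  by apply: continuous_scale; exact: ca.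
- by move=> N t t0; apply: (@is_derive_bigsum _ _ (fun k t => coef p k * a k t) (fun k t => coef p k * b k t)) => k;
    apply: is_derive_scale; exact: da.
- move=> t t0; have fa := modes_finite t0.
  have := parseval_cvg L0 (sqi_Phi L0 fa) (mean_Phi L0 fa) sp.
  under eq_fun do under eq_bigr do rewrite coef_Phi// mulrC.
  exact.
- move=> T e e0; have [N0 hN] := uniform_parseval L0 sp mp energy_S_ge0 e0.
  exists N0 => N NN t /andP[t0 _].
  have := hN N NN _ (velocity_sqi t0) (velocity_pairing t0).
  have [_ _ ht] := hv t0.
  by under eq_bigr do rewrite ht mulrC.
Qed.

Notation w t := (force L (u t)).

Lemma force_bounded t p : 0 <= t -> Hs_per_m L 1 p -> Hs_norm L 1 p <= 1 ->
  `|w t p| <= force_cst L S * Num.sqrt S.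
Proof.
move=> t0 hp p1; apply: le_trans (force_bound L0 (modes_energy t0) hp) _.
by rewrite ler_piMr// mulr_ge0 ?sqrtr_ge0// force_cst_ge0.
Qed.

Lemma force_time_lipschitz s t e p : 0 <= s -> 0 <= t ->
  (forall N, energy lam (fun k r => a k r - a k t) (fun k r => b k r - b k t)
        (index_iota 0 N) s <= e) -> Hs_per_m L 1 p ->
  `|w s p - w t p| <= force_cst L S * Num.sqrt e * Hs_norm L 1 p.
Proof.
move=> s0 t0 he hp; apply: force_lipschitz => //; [exact: modes_energy|exact: modes_energy|].
move=> N; apply: le_trans (he N).
exact: (@energy_potential_le _ lam (fun k r => a k r - a k t) (fun k r => b k r - b k t)).
Qed.

Lemma force_continuous p : Hs_per_m L 1 p -> continuous (fun t : R => w `|t| p).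
Proof.
move=> hp; apply: (@strongly_continuous_comp a b (fun t => w t p) sc) => T.
exists (force_cst L S * Hs_norm L 1 p).
  by rewrite mulr_ge0 ?sqrtr_ge0 ?force_cst_ge0.
move=> s t e /andP[s0 _] /andP[t0 _] he; rewrite mulrAC.
exact: force_time_lipschitz.
Qed.

(** Uniformity over the unit ball of test functions lets continuity pass to the dual norm; local
    integrability in time follows. *)
Lemma force_Hm1_norm_continuous : continuous (fun t : R => fine (Hm1_norm L (w `|t|))).
Proof.
apply: (@strongly_continuous_comp a b (fun t => fine (Hm1_norm L (w t))) sc) => T.
exists (force_cst L S); first exact: force_cst_ge0.
move=> s t e /andP[s0 _] /andP[t0 _] he.
apply: (Hm1_norm_sub L0 (C := force_cst L S * Num.sqrt S)) => p hp p1;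
  [exact: force_bounded|exact: force_bounded|].
apply: le_trans (force_time_lipschitz s0 t0 he hp) _.
by rewrite ler_piMr// mulr_ge0 ?sqrtr_ge0// force_cst_ge0.
Qed.

Lemma force_L1loc : L1loc_Hm1 L (fun t => w t).
Proof.
split.
- move=> t t0; split.
    by move=> r p q hp hq; apply: force_lin => //; exact: modes_finite.
  exists (force_cst L S * Num.sqrt S) => p hp.
  exact: force_bound (modes_energy t0) hp.
- move=> p hp; apply: (eq_measurable_fun (fun t : R => w `|t| p)).
    by move=> t; rewrite inE/= in_itv/= andbT => t0; rewrite ger0_norm.
  by apply: measurable_funTS; apply: measurable_continuous; exact: force_continuous.
- move=> T T0.
  have h : mu.-integrable `[0, T] (EFin \o (fun t : R => fine (Hm1_norm L (w `|t|)))).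
    apply: continuous_compact_integrable; first exact: segment_compact.
    apply: continuous_subspaceT; exact: force_Hm1_norm_continuous.
  apply: eq_integrable h => //.
  move=> t; rewrite inE/= in_itv/= => /andP[t0 _]; rewrite ger0_norm// fineK//.
  by apply: (Hm1_norm_fin_num L0) => p; exact: force_bounded.
Qed.

Lemma sum_force_error p N t (A B C : R) : 0 <= t ->
  \sum_(0 <= k < N) coef p k * (- lam k * a k t + cubic_source L (a^~ t) k) - (- A + B - C) =
  - (\sum_(0 <= k < N) lam k * a k t * coef p k - A)
  + (\sum_(0 <= k < N) a k t * coef p k - B)
  - (\sum_(0 <= k < N) coef (fun x => u t x ^+ 3) k * coef p k - C).
Proof.
move=> t0.
have -> : \sum_(0 <= k < N) coef p k * (- lam k * a k t + cubic_source L (a^~ t) k) =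
  - (\sum_(0 <= k < N) lam k * a k t * coef p k) + \sum_(0 <= k < N) a k t * coef p k -
  \sum_(0 <= k < N) coef (fun x => u t x ^+ 3) k * coef p k.
  rewrite -!sumrN -!big_split/=; apply: eq_bigr => k _; rewrite /cubic_source.
  have aux (x y z r q : R) : q * (- x * y + (y - z)) = - (x * y * q) + y * q - z * q by ring.
  by rewrite aux// .
have aux (x y z : R) : - x + y - z - (- A + B - C) = - (x - A) + (y - B) - (z - C) by ring.
exact: aux.
Qed.

(** Each of the three terms is handled by uniform Parseval on a ball fixed by the energy bound. The
    sums stop at [N.*2] because of the exchange of cosines and sines in the Dirichlet form. *)
Lemma force_uniform p e : Hs_per_m L 1 p -> 0 < e ->
  exists N0, forall N, (N0 <= N)%N -> forall t, 0 <= t ->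
  `|\sum_(0 <= k < N.*2) coef p k * (- lam k * a k t + cubic_source L (a^~ t) k) - w t p| <= e.
Proof.
move=> hp e0.
have e3 : 0 < e / 3 by rewrite divr_gt0// ltr0n.
have sp := Hs1_sqi L0 hp; have [_ mp _] := (Hs1P L0 p).1 hp.
have swp := sqi_weak_dx L0 hp; have mwp := mean_weak_dx L0 hp.
have S0 := energy_S_ge0.
have k0 : 0 <= kap by rewrite ltW// kap_gt0.
have kS0 : 0 <= kap * S by exact: mulr_ge0.
have Q1 : 0 <= L * (kap * S) by apply: mulr_ge0 => //; exact: ltW.
have Q2 : 0 <= L * (kap * S) ^+ 3 by apply: mulr_ge0; [exact: ltW|exact: exprn_ge0].
have [N1 h1] := uniform_parseval L0 swp mwp S0 e3.
have [N2 h2] := uniform_parseval L0 sp mp Q1 e3.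
have [N3 h3] := uniform_parseval L0 sp mp Q2 e3.
exists (maxn N1 (maxn N2 N3)) => N; rewrite !geq_max => /and3P[n1 n2 n3] t t0.
have NN : (N <= N.*2)%N by rewrite -addnn leq_addl.
have fa := modes_finite t0; have ha := modes_energy t0.
have hf := Phi_Hs1 L0 fa.
rewrite /force sum_force_error//.
have {}h1 : `|\sum_(0 <= k < N.*2) lam k * a k t * coef p k - pairing L (weak_dx L (u t)) (weak_dx L p)| <= e / 3.
  have E : \sum_(0 <= k < N.*2) lam k * a k t * coef p k =
      \sum_(0 <= k < N.*2) coef (weak_dx L (u t)) k * coef (weak_dx L p) k.
    by rewrite sum_coef_weak_dx//; apply: eq_bigr => k _; rewrite coef_Phi.
  rewrite E; apply: h1; [exact: leq_trans NN|exact: sqi_weak_dx|].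
  apply: pairing_weak_dx_le => // M.
  by under eq_bigr do rewrite coef_Phi//.
have {}h2 : `|\sum_(0 <= k < N.*2) a k t * coef p k - pairing L (u t) p| <= e / 3.
  have E : \sum_(0 <= k < N.*2) a k t * coef p k = \sum_(0 <= k < N.*2) coef (u t) k * coef p k.
    by apply: eq_bigr => k _; rewrite coef_Phi.
  rewrite E; apply: h2; [exact: leq_trans NN|exact: sqi_Phi|].
  apply: pairing_sqr_bound => //; first exact: sqi_Phi.
  by move=> x _; exact: Phi_bound.
have {}h3 : `|\sum_(0 <= k < N.*2) coef (fun x => u t x ^+ 3) k * coef p k
    - pairing L (fun x => u t x ^+ 3) p| <= e / 3.
  apply: h3; [exact: leq_trans NN|exact: sqi_Phi_cube|].
  apply: pairing_sqr_bound => //; first exact: sqi_Phi_cube.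
  move=> x _; rewrite -exprM mulnC exprM.
  by apply: lerXn2r; rewrite ?nnegrE ?sqr_ge0//; exact: Phi_bound.
have -> : e = e / 3 + e / 3 + e / 3 by field.
apply: le_trans (ler_normB _ _) _; apply: lerD => //.
by apply: le_trans (ler_normD _ _) _; rewrite normrN; exact: lerD.
Qed.

Lemma existence_phitt : is_phitt L v (fun t => w t).
Proof.
split; first exact: force_L1loc.
move=> p hp; have sp := Hs1_sqi L0 hp; have [_ mp _] := (Hs1P L0 p).1 hp.
have [ca cb da db] := osc.
have cV := force_continuous hp.
suff [cU dU] : continuous (fun t : R => pairing L (v `|t|) p) /\
    forall t : R, 0 < t -> is_derive t 1 (fun t => pairing L (v t) p) (w t p).
  exact: (C1_weak_dt cU cV dU).
apply: (@derive_limit _ _ _ (fun N t => \sum_(0 <= k < N.*2) coef p k * b k t)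
  (fun N t => \sum_(0 <= k < N.*2) coef p k * (- lam k * a k t + cubic_source L (a^~ t) k))) => //.
- move=> N; apply: (@continuous_sum_halfline _ _ (fun k t => coef p k * b k t)) => k.
  by apply: continuous_scale; exact: cb.
- move=> N t t0; apply: (@is_derive_bigsum _ _ (fun k t => coef p k * b k t)
    (fun k t => coef p k * (- lam k * a k t + cubic_source L (a^~ t) k))) => k.
  by apply: is_derive_scale; exact: db.
- move=> t t0; apply/cvgrPdist_le => e e0.
  have [N0 hN] := uniform_parseval L0 sp mp energy_S_ge0 e0.
  exists N0 => // N /= NN; have NN2 : (N0 <= N.*2)%N by rewrite -addnn (leq_trans NN)// leq_addl.
  have [_ _ ht] := hv t0.
  have -> : \sum_(0 <= k < N.*2) coef p k * b k t = \sum_(0 <= k < N.*2) coef (v t) k * coef p k.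
    by apply: eq_bigr => k _; rewrite ht mulrC.
  by rewrite distrC; apply: hN => //; [exact: velocity_sqi|exact: velocity_pairing].
- move=> T e e0; have [N0 hN] := force_uniform hp e0.
  by exists N0 => N NN t /andP[t0 _]; exact: hN.
Qed.

(** The second time derivative is taken to be the force itself, so the equation holds at every time
    by construction; that it is the derivative is [existence_phitt]. *)
Lemma existence_weak_equation : weak_equation L u (fun t => w t).
Proof.
move=> p hp; apply: aeW => t t0.
rewrite /force /pairing.
have aux (A B C : R) : - A + B - C + A - B + C = 0 by ring.
exact: aux.
Qed.

End Existence.

Section GlobalSolution.
Context {R : realType}.

Theorem global_solution_exists (L : R) (hL : 0 < L < 2 * pi) (phi0 phi1 : R -> R) :
  Y_space L (phi0, phi1) -> exists phi, global_weak_solution L phi0 phi1 phi.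
Proof.
case=> /= h0 h1; have /andP[L0 L2] := hL.
have w1 : 1 < 2 * pi / L by rewrite ltr_pdivlMr// mul1r.
have s1 := Hs0_sqi L0 h1.
pose a0 := coef L phi0; pose b0 := coef L phi1.
pose E0 := pairing L phi1 phi1 + (2 * pi / L) ^+ 2 * Hs_norm L 1 phi0 ^+ 2.
have hE N : \sum_(0 <= k < N) (b0 k ^+ 2 + lam L k * a0 k ^+ 2) <= E0.
  by rewrite big_split/= lerD ?bessel//; exact: Hs1_energy.
have [a [b [osc sc ini [S bnd]]]] := modes_exist L0 w1 hE.
have [v hv] : exists v : R -> R -> R, forall t, 0 <= t ->
    [/\ L2_per L (v t), mean L (v t) = 0 & forall k, coef L (v t) k = b k t].
  have h (t : R) : exists f : R -> R, 0 <= t ->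
      [/\ L2_per L f, mean L f = 0 & forall k, coef L f k = b k t].
    have [t0|t0] := leP 0 t; last by exists (fun=> 0).
    have hb N : \sum_(0 <= k < N) (b^~ t) k ^+ 2 <= S.
      apply: le_trans (bnd t t0 N); apply: energy_kinetic_le => k; exact: lam_ge0.
    by have [f [f1 f2 f3 _]] := riesz_fischer L0 hb; exists f.
  by have [v hv] := choice h; exists v.
exists (fun t => Phi L (a^~ t)), v, (fun t => force L (Phi L (a^~ t))); split.
- exact: (existence_continuous_Y L0 sc bnd hv).
- exact: (existence_phit L0 osc sc bnd hv).
- exact: (existence_phitt L0 osc sc bnd hv).
- exact: existence_weak_equation.
have fa := modes_finite bnd (lexx 0).
split.
  have [p1 m1 _] := (Hs1P L0 _).1 h0; have [p2 m2 _] := (Hs1P L0 _).1 (Phi_Hs1 L0 fa).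
  apply: (coef_inj L0 p2 p1) => [|k]; first by rewrite m1 m2.
  by rewrite coef_Phi//; have [->] := ini k.
have [p1 m1] := (Hs0P L0 _).1 h1; have [p2 m2 c2] := hv 0 (lexx 0).
apply: (coef_inj L0 p2 p1) => [|k]; first by rewrite m1 m2.
by rewrite c2; have [_ ->] := ini k.
Qed.

End GlobalSolution.

(** * Uniqueness *)

Section Uniqueness.
Context {R : realType}.
Notation mu := (@lebesgue_measure R).
Set Implicit Arguments.
Unset Strict Implicit.
Variable L : R.
Hypothesis L0 : 0 < L.
Implicit Types (f g h p q : R -> R) (x t s : R) (N M k : nat) (c : nat -> R).
Notation coef := (coef L).
Notation lam := (lam L).
Notation kap := (kap L).
Notation Phi := (Phi L).
Notation I := [set` `[(0 : R), L]].
Let mI : measurable (I : set (measurableTypeR R)). Proof. exact: measurable_itv. Qed.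

(** Near each time the energy stays below 2 (1 + S), where [S] bounds it at that time. Compactness
    of [0, T] is used in its near-covering form, with the bound tending to +oo as the filter
    variable. *)
Lemma strongly_continuous_bounded (a b : nat -> R -> R) T : strongly_continuous lam a b ->
  (forall t, 0 <= t -> exists S, forall N, energy lam a b (index_iota 0 N) t <= S) ->
  exists C, forall t, 0 <= t <= T -> forall N, energy lam a b (index_iota 0 N) t <= C.
Proof.
move=> sc fin.
pose P (C t : R) := 0 <= t -> forall N, energy lam a b (index_iota 0 N) t <= C.
have cov := (compact_near_coveringP _).1 (@segment_compact R 0 T).
have [] := cov R (pinfty_nbhs R) P _.
  move=> t0; rewrite /= in_itv/= => /andP[t00 _].
  have [d d0 hd] := sc t0 t00 1 ltr01; have [S hS] := fin t0 t00.
  exists (ball t0 d, [set C | 2 * (1 + S) < C]); first split => /=.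
  - exact: nbhsx_ballx.
  - exact: nbhs_pinfty_gt (num_real _).
  move=> [t C] /= [td hC] t_0 N.
  apply: le_trans (ltW hC); rewrite /ball/= in td.
  (* The state at [t] is written as its increment from [t0] minus the opposite of the state at [t0],
     so that the estimate for differences applies. *)
  have := @energy_sub_le _ lam (fun k r => a k r - a k t0) (fun k r => b k r - b k t0)
    (fun k _ => - a k t0) (fun k _ => - b k t0) (index_iota 0 N) t (fun k => lam_ge0 L0 k).
  have -> : energy lam (fun k r => a k r - a k t0 - - a k t0) (fun k r => b k r - b k t0 - - b k t0)
     (index_iota 0 N) t = energy lam a b (index_iota 0 N) t.
    by apply: energy_congr => k; rewrite opprK subrK.
  move/le_trans; apply; rewrite ler_pM2l//; apply: lerD; first by apply: hd => //; rewrite distrC.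
  apply: le_trans (hS N); apply: eq_ler.
  by apply: eq_bigr => k _; rewrite !sqrrN.
move=> M [Mr hM]; exists (M + 1) => t tT N.
apply: (hM (M + 1)); [by rewrite ltrDl|by rewrite /= in_itv|by case/andP: tT].
Qed.

Lemma strongly_continuous_modes (a b : nat -> R -> R) : strongly_continuous lam a b ->
  (forall k, continuous (fun t : R => a k `|t|)) /\ (forall k, continuous (fun t : R => b k `|t|)).
Proof.
move=> sc.
have term s t e k : (forall N, energy lam (fun k r => a k r - a k t) (fun k r => b k r - b k t)
        (index_iota 0 N) s <= e) -> (b k s - b k t) ^+ 2 + lam k * (a k s - a k t) ^+ 2 <= e.
  move=> /(_ k.+1); apply: le_trans; rewrite /energy big_nat_recr//= lerDr.
  by apply: sumr_ge0 => j _; rewrite addr_ge0 ?sqr_ge0// mulr_ge0 ?sqr_ge0// lam_ge0.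
split=> k.
  apply: (@strongly_continuous_comp _ L a b (a k) sc) => T.
  have l0 := lam_gt0 L0 k.
  exists (Num.sqrt (lam k)^-1); first exact: sqrtr_ge0.
  move=> s t e _ _ /term => /(_ k) h.
  have lv : 0 <= (lam k)^-1 by rewrite invr_ge0 ltW.
  have e0 : 0 <= e by apply: le_trans h; rewrite addr_ge0 ?sqr_ge0// mulr_ge0 ?sqr_ge0// ltW.
  rewrite -(sqrtrM _ lv) -sqrtr_sqr ler_sqrt ?mulr_ge0//.
  rewrite mulrC ler_pdivlMr// mulrC; apply: le_trans h.
  by rewrite lerDr sqr_ge0.
apply: (@strongly_continuous_comp _ L a b (b k) sc) => T.
exists 1; first exact: ler01.
move=> s t e _ _ /term => /(_ k) h.
have l0 := lam_gt0 L0 k.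
have e0 : 0 <= e by apply: le_trans h; rewrite addr_ge0 ?sqr_ge0// mulr_ge0 ?sqr_ge0// ltW.
rewrite mul1r -sqrtr_sqr ler_sqrt//; apply: le_trans h.
by rewrite lerDl mulr_ge0 ?sqr_ge0// ltW.
Qed.

Lemma pairing_ae_measurable f g p : measurable_fun setT f -> measurable_fun setT g ->
  measurable_fun setT p -> eq_ae f g -> pairing L f p = pairing L g p.
Proof.
move=> mf mg mp fg.
have m q : measurable_fun setT q -> measurable_fun I (EFin \o (fun x => q x * p x)).
  by move=> mq; apply/measurable_EFinP; apply: measurable_funTS; exact: measurable_funM.
rewrite /pairing /Rintegral; congr fine; apply: ae_eq_integral; [exact: mI|exact: m|exact: m|].
by apply: ae_imp fg => x h Ix; rewrite /= h.
Qed.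

(** The force does not depend on the representative: the Dirichlet form is determined by the
    coefficients, and the other two terms by the class almost everywhere. *)
Lemma force_Phi_coef f p : Hs_per_m L 1 f -> Hs_per_m L 1 p ->
  force L f p = force L (Phi (coef f)) p.
Proof.
move=> hf hp; have [[mf _ _] _ fc] := (Hs1P L0 f).1 hf.
have hP := Phi_Hs1 L0 fc; have [mp _] := Hs1_sqi L0 hp.
have ae := Hs1_Phi L0 hf.
have h1 := weak_dx_pairing_cvg L0 hf hp; have h2 := weak_dx_pairing_cvg L0 hP hp.
have E : (fun M => \sum_(0 <= k < M.*2) lam k * coef (Phi (coef f)) k * coef p k) =
         (fun M => \sum_(0 <= k < M.*2) lam k * coef f k * coef p k).
  by apply/funext => M; apply: eq_bigr => k _; rewrite coef_Phi.
rewrite E in h2.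
have Ed : pairing L (weak_dx L f) (weak_dx L p) = pairing L (weak_dx L (Phi (coef f))) (weak_dx L p).
  exact: (cvg_unique (@Rhausdorff R) h1 h2).
have mP := Phi_meas L0 fc.
have E1 : pairing L f p = pairing L (Phi (coef f)) p by exact: pairing_ae_measurable.
have E2 : pairing L (fun x => f x ^+ 3) p = pairing L (fun x => Phi (coef f) x ^+ 3) p.
  apply: pairing_ae_measurable; [exact: measurable_funX|exact: measurable_funX|exact: mp|].
  by apply: ae_imp ae => x ->.
have aux (A B C A' B' C' : R) : A = A' -> B = B' -> C = C' -> - A + B - C = - A' + B' - C'.
  by move=> -> -> ->.
exact: aux Ed E1 E2.
Qed.

(** Testing with a basis function makes the Dirichlet sum eventually constant and gives back the
    right-hand side of one oscillator. *)
Lemma force_tb c k : finite_energy lam c ->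
  force L (Phi c) (tb L k) = - lam k * c k + cubic_source L c k.
Proof.
move=> fc; have hP := Phi_Hs1 L0 fc.
have h1 := weak_dx_pairing_cvg L0 hP (tb_Hs1 L0 k).
have Et j : coef (tb L k) j = (j == k)%:R by rewrite /coef tb_orthonormal// eq_sym.
have h2 : (fun M => \sum_(0 <= j < M.*2) lam j * coef (Phi c) j * coef (tb L k) j) @ \oo --> lam k * c k.
  apply: (@cvg_near_cst _ _ (lam k * c k)).
  exists k.+1 => // M /= kM.
  have kM2 : (k < M.*2)%N by rewrite (leq_trans kM)// -addnn leq_addl.
  rewrite big_mkord (bigD1 (Ordinal kM2))//= big1 ?addr0.
    by rewrite coef_Phi// Et eqxx mulr1.
  move=> j jk; rewrite Et (_ : (j == k :> nat) = false) ?mulr0//.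
  by apply/negbTE; apply: contra jk => /eqP kj; apply/eqP/val_inj.
have E : pairing L (weak_dx L (Phi c)) (weak_dx L (tb L k)) = lam k * c k.
  exact: (cvg_unique (@Rhausdorff R) h1 h2).
rewrite /force E /cubic_source.
have -> : pairing L (Phi c) (tb L k) = c k by exact: coef_Phi.
by rewrite addrA mulNr.
Qed.

(** The second derivative of a weak solution is known almost everywhere only; replacing it by a
    version continuous in time opens the way to classical derivatives. *)
Lemma weak_dt_ae (U V V' : R -> R) : measurable_fun `[(0 : R), +oo[ V ->
  continuous (fun t : R => V' `|t|) -> {ae mu, forall t, 0 <= t -> V t = V' t} ->
  is_weak_dt U V -> is_weak_dt U V'.
Proof.
move=> mV cV' VV' h theta htheta; rewrite (h theta htheta); congr (- _).
have mth : measurable_fun setT theta.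
  by apply: measurable_continuous; apply: is_C1_continuous; case: htheta.
have mp : measurable ([set` `](0 : R), +oo[] : set (measurableTypeR R)) by exact: measurable_itv.
have sub : [set` `](0 : R), +oo[] `<=` [set` `[(0 : R), +oo[].
  by move=> t /=; rewrite !in_itv/= !andbT => /ltW.
congr fine; apply: ae_eq_integral => //.
- apply/measurable_EFinP; apply: measurable_funM; last exact: measurable_funTS.
  by apply: measurable_funS mV => //; exact: measurable_itv.
- apply/measurable_EFinP; apply: measurable_funM; last exact: measurable_funTS.
  apply: (eq_measurable_fun (fun t : R => V' `|t|)).
    by move=> t; rewrite inE/= in_itv/= andbT => t0; rewrite gtr0_norm.
  by apply: measurable_funTS; exact: measurable_continuous.
- by apply: ae_imp VV' => t ht /=; rewrite in_itv/= andbT => t0; rewrite ht// ltW.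
Qed.

(** For almost every time the equation identifies [z] with the force, which is continuous in time
    along a trajectory continuous in Y; the weak derivatives of the coefficients are therefore
    classical. *)
Lemma solution_modes (u v : R -> R -> R) (z : R -> (R -> R) -> R) :
  continuous_Y L u v -> is_phit L u v -> is_phitt L v z -> weak_equation L u z ->
  let a k t := coef (u t) k in let b k t := coef (v t) k in
  [/\ oscillators lam a b (fun k t => cubic_source L (a^~ t) k),
      forall t, 0 <= t -> finite_energy lam (a^~ t) &
      forall T, exists C, forall t, 0 <= t <= T -> forall N, energy lam a b (index_iota 0 N) t <= C].
Proof.
move=> cY phit [[_ zmeas _] phitt] weq a b.
have hY := cY.1; have sc := Y_strongly_continuous L0 cY.
have [ca cb] := strongly_continuous_modes sc.
have fin t : 0 <= t -> exists S, forall N, energy lam a b (index_iota 0 N) t <= S.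
  move=> t0; have [/= hu hv] := hY t t0.
  have [_ _ [S hS]] := (Hs1P L0 _).1 hu; have sv := Hs0_sqi L0 hv.
  exists (pairing L (v t) (v t) + S) => N.
  by rewrite /energy big_split/=; apply: lerD; [exact: bessel|exact: hS].
have bnd T := strongly_continuous_bounded T sc fin.
have fa t : 0 <= t -> finite_energy lam (a^~ t).
  by move=> t0; have [S hS] := fin t t0; exists S => N; apply: le_trans (hS N); exact: energy_potential_le.
split=> //; split=> //.
  move=> k; have htb := Hs1_Hs0 L0 (tb_Hs1 L0 k).
  move=> t t0; exact: (weak_dt_is_derive (ca k) (cb k) (phit _ htb) t0).
move=> k; have htb := tb_Hs1 L0 k.
have cF : continuous (fun t : R => force L (Phi (a^~ `|t|)) (tb L k)).
  apply: (@strongly_continuous_comp _ L a b (fun t => force L (Phi (a^~ t)) (tb L k)) sc) => T.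
  have [C hC] := bnd T.
  exists (force_cst L C * Hs_norm L 1 (tb L k)).
    by apply: mulr_ge0; [exact: force_cst_ge0|exact: sqrtr_ge0].
  move=> s t e sT tT he; rewrite mulrAC; apply: force_lipschitz => //.
  - by move=> N; apply: le_trans (hC s sT N); exact: energy_potential_le.
  - by move=> N; apply: le_trans (hC t tT N); exact: energy_potential_le.
  - move=> N; apply: le_trans (he N).
    exact: (@energy_potential_le _ lam (fun k r => a k r - a k t) (fun k r => b k r - b k t)).
have aez : {ae mu, forall t : R, 0 <= t -> z t (tb L k) = force L (Phi (a^~ t)) (tb L k)}.
  apply: ae_imp (weq _ htb) => t h t0.
  rewrite -(force_Phi_coef (hY t t0).1 htb) /force /pairing.
  have aux (y A B C : R) : y + A - B + C = 0 -> y = - A + B - C by lra.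
  exact: aux (h t0).
move=> t t0.
have wd := weak_dt_ae (zmeas _ htb) cF aez (phitt _ htb).
have := weak_dt_is_derive (cb k) cF wd t0.
by rewrite force_tb//; apply: fa; exact: ltW.
Qed.

Lemma coef_ae f g k : L2_per L f -> L2_per L g -> eq_ae f g -> coef f k = coef g k.
Proof.
by move=> [mf _ _] [mg _ _]; apply: pairing_ae_measurable => //; have [] := sqi_tb L k.
Qed.

Lemma solution_unique (phi0 phi1 : R -> R) (phi psi : R -> R -> R) :
  Y_space L (phi0, phi1) ->
  global_weak_solution L phi0 phi1 phi -> global_weak_solution L phi0 phi1 psi ->
  forall t, 0 <= t -> eq_ae (phi t) (psi t).
Proof.
move=> [/= h0 h1] [v [z [cY pt ptt we [i0 i1]]]] [v' [z' [cY' pt' ptt' we' [i0' i1']]]] t t0.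
have [osc fa bnd] := solution_modes cY pt ptt we.
have [osc' fa' bnd'] := solution_modes cY' pt' ptt' we'.
have [C hC] := bnd t; have [C' hC'] := bnd' t.
have u0 := cY.1; have u0' := cY'.1.
have [l0 _ _] := (Hs1P L0 _).1 h0; have [l1 _] := (Hs0P L0 _).1 h1.
have L1 s : 0 <= s -> L2_per L (phi s) /\ mean L (phi s) = 0.
  by move=> /u0[/= /(Hs1P L0)[]].
have L1' s : 0 <= s -> L2_per L (psi s) /\ mean L (psi s) = 0.
  by move=> /u0'[/= /(Hs1P L0)[]].
have L2 : L2_per L (v 0) by have [_ /(Hs0P L0)[]] := u0 0 (lexx 0).
have L2' : L2_per L (v' 0) by have [_ /(Hs0P L0)[]] := u0' 0 (lexx 0).
pose S := Num.max C C'.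
have eC s N : 0 <= s <= t -> \sum_(0 <= k < N) lam k * coef (phi s) k ^+ 2 <= S.
  move=> sT; rewrite le_max; apply/orP; left; apply: le_trans (hC s sT N).
  exact: (energy_potential_le lam (fun k r => coef (phi r) k) (fun k r => coef (v r) k)).
have eC' s N : 0 <= s <= t -> \sum_(0 <= k < N) lam k * coef (psi s) k ^+ 2 <= S.
  move=> sT; rewrite le_max; apply/orP; right; apply: le_trans (hC' s sT N).
  exact: (energy_potential_le lam (fun k r => coef (psi r) k) (fun k r => coef (v' r) k)).
(* Neither solution exceeds this height on [0, t], so the cube may be replaced by its truncation,
   whose Lipschitz estimate closes the argument. *)
pose K := Num.sqrt (kap * S).
have K0 : 0 <= K by exact: sqrtr_ge0.
have srcE c : (forall N, \sum_(0 <= k < N) lam k * c k ^+ 2 <= S) ->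
    forall k, cubic_source L c k = source L K c k.
  move=> hc k; rewrite /cubic_source /source; congr (_ - coef _ k); apply/funext => x.
  rewrite cubic_id//; apply: sqr_bound_norm; exact: Phi_bound.
have tt : 0 <= t <= t by rewrite t0 lexx.
have zero := oscillators_zero (lam_gt0 L0) (source_lipschitz_cst_ge0 L0 K0) (oscillators_sub osc osc')
  _ _ _ tt (T := t) (C := 2 * (C + C')).
have [p1 m1] := L1 t t0; have [p2 m2] := L1' t t0.
apply: (coef_inj L0 p1 p2) => [|k]; first by rewrite m1 m2.
apply/eqP; rewrite -subr_eq0; apply/eqP; have [] := zero _ _ _ k => //.
- move=> j; have z0 := lexx (0 : R).
  rewrite (coef_ae j (L1 0 z0).1 l0 i0) (coef_ae j (L1' 0 z0).1 l0 i0').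
  by rewrite (coef_ae j L2 l1 i1) (coef_ae j L2' l1 i1') !subrr.
- move=> s sT N; apply: le_trans (energy_sub_le _ _ _ _ _ _ (fun k => lam_ge0 L0 k)) _.
  by rewrite ler_pM2l//; apply: lerD; [exact: hC|exact: hC'].
- move=> s /andP[s0 st] S0 hS N.
  have sT : 0 <= s <= t by rewrite !ltW.
  under eq_bigr do rewrite (srcE (coef (phi s)) (fun N => eC s N sT))
    (srcE (coef (psi s)) (fun N => eC' s N sT)).
  by apply: source_lipschitz => //; [exact: fa (ltW s0)|exact: fa' (ltW s0)].
Qed.

End Uniqueness.

Theorem theorem1p3 (R : realType) (L : R) (hL : 0 < L < 2 * pi)
    (phi0 phi1 : R -> R) (hY : Y_space L (phi0, phi1)) :
  exists phi : R -> R -> R,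
    global_weak_solution L phi0 phi1 phi /\
    (forall phi' : R -> R -> R, global_weak_solution L phi0 phi1 phi' ->
       forall t : R, 0 <= t -> eq_ae (phi' t) (phi t)).
Proof.
have [phi hphi] := global_solution_exists hL hY; exists phi; split=> // phi' hphi' t t0.
have /andP[L0 _] := hL.
exact: (solution_unique L0 hY hphi' hphi t0).
Qed.
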